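(* Let $z^0\in\Delta$ and let $p_1,\dots,p_d$ be a list of all distinct isolated critical points of the master function $\Phi(z^0,\cdot)$ on $U(\mathcal A(z^0))$. Then the sum of the Milnor numbers of the critical points $p_1,\dots,p_d$ is not greater than the rank of the contravariant form $S^{(a)}|_{\operatorname{Sing}\mathcal F^k(z^0)}$.
   Context: Let $0<k<n$ be integers and $J=\{1,\dots,n\}$. Fix nonzero linear functions $g_j=b_j^1t_1+\dots+b_j^kt_k$, $j\in J$, on $\mathbb C^k$ ($b_j^i\in\mathbb C$) spanning the dual space of $\mathbb C^k$, and nonzero complex weights $a=(a_j)_{j\in J}$. For $z\in\mathbb C^n$ put $f_j(z,t)=z_j+g_j(t)$, $H_j(z)=\{t\in\mathbb C^k: f_j(z,t)=0\}$; $\mathcal A(z)=(H_j(z))_{j\in J}$ is an arrangement in $\mathbb C^k$ with complement $U(\mathcal A(z))=\mathbb C^k\setminus\bigcup_jH_j(z)$. The (multivalued) master function is $\Phi(z,t)=\sum_ja_j\log f_j(z,t)$; its critical points in $t$ are the points of $U(\mathcal A(z))$ where all $\partial\Phi/\partial t_i$ vanish. The Milnor number of an isolated critical point $p$ is the dimension of the quotient of the algebra of germs at $p$ of holomorphic functions by the ideal generated by the $\partial\Phi/\partial t_i$, $i=1,\dots,k$. A circuit is a subset $C\subset J$ such that $(g_i)_{i\in C}$ is linearly dependent while every proper subset is linearly independent. For each circuit $C$ fix numbers $(\lambda^C_i)_{i\in C}$, not all zero, with $\sum_{i\in C}\lambda_i^Cg_i=0$; put $f_C(z)=\sum_{i\in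 C}\lambda_i^Cz_i$; $\Delta\subset\mathbb C^n$ is the union of the hyperplanes $\{f_C=0\}$ over all circuits. For $z\in\mathbb C^n$ let $\omega_j(z)=dg_j/f_j(z,\cdot)$, a form on $U(\mathcal A(z))$; $\mathrm{OS}^p(z)$ is the complex span of all $\omega_{j_1}(z)\wedge\dots\wedge\omega_{j_p}(z)$ ($\mathrm{OS}^0=\mathbb C$; this is the degree $p$ part of the Orlik–Solomon algebra), $\mathcal F^k(z)=\mathrm{OS}^k(z)^*$, and $\operatorname{Sing}\mathcal F^k(z)$ is the annihilator of $\nu\wedge\mathrm{OS}^{k-1}(z)$, where $\nu=\sum_ja_j\omega_j(z)$. The contravariant form on $\mathcal F^k(z)$ is the symmetric bilinear form $$S^{(a)}(F_1,F_2)=\sum_{\{j_1,\dots,j_k\}\subset J}a_{j_1}\cdots a_{j_k}\langle\omega_{j_1}(z)\wedge\dots\wedge\omega_{j_k}(z),F_1\rangle\langle\omega_{j_1}(z)\wedge\dots\wedge\omega_{j_k}(z),F_2\rangle,$$ the sum being over all unordered $k$-element subsets of $J$. *)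

(* Defs.v *)
From HB Require Import structures.
From mathcomp Require Import all_boot all_order all_algebra.
From mathcomp Require Import complex.
From mathcomp Require Import all_classical all_reals all_analysis.
Set Implicit Arguments.
Unset Strict Implicit.
Unset Printing Implicit Defensive.
Import Order.TTheory GRing.Theory Num.Theory.
Import numFieldNormedType.Exports.
Local Open Scope classical_set_scope.
Local Open Scope complex_scope.
Local Open Scope ring_scope.

(* [R[i]] comes with a structure of module over [R]; as a module over itself it
   is written [R[i]^o], whose topology is transferred to [R[i]] here. *)
HB.instance Definition _ (R : realType) := PseudoPointedMetric.copy R[i] R[i]^o.

Section LinearAlgebra.
Variables (K : fieldType) (V : lmodType K).

(* For a subspace [A] of [V] and a subspace [I] of [A], the classes of
   [e_0, ..., e_(m-1)] form a basis of the quotient [A / I]. *)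
Definition basis_mod (A I : set V) (m : nat) (e : 'I_m -> V) : Prop :=
  [/\ forall i, A (e i),
      forall v, A v -> exists c : 'I_m -> K, I (v - \sum_i c i *: e i) &
      forall c : 'I_m -> K, I (\sum_i c i *: e i) -> forall i, c i = 0].

Definition has_quotient_dim (A I : set V) (m : nat) : Prop :=
  exists e : 'I_m -> V, basis_mod A I e.

(* The rank of the restriction of a bilinear form to a finite-dimensional
   subspace is the rank of its matrix in a basis of that subspace. *)
Definition has_form_rank (W : set V) (S : V -> V -> K) (r : nat) : Prop :=
  exists (m : nat) (e : 'I_m -> V),
    basis_mod W [set 0] e /\ \rank (\matrix_(i, j) S (e i) (e j)) = r.

End LinearAlgebra.

Section ComplexAnalysis.
Variables (R : realType) (k : nat).

Definition expC (w : R[i]) : R[i] :=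
  (expR (complex.Re w))%:C * (cos (complex.Im w) +i* sin (complex.Im w)).

(* [differentiable] is Frechet differentiability over the base field, here
   [R[i]], so this says that [h] is holomorphic in a neighbourhood of [p]. *)
Definition holomorphic_near (p : 'rV[R[i]]_k) (h : 'rV[R[i]]_k -> R[i]^o) :
    Prop :=
  \forall q \near p, differentiable h q.

Definition partial (i : 'I_k) (h : 'rV[R[i]]_k -> R[i]^o) (q : 'rV[R[i]]_k) :
    R[i] :=
  'D_(delta_mx 0 i) h q.

(* Germs at [p] are represented by functions; this ideal contains every
   function vanishing near [p], so that the quotient of [holomorphic_near p]
   by it is the quotient of the algebra of germs by the ideal generated by the
   germs of the [d i]. *)
Definition germ_ideal (p : 'rV[R[i]]_k) (d : 'I_k -> 'rV[R[i]]_k -> R[i]) :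
    set ('rV[R[i]]_k -> R[i]^o) :=
  [set h | exists g : 'I_k -> 'rV[R[i]]_k -> R[i]^o,
     (forall i, holomorphic_near p (g i)) /\
     \forall q \near p, h q = \sum_i g i q * d i q].

End ComplexAnalysis.

(* [row j b] is the vector of coefficients of the linear function [g_j]; linear
   relations between the [g_j] are relations between these rows. *)
Section Arrangement.
Variables (R : realType) (n k : nat) (b : 'M[R[i]]_(n, k)).

Definition glin (j : 'I_n) (t : 'rV[R[i]]_k) : R[i] :=
  \sum_(i < k) b j i * t 0 i.

Definition faff (z : 'rV[R[i]]_n) (j : 'I_n) (t : 'rV[R[i]]_k) : R[i] :=
  z 0 j + glin j t.

Definition arr_compl (z : 'rV[R[i]]_n) : set 'rV[R[i]]_k :=
  [set t | forall j, faff z j t != 0].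

Definition indep (A : {set 'I_n}) : bool := free [seq row j b | j <- enum A].

Definition circuit (A : {set 'I_n}) : bool :=
  ~~ indep A && [forall B : {set 'I_n}, (B \proper A) ==> indep B].

Definition circuit_coefs (lam : {set 'I_n} -> 'I_n -> R[i]) : Prop :=
  forall A, circuit A ->
    (exists2 i, i \in A & lam A i != 0) /\
    \sum_(i in A) lam A i *: row i b = 0.

Definition discriminant (lam : {set 'I_n} -> 'I_n -> R[i]) :
    set 'rV[R[i]]_n :=
  [set z | exists2 A, circuit A & \sum_(i in A) lam A i * z 0 i = 0].

End Arrangement.

Section MasterFunction.
Variables (R : realType) (n k : nat) (b : 'M[R[i]]_(n, k)).
Variables (a : 'I_n -> R[i]) (z : 'rV[R[i]]_n).

(* [phi] is, near [p], a branch of the multivalued function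
   [\sum_j a_j log f_j(z, .)]: [L j] is a holomorphic branch of [log f_j]. *)
Definition master_branch (p : 'rV[R[i]]_k) (phi : 'rV[R[i]]_k -> R[i]^o) :
    Prop :=
  exists L : 'I_n -> 'rV[R[i]]_k -> R[i]^o,
    [/\ forall j, holomorphic_near p (L j),
        forall j, \forall t \near p, expC (L j t) = faff b z j t &
        \forall t \near p, phi t = \sum_j a j * L j t].

(* Branches exist near every point of the complement and differ by locally
   constant functions, so the choice of [phi] below is irrelevant. *)
Definition critical (p : 'rV[R[i]]_k) : Prop :=
  arr_compl b z p /\
  exists2 phi, master_branch p phi & forall i, partial i phi p = 0.

Definition isolated_critical (p : 'rV[R[i]]_k) : Prop :=
  critical p /\ \forall q \near p^', ~ critical q.

Definition has_milnor_number (p : 'rV[R[i]]_k) (m : nat) : Prop :=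
  exists2 phi, master_branch p phi &
    has_quotient_dim (holomorphic_near p)
      (germ_ideal p (fun i => partial i phi)) m.

End MasterFunction.

Section OrlikSolomon.
Variables (R : realType) (n k : nat) (b : 'M[R[i]]_(n, k)).
Variables (a : 'I_n -> R[i]) (z : 'rV[R[i]]_n).

(* A [p]-form on the complement, evaluated at a point and at the [p] tangent
   vectors which are the rows of a matrix. *)
Definition diff_form (p : nat) : Type :=
  arr_compl b z -> 'M[R[i]]_(p, k) -> R[i]^o.
HB.instance Definition _ p := GRing.Lmodule.on (diff_form p).

Definition wedge1 (p : nat) (al : diff_form 1) (be : diff_form p.-1) :
    diff_form p :=
  fun t v => \sum_(i < p) (-1) ^+ i * al t (row i v) * be t (row' i v).

Fixpoint wedges (p : nat) : ('I_p -> diff_form 1) -> diff_form p :=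
  match p with
  | 0 => fun _ _ _ => 1
  | p'.+1 => fun al =>
      @wedge1 p'.+1 (al ord0) (wedges (fun i => al (lift ord0 i)))
  end.

(* The differential of the linear function [g_j] is [g_j] itself. *)
Definition omega (j : 'I_n) : diff_form 1 :=
  fun t v => glin b j v / faff b z j (\val t).

Definition omegas (p : nat) (s : p.-tuple 'I_n) : diff_form p :=
  wedges (fun i => omega (tnth s i)).

Definition OS (p : nat) : set (diff_form p) :=
  [set w | exists c : p.-tuple 'I_n -> R[i], w = \sum_s c s *: omegas s].

Definition nu : diff_form 1 := \sum_j a j *: omega j.

(* The dual space of [OS p]; a linear function on [OS p] is represented by its
   extension by zero to all forms. *)
Definition flag_space (p : nat) : set (diff_form p -> R[i]^o) :=
  [set F | (forall (c : R[i]) w1 w2, OS w1 -> OS w2 ->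
              F (c *: w1 + w2) = c * F w1 + F w2) /\
           (forall w, ~ OS w -> F w = 0)].

Definition sing_space (p : nat) : set (diff_form p -> R[i]^o) :=
  [set F | flag_space F /\
           forall eta : diff_form p.-1, OS eta -> F (wedge1 nu eta) = 0].

(* The [p]-element subsets of the index set are the increasing [p]-tuples. *)
Definition contravariant_form (p : nat) (F1 F2 : diff_form p -> R[i]^o) :
    R[i] :=
  \sum_(s : p.-tuple 'I_n | sorted ltn [seq val j | j <- s])
    (\prod_(j <- s) a j) * F1 (omegas s) * F2 (omegas s).

End OrlikSolomon.

(* Main.v *)
Require Import Defs.
From HB Require Import structures.
From mathcomp Require Import all_boot all_order all_algebra.
From mathcomp Require Import perm complex.
From mathcomp Require Import all_classical all_reals all_analysis.
From mathcomp Require Import ring lra.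
Set Implicit Arguments.
Unset Strict Implicit.
Unset Printing Implicit Defensive.
Import Order.TTheory GRing.Theory Num.Theory.
Import numFieldNormedType.Exports.
Local Open Scope classical_set_scope.
Local Open Scope complex_scope.
Local Open Scope ring_scope.

(** Write [h i] for the [i]-th partial derivative of the master function, so that
    [h i t = \sum_j a j * b j i / f_j t], and [I_p] for the ideal which the [h i]
    generate in the algebra [O_p] of germs at a critical point [p].  On the unit
    multivector the form [omegas s] has the coefficient
    [d_s t = minor b s / \prod_i f_(s i) t].

    The link between the two sides of the inequality is the Bezoutian of the
    system [h]: the explicit matrix [bezout x y] satisfies
    [h y - h x = bezout x y *m (y - x)], and by the Cauchy-Binet formula its
    determinant is, up to the sign [(-1) ^+ k], the contravariant form
    [\sum_s (\prod_(j <- s) a j) * d_s x * d_s y] read as a function of two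
    points ([det_bezout]).

    For a linear functional [ell] vanishing on [I_p], put
    [T phi = \sum_s (\prod_(j <- s) a j) * ell (phi * d_s) * d_s].  By Cramer's rule
    [(y - x) 0 l * \det (bezout x y)] is a combination of the [h i y - h i x]; hence
    multiplying [T phi] by a coordinate or multiplying [phi] by it amounts to the
    same modulo the ideal of every point of the complement ([transform_shift]).
    If [ell] takes the value [1] on [\det (bezout p _)], then [T 1] does not vanish
    at [p].  As the [d_s] span a space of finite dimension, this makes the
    coordinates centred at [p] nilpotent modulo [I_p], so that by Hadamard's lemma
    finitely many of the [T phi] span [O_p] modulo [I_p] ([transform_span]), and
    it makes every [T phi] belong to the ideals of all other critical points
    ([transform_elsewhere]).

    Now choose at each [p_i] a basis of [O_(p_i) / I_(p_i)] of the form
    [T_i phi_(i, j)], together with functionals [lam_(i, j)] vanishing on [I_(p_i)]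
    and dual to this basis.  A functional vanishing on [I_p] defines an element of
    [Sing], because the coefficient of [nu] wedge any form is a combination of the
    [h i].  In this way [ell_i (phi_(i, j) * _)] defines [F_(i, j)], and
    [lam_(i, j)] defines [G_(i, j)].  The contravariant form of [F_(i, j)] and
    [G_(i', j')] is [lam_(i', j') (T_i phi_(i, j))], which is [1] if the indices
    agree and [0] otherwise.  So the Gram matrix factors an identity matrix whose
    size is the sum of the Milnor numbers.

    The functional [ell] exists because [\det (bezout p _)] is not in [I_p].  This
    is the one point where it matters that [p] is isolated ([det_notin_ideal]):
    a Jacobian homotopy compares a cut-off multiple of [\det B * conj (\det (dh))],
    where [h = B x], with a function of positive integral, whereas an element of
    the ideal would give an exact divergence.  The integrals are replaced by sums
    over finer and finer lattices, which only requires the first-order expansion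
    of holomorphic functions with a quadratic remainder.  That expansion and
    Hadamard's lemma come from Cauchy's formula in one variable, for which the
    integral over a circle is replaced by a limit, along an ultrafilter, of
    averages over roots of unity. *)

(** * Moduli, norms and complex gradients *)

Section Modulus.
Variable R : realType.
Implicit Types z w : R[i].

(** The norm of [R[i]] takes its values in [R[i]]; estimates are made in [R]. *)
Definition cabs z : R := complex.Re `|z|.

Lemma cabsE z : `|z| = (cabs z)%:C.
Proof. by rewrite /cabs normc_def. Qed.

Lemma cabs_ge0 z : 0 <= cabs z.
Proof. by rewrite -lecR -cabsE normr_ge0. Qed.

Lemma cabs0 : cabs 0 = 0.
Proof. by rewrite /cabs normr0. Qed.

Lemma cabs1 : cabs 1 = 1.
Proof. by rewrite /cabs normr1. Qed.

Lemma cabs_eq0 z : (cabs z == 0) = (z == 0).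
Proof. by rewrite -(inj_eq (@complexI R)) -cabsE (normr_eq0 z). Qed.

Lemma cabs_gt0 z : (0 < cabs z) = (z != 0).
Proof. by rewrite lt0r cabs_ge0 andbT cabs_eq0. Qed.

Lemma cabsM z w : cabs (z * w) = cabs z * cabs w.
Proof. by apply: complexI; rewrite -cabsE normrM !cabsE rmorphM. Qed.

Lemma cabsX z m : cabs (z ^+ m) = cabs z ^+ m.
Proof. by apply: complexI; rewrite -cabsE normrX !cabsE rmorphXn. Qed.

Lemma cabsV z : cabs z^-1 = (cabs z)^-1.
Proof. by apply: complexI; rewrite -cabsE normfV cabsE fmorphV. Qed.

Lemma cabsN z : cabs (- z) = cabs z.
Proof. by rewrite /cabs normrN. Qed.

Lemma cabsB z w : cabs (z - w) = cabs (w - z).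
Proof. by rewrite /cabs distrC. Qed.

Lemma cabsD z w : cabs (z + w) <= cabs z + cabs w.
Proof. by rewrite -lecR rmorphD -!cabsE ler_normD. Qed.

Lemma cabsBD z w : cabs (z - w) <= cabs z + cabs w.
Proof. by rewrite -(cabsN w) cabsD. Qed.

Lemma cabs_real (x : R) : cabs x%:C = `|x|.
Proof. by apply: complexI; rewrite -cabsE normc_def /= expr0n /= addr0 sqrtr_sqr. Qed.

Lemma cabs_i : cabs 'i%C = 1.
Proof. by apply: complexI; rewrite -cabsE normc_def /= expr0n expr1n /= add0r sqrtr1. Qed.

Lemma cabs_conj z : cabs (conjc z) = cabs z.
Proof. by rewrite /cabs normcJ. Qed.

Lemma conjcM z w : conjc (z * w) = conjc z * conjc w.
Proof. exact: rmorphM. Qed.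

Lemma realcM (x y : R) : (x * y)%:C = x%:C * y%:C :> R[i].
Proof. exact: rmorphM. Qed.

Lemma cabs_sum (I : Type) (s : seq I) (P : pred I) (F : I -> R[i]) :
  cabs (\sum_(i <- s | P i) F i) <= \sum_(i <- s | P i) cabs (F i).
Proof.
elim/big_ind2 : _ => [|x u y v xu yv|//]; first by rewrite cabs0.
by apply: le_trans (cabsD _ _) _; rewrite lerD.
Qed.

Lemma unit_telescope (T : R -> R[i]) (S : nat) : 0 < S%:R :> R ->
  T 1 - T 0 = \sum_(j < S) (T (j.+1%:R / S%:R) - T (j%:R / S%:R)).
Proof.
move=> S0; rewrite -(big_mkord xpredT (fun j => T (j.+1%:R / S%:R) - T (j%:R / S%:R))).
by rewrite (telescope_sumr (fun j => T (j%:R / S%:R)))// divff ?gt_eqF// mul0r.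
Qed.

Lemma Re_le_cabs z : `|complex.Re z| <= cabs z.
Proof. by rewrite -lecR -cabsE; apply: le_trans (normc_ge_Re z). Qed.

Lemma Im_le_cabs z : `|complex.Im z| <= cabs z.
Proof.
have := Re_le_cabs (z * 'i%C); rewrite cabsM cabs_i mulr1.
by case: z => x y /=; rewrite mulr0 mulr1 sub0r normrN.
Qed.

Lemma cabs_le_ReIm z : cabs z <= `|complex.Re z| + `|complex.Im z|.
Proof.
rewrite {1}(complexE z); apply: le_trans (cabsD _ _) _.
by rewrite cabsM cabs_i mul1r !cabs_real.
Qed.

Lemma sqr_cabs z : (cabs z ^+ 2)%:C = z * conjc z.
Proof. by rewrite rmorphXn /= -cabsE sqr_normc. Qed.

End Modulus.

Section VectorModulus.
Variables (R : realType) (k : nat).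
Implicit Types v w : 'rV[R[i]]_k.

(** The sum norm, for which coordinates and directional steps have exact norms. *)
Definition vabs v : R := \sum_l cabs (v 0 l).

Lemma vabs_ge0 v : 0 <= vabs v.
Proof. by apply: sumr_ge0 => l _; apply: cabs_ge0. Qed.

Lemma vabs0 : vabs 0 = 0.
Proof. by apply: big1 => l _; rewrite mxE cabs0. Qed.

Lemma vabs_coord v l : cabs (v 0 l) <= vabs v.
Proof. by rewrite /vabs (bigD1 l)//= lerDl sumr_ge0// => ? _; apply: cabs_ge0. Qed.

Lemma vabs_eq0 v : vabs v = 0 -> v = 0.
Proof.
move=> v0; apply/rowP => l; rewrite mxE; apply/eqP; rewrite -cabs_eq0.
by rewrite eq_le cabs_ge0 andbT -v0 vabs_coord.
Qed.

Lemma vabsD v w : vabs (v + w) <= vabs v + vabs w.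
Proof. by rewrite /vabs -big_split ler_sum// => l _; rewrite mxE cabsD. Qed.

Lemma vabsZ (c : R[i]) v : vabs (c *: v) = cabs c * vabs v.
Proof. by rewrite /vabs mulr_sumr; apply: eq_bigr => l _; rewrite mxE cabsM. Qed.

Lemma vabsN v : vabs (- v) = vabs v.
Proof. by apply: eq_bigr => l _; rewrite mxE cabsN. Qed.

Lemma vabsB v w : vabs (v - w) = vabs (w - v).
Proof. by rewrite -vabsN opprB. Qed.

Lemma vabs_delta (c : R[i]) (l : 'I_k) : vabs (c *: delta_mx 0 l) = cabs c.
Proof.
rewrite vabsZ /vabs (bigD1 l)//= mxE !eqxx cabs1 big1 ?addr0 ?mulr1// => m ml.
by rewrite mxE eqxx (negbTE ml) cabs0.
Qed.

Lemma norm_le_vabs v : `|v| <= (vabs v)%:C.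
Proof.
suff H (x : R[i]) : x = mx_norm v -> x <= (vabs v)%:C by exact: (H `|v|).
have [v0 ->|/mx_norm_neq0[[i l] /= ->] ->] := eqVneq (mx_norm v) 0.
  by rewrite v0 ler0c vabs_ge0.
by rewrite (ord1 i) cabsE lecR vabs_coord.
Qed.

Lemma vabs_le_norm v : (vabs v)%:C <= k%:R * `|v|.
Proof.
have -> : k%:R * `|v| = \sum_(l < k) `|v| by rewrite sumr_const card_ord mulr_natl.
rewrite /vabs rmorph_sum /=; apply: ler_sum => l _; rewrite -cabsE.
suff H (x : R[i]) : x = mx_norm v -> `|v 0 l| <= x by exact: (H `|v|).
move=> ->; rewrite /mx_norm -[leLHS]nngE num_le.
exact: (le_bigmax _ (fun i : 'I_1 * 'I_k => `|v i.1 i.2|%:nng) (0, l)).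
Qed.

Lemma near_vabsP (p : 'rV[R[i]]_k) (P : 'rV[R[i]]_k -> Prop) :
  (\forall q \near p, P q) <->
  exists2 r : R, 0 < r & forall q, vabs (q - p) < r -> P q.
Proof.
split=> [/nbhs_ballP[e /= e0 eP]|[r r0 rP]].
  have e1 : 0 < complex.Re e by move: e0; rewrite ltcE => /andP[].
  have eE : e = (complex.Re e)%:C by rewrite RRe_real// realE ltW.
  exists (complex.Re e) => // q qp; apply: eP; split=> // i l; rewrite (ord1 i).
  change (`|p 0 l - q 0 l| < e); rewrite eE cabsE ltcR cabsB; apply: le_lt_trans qp.
  by have := vabs_coord (q - p) l; rewrite !mxE.
have k1 : 0 < k.+1%:R :> R by [].
apply/nbhs_ballP; exists (r / k.+1%:R)%:C; first by rewrite /= ltcR divr_gt0.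
move=> q [_ pq]; apply: rP; apply: (@le_lt_trans _ _ (\sum_(l < k) (r / k.+1%:R))).
  apply: ler_sum => l _; have : `|p 0 l - q 0 l| < (r / k.+1%:R)%:C := pq 0 l.
  rewrite cabsE ltcR.
  by rewrite cabsB !mxE => /ltW.
rewrite sumr_const card_ord -[ltLHS]mulr_natl mulrCA gtr_pMr// ltr_pdivrMr// mul1r.
by rewrite ltr_nat.
Qed.

End VectorModulus.

Section ComplexDerivative.
Variables (R : realType) (k : nat).
Implicit Types (f : 'rV[R[i]]_k -> R[i]^o) (d : 'I_k -> R[i]).

Definition pairing d (v : 'rV[R[i]]_k) : R[i] := \sum_l d l * v 0 l.

Lemma pairingD d v w : pairing d (v + w) = pairing d v + pairing d w.
Proof. by rewrite -big_split; apply: eq_bigr => l _; rewrite mxE mulrDr. Qed.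

Lemma pairingZ d c v : pairing d (c *: v) = c * pairing d v.
Proof. by rewrite mulr_sumr; apply: eq_bigr => l _; rewrite mxE mulrCA. Qed.

Lemma pairing_delta d l : pairing d (delta_mx 0 l) = d l.
Proof.
rewrite /pairing (bigD1 l)//= mxE !eqxx mulr1 big1 ?addr0// => m ml.
by rewrite mxE eqxx (negbTE ml) mulr0.
Qed.

Lemma pairing_bound d : exists2 M : R, 0 < M & forall v, cabs (pairing d v) <= M * vabs v.
Proof.
have s0 : 0 <= \sum_l cabs (d l) by apply: sumr_ge0 => l _; apply: cabs_ge0.
exists (1 + \sum_l cabs (d l)) => [|v]; first by rewrite ltr_pwDl.
apply: le_trans (cabs_sum _ _ _) _; rewrite /vabs mulr_sumr ler_sum// => l _.
rewrite cabsM ler_wpM2r ?cabs_ge0// (bigD1 l)//= addrCA lerDl addr_ge0//.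
by apply: sumr_ge0 => m _; apply: cabs_ge0.
Qed.

(** Frechet differentiability, with a modulus in [R] instead of in the partially
    ordered field [R[i]]. *)
Definition has_gradient f q d := forall e : R, 0 < e ->
  exists2 r : R, 0 < r & forall v, vabs v < r ->
    cabs (f (q + v) - f q - pairing d v) <= e * vabs v.

Lemma gtr0_realpart (e : R[i]) : 0 < e -> 0 < complex.Re e /\ e = (complex.Re e)%:C.
Proof.
move=> e0; have : 0 < complex.Re e by move: e0; rewrite ltcE => /andP[].
by split=> //; rewrite RRe_real// realE ltW.
Qed.

Lemma gradient_differentiable f q d : has_gradient f q d ->
  differentiable f q /\ forall v, 'D_v f q = pairing d v.
Proof.
move=> fd.
have plin : linear (pairing d : 'rV[R[i]]_k -> R[i]^o).
  by move=> c u v; rewrite pairingD pairingZ.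
pose L : {linear 'rV[R[i]]_k -> R[i]^o} := HB.pack (pairing d : 'rV[R[i]]_k -> R[i]^o)
  (GRing.isLinear.Build _ _ _ _ (pairing d : 'rV[R[i]]_k -> R[i]^o) plin).
have [M M0 dM] := pairing_bound d.
have Lc : continuous L.
  apply: bounded_linear_continuous; apply/ex_bound; exists M%:C.
  apply/near_vabsP; exists 1 => // v; rewrite subr0 => v1 /=.
  rewrite [leLHS]cabsE lecR (le_trans (dM v))// ger_pMr// ltW//.
have fL : f \o shift q = cst (f q) + L +o_ (0 : 'rV[R[i]]_k) id.
  apply/eqaddoP => e e0; have [e1 eE] := gtr0_realpart e0.
  have k1 : 0 < k.+1%:R :> R by [].
  have [|r r0 rf] := fd (complex.Re e / k.+1%:R); first by rewrite divr_gt0.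
  apply/near_vabsP; exists r => // v; rewrite subr0 => vr.
  rewrite [X in `|X|](_ : _ = f (q + v) - f q - pairing d v); last first.
    by change (f (v + q) - (f q + pairing d v) = f (q + v) - f q - pairing d v); rewrite [v + q]addrC opprD addrA.
  rewrite [leLHS]cabsE; apply: (@le_trans _ _ (complex.Re e / k.+1%:R * vabs v)%:C).
    by rewrite lecR rf.
  rewrite -mulrA rmorphM /= -eE ler_wpM2l//; first exact: ltW.
  rewrite rmorphM /= fmorphV rmorph_nat ler_pdivrMl ?ltr0n//.
  by apply: le_trans (vabs_le_norm v) _; rewrite ler_wpM2r ?ler_nat.
have [df Ed] : differentiable f q /\ 'd f q = L :> ('rV[R[i]]_k -> R[i]^o).
  have Ed := diff_unique Lc fL.
  split; last exact: Ed.
  by apply/diff_locallyP; rewrite Ed; split; [exact: Lc|exact: fL].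
by split=> // v; rewrite deriveE// Ed.
Qed.

Lemma differentiable_gradient f q : differentiable f q ->
  has_gradient f q (fun l => 'D_(delta_mx 0 l) f q).
Proof.
move=> df e e0.
have dE v : 'd f q v = pairing (fun l => 'D_(delta_mx 0 l) f q) v.
  rewrite [in LHS](matrix_sum_delta v) big_ord1 linear_sum; apply: eq_bigr => l _.
  by rewrite linearZ /= deriveE// mulrC.
have /eqaddoP/(_ e%:C) := diff_locally df; rewrite ltcR => /(_ e0).
move=> /near_vabsP[r r0 rf]; exists r => // v vr.
have := rf v; rewrite subr0 => /(_ vr).
rewrite [X in `|X|](_ : _ = f (q + v) - f q - 'd f q v); last first.
  by change (f (v + q) - (f q + 'd f q v) = f (q + v) - f q - 'd f q v); rewrite [v + q]addrC opprD addrA.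
rewrite [leLHS]cabsE dE => /le_trans fv; rewrite -lecR; apply: fv.
by rewrite rmorphM /= ler_wpM2l ?norm_le_vabs// ler0c ltW.
Qed.

End ComplexDerivative.

(** * Expansions with a quadratic remainder *)

Section C11.
Variables (R : realType) (X : Type) (adm : X -> X -> Prop) (sz : X -> X -> R).
Hypothesis sz01 : forall x y, adm x y -> 0 <= sz x y <= 1.
Implicit Types (f g : X -> R[i]) (d : X -> X -> R[i]).

(** A function with a first-order expansion whose remainder is quadratic,
    uniformly over the admissible pairs; [d x y] is the linear part between [x]
    and [y], of size [sz x y].  Keeping the set and the admissible pairs abstract
    lets the same rules serve several complex variables, one real homotopy
    parameter, and functions depending on a point of a circle. *)
Definition C11 f d := exists2 M : R, 0 <= M & forall x y, adm x y ->
  [/\ cabs (f y - f x - d x y) <= M * sz x y ^+ 2,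
      cabs (f x) <= M, cabs (f y) <= M & cabs (d x y) <= M * sz x y].

Lemma C11_ext f d f' d' : C11 f d -> (forall x y, adm x y ->
   [/\ f' x = f x, f' y = f y & d' x y = d x y]) -> C11 f' d'.
Proof.
move=> [M M0 fM] E; exists M => // x y xy; have [-> -> ->] := E _ _ xy.
exact: fM.
Qed.

Lemma C11_cst c : C11 (fun=> c) (fun _ _ => 0).
Proof.
exists (cabs c) => [|x y xy]; first exact: cabs_ge0.
have /andP[s0 s1] := sz01 xy.
by rewrite subrr subr0 cabs0; split=> //; rewrite mulr_ge0 ?cabs_ge0// exprn_ge0.
Qed.

Lemma C11D f1 d1 f2 d2 : C11 f1 d1 -> C11 f2 d2 ->
  C11 (fun x => f1 x + f2 x) (fun x y => d1 x y + d2 x y).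
Proof.
move=> [M M0 fM] [N N0 fN]; exists (M + N) => [|x y xy]; first exact: addr_ge0.
have [a1 a2 a3 a4] := fM _ _ xy; have [b1 b2 b3 b4] := fN _ _ xy.
split; [|by apply: le_trans (cabsD _ _) _; rewrite ?mulrDl lerD..].
rewrite (_ : _ - _ = (f1 y - f1 x - d1 x y) + (f2 y - f2 x - d2 x y)); last by ring.
by apply: le_trans (cabsD _ _) _; rewrite ?mulrDl lerD.
Qed.

Lemma C11_conj f d : C11 f d -> C11 (fun x => conjc (f x)) (fun x y => conjc (d x y)).
Proof.
move=> [M M0 fM]; exists M => // x y xy; have [] := fM _ _ xy.
by rewrite -!(rmorphB (@conjc R)) !cabs_conj.
Qed.

Lemma C11M f1 d1 f2 d2 : C11 f1 d1 -> C11 f2 d2 ->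
  C11 (fun x => f1 x * f2 x) (fun x y => d1 x y * f2 x + f1 x * d2 x y).
Proof.
move=> [M M0 fM] [N N0 fN].
exists (6 * M * N) => [|x y xy]; first by rewrite !mulr_ge0.
have /andP[s0 s1] := sz01 xy.
have [a1 a2 a3 a4] := fM _ _ xy; have [b1 b2 b3 b4] := fN _ _ xy.
have s2 : sz x y ^+ 2 <= sz x y by rewrite expr2 ler_piMr.
have MN : 0 <= M * N by rewrite mulr_ge0.
have a5 : cabs (f1 y - f1 x) <= 2 * M * sz x y.
  rewrite (_ : f1 y - f1 x = (f1 y - f1 x - d1 x y) + d1 x y); last by ring.
  apply: le_trans (cabsD _ _) _.
  have : M * sz x y ^+ 2 <= M * sz x y by rewrite ler_wpM2l.
  lra.
have b5 : cabs (f2 y - f2 x) <= 2 * N * sz x y.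
  rewrite (_ : f2 y - f2 x = (f2 y - f2 x - d2 x y) + d2 x y); last by ring.
  apply: le_trans (cabsD _ _) _.
  have : N * sz x y ^+ 2 <= N * sz x y by rewrite ler_wpM2l.
  lra.
split.
- rewrite (_ : _ - _ = (f1 y - f1 x) * (f2 y - f2 x) + (f1 y - f1 x - d1 x y) * f2 x
     + f1 x * (f2 y - f2 x - d2 x y)); last by ring.
  apply: le_trans (cabsD _ _) _; apply: le_trans (lerD (cabsD _ _) (lexx _)) _.
  rewrite !cabsM.
  have h1 : cabs (f1 y - f1 x) * cabs (f2 y - f2 x) <= (2 * M * sz x y) * (2 * N * sz x y).
    by apply: ler_pM; rewrite ?cabs_ge0.
  have h2 : cabs (f1 y - f1 x - d1 x y) * cabs (f2 x) <= (M * sz x y ^+ 2) * N.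
    by apply: ler_pM; rewrite ?cabs_ge0.
  have h3 : cabs (f1 x) * cabs (f2 y - f2 x - d2 x y) <= M * (N * sz x y ^+ 2).
    by apply: ler_pM; rewrite ?cabs_ge0.
  apply: le_trans (lerD (lerD h1 h2) h3) _.
  by rewrite le_eqVlt; apply/orP; left; apply/eqP; ring.
- rewrite cabsM; apply: (@le_trans _ _ (M * N)); first by apply: ler_pM; rewrite ?cabs_ge0.
  by rewrite -mulrA; lra.
- rewrite cabsM; apply: (@le_trans _ _ (M * N)); first by apply: ler_pM; rewrite ?cabs_ge0.
  by rewrite -mulrA; lra.
- apply: le_trans (cabsD _ _) _; rewrite !cabsM.
  have h1 : cabs (d1 x y) * cabs (f2 x) <= (M * sz x y) * N.
    by apply: ler_pM; rewrite ?cabs_ge0.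
  have h2 : cabs (f1 x) * cabs (d2 x y) <= M * (N * sz x y).
    by apply: ler_pM; rewrite ?cabs_ge0.
  have : 0 <= M * N * sz x y by rewrite mulr_ge0.
  lra.
Qed.

Lemma C11_sum (I : Type) (r : seq I) (F : I -> X -> R[i]) (D : I -> X -> X -> R[i]) :
  (forall i, C11 (F i) (D i)) ->
  C11 (fun x => \sum_(i <- r) F i x) (fun x y => \sum_(i <- r) D i x y).
Proof.
move=> FD; elim: r => [|i r IHr].
  by apply: C11_ext (C11_cst 0) _ => x y _; rewrite !big_nil.
by apply: C11_ext (C11D (FD i) IHr) _ => x y _; rewrite !big_cons.
Qed.

Lemma C11_prod (I : eqType) (r : seq I) (F : I -> X -> R[i]) (D : I -> X -> X -> R[i]) :
  uniq r -> (forall i, C11 (F i) (D i)) ->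
  C11 (fun x => \prod_(i <- r) F i x)
      (fun x y => \sum_(j <- r) D j x y * \prod_(i <- r | i != j) F i x).
Proof.
move=> + FD; elim: r => [_|i r IHr /= /andP[ir /IHr{}IHr]].
  by apply: C11_ext (C11_cst 1) _ => x y _; rewrite !big_nil.
apply: C11_ext (C11M (FD i) IHr) _ => x y _; rewrite !big_cons eqxx /=; split=> //.
congr (_ * _ + _).
  rewrite big_seq_cond [RHS]big_seq_cond; apply: eq_bigl => j.
  by rewrite andbT; case: (boolP (j \in r)) => //= jr; apply: contraNneq ir => <-.
rewrite mulr_sumr big_seq_cond [RHS]big_seq_cond; apply: eq_bigr => j /andP[jr _].
by rewrite big_cons ifT 1?mulrCA//; apply: contraNneq ir => ->.
Qed.

Lemma C11_real (phi phi' : R -> R) f d :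
  (forall N, exists2 c : R, 0 <= c & forall s t, `|s| <= N -> `|t| <= N ->
     [/\ `|phi t - phi s - phi' s * (t - s)| <= c * (t - s) ^+ 2, `|phi s| <= c
       & `|phi' s| <= c]) ->
  C11 f d ->
  C11 (fun x => (phi (complex.Re (f x)))%:C)
      (fun x y => (phi' (complex.Re (f x)) * complex.Re (d x y))%:C).
Proof.
move=> phiP [N N0 fN]; have [c c0 cP] := phiP N.
exists (c * (1 + N + 4 * N ^+ 2)) => [|x y xy].
  by rewrite mulr_ge0// !addr_ge0// mulr_ge0// exprn_ge0.
have /andP[s0 s1] := sz01 xy.
have s2 : sz x y ^+ 2 <= sz x y by rewrite expr2 ler_piMr.
have [a1 a2 a3 a4] := fN _ _ xy.
have cN : 0 <= c * N by rewrite mulr_ge0.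
have cN2 : 0 <= c * N ^+ 2 by rewrite mulr_ge0// exprn_ge0.
have ss0 : 0 <= sz x y ^+ 2 by rewrite exprn_ge0.
have a5 : cabs (f y - f x) <= 2 * N * sz x y.
  rewrite (_ : f y - f x = (f y - f x - d x y) + d x y); last by ring.
  apply: le_trans (cabsD _ _) _.
  have : N * sz x y ^+ 2 <= N * sz x y by rewrite ler_wpM2l.
  lra.
have [p1 p2 p3] := cP _ _ (le_trans (Re_le_cabs _) a2) (le_trans (Re_le_cabs _) a3).
have [_ q2 _] := cP _ _ (le_trans (Re_le_cabs _) a3) (le_trans (Re_le_cabs _) a2).
have ReB (u v : R[i]) : complex.Re (u - v) = complex.Re u - complex.Re v.
  by case: u v => [? ?] [? ?].
split.
- rewrite -!rmorphB /= cabs_real.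
  have -> : phi (complex.Re (f y)) - phi (complex.Re (f x)) -
       phi' (complex.Re (f x)) * complex.Re (d x y) =
     (phi (complex.Re (f y)) - phi (complex.Re (f x)) -
       phi' (complex.Re (f x)) * (complex.Re (f y) - complex.Re (f x))) +
     phi' (complex.Re (f x)) * complex.Re (f y - f x - d x y).
    by rewrite !ReB; ring.
  apply: le_trans (ler_normD _ _) _; rewrite normrM.
  have h1 : (complex.Re (f y) - complex.Re (f x)) ^+ 2 <= (2 * N * sz x y) ^+ 2.
    rewrite -ReB -real_normK ?num_real// lerXn2r ?nnegrE ?normr_ge0//.
      by rewrite !mulr_ge0.
    exact: le_trans (Re_le_cabs _) a5.
  have h2 : `|phi' (complex.Re (f x))| * `|complex.Re (f y - f x - d x y)|
      <= c * (N * sz x y ^+ 2).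
    by apply: ler_pM => //; apply: le_trans (Re_le_cabs _) a1.
  have h3 := ler_wpM2l c0 h1.
  have h4 : 0 <= c * sz x y ^+ 2 by rewrite mulr_ge0.
  have -> : c * (1 + N + 4 * N ^+ 2) * sz x y ^+ 2 = c * sz x y ^+ 2 +
    c * (N * sz x y ^+ 2) + c * (2 * N * sz x y) ^+ 2 by ring.
  lra.
- by rewrite cabs_real; lra.
- by rewrite cabs_real; lra.
rewrite cabs_real normrM.
have h2 : `|phi' (complex.Re (f x))| * `|complex.Re (d x y)| <= c * (N * sz x y).
  by apply: ler_pM => //; apply: le_trans (Re_le_cabs _) a4.
have h3 : 0 <= c * sz x y by rewrite mulr_ge0.
have h4 : 0 <= c * N ^+ 2 * sz x y by rewrite mulr_ge0.
lra.
Qed.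

Definition setrow m n (j : 'I_m) (u : 'rV[R[i]]_n) (A : 'M[R[i]]_(m, n)) : 'M[R[i]]_(m, n) :=
  \matrix_(r, c) if r == j then u 0 c else A r c.

Lemma det_setrow m (j : 'I_m) u (A : 'M[R[i]]_m) :
  \det (setrow j u A) =
  \sum_(s : {perm 'I_m}) (-1) ^+ s * (u 0 (s j) * \prod_(i | i != j) A i (s i)).
Proof.
apply: eq_bigr => s _; congr (_ * _); rewrite (bigD1 j)//= mxE eqxx; congr (_ * _).
by apply: eq_bigr => i ij; rewrite mxE (negbTE ij).
Qed.

(** Jacobi's formula: the differential of a determinant replaces one row at a
    time by its differential. *)
Lemma C11_det m (A : X -> 'M[R[i]]_m) (dA : X -> X -> 'M[R[i]]_m) :
  (forall i j, C11 (fun x => A x i j) (fun x y => dA x y i j)) ->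
  C11 (fun x => \det (A x))
      (fun x y => \sum_j \det (setrow j (row j (dA x y)) (A x))).
Proof.
move=> AdA.
pose F (s : {perm 'I_m}) x := \prod_(i <- enum 'I_m) A x i (s i).
pose D (s : {perm 'I_m}) x y :=
  \sum_(j <- enum 'I_m) dA x y j (s j) * \prod_(i <- enum 'I_m | i != j) A x i (s i).
have FD (s : {perm 'I_m}) : C11 (fun x => (-1) ^+ s * F s x) (fun x y => (-1) ^+ s * D s x y).
  have := C11M (C11_cst ((-1) ^+ s)) (C11_prod (enum_uniq 'I_m) (fun i => AdA i (s i))).
  by move=> H; apply: C11_ext H _ => x y _; rewrite mul0r add0r.
apply: C11_ext (C11_sum (enum {: {perm 'I_m}}) FD) _ => x y _.
have detE z : \det (A z) = \sum_(s <- enum {: {perm 'I_m}}) (-1) ^+ s * F s z.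
  by rewrite big_enum; apply: eq_bigr => s _; rewrite /F big_enum.
split=> //; under eq_bigr do rewrite det_setrow.
rewrite exchange_big big_enum; apply: eq_bigr => s _.
rewrite -mulr_sumr /D big_enum; congr (_ * _); apply: eq_bigr => j _.
by rewrite mxE big_enum_cond.
Qed.

End C11.

Section RowReplacement.
Variables (R : realType) (k : nat).
Implicit Types (A : 'M[R[i]]_k) (u v y : 'rV[R[i]]_k).

Lemma det_setrowD i u v A :
  \det (setrow i (u + v) A) = \det (setrow i u A) + \det (setrow i v A).
Proof.
rewrite !det_setrow -big_split; apply: eq_bigr => s _.
by rewrite mxE mulrDl mulrDr.
Qed.

Lemma det_setrowZ i c u A : \det (setrow i (c *: u) A) = c * \det (setrow i u A).
Proof.
rewrite !det_setrow mulr_sumr; apply: eq_bigr => s _.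
by rewrite mxE -mulrA mulrCA.
Qed.

Lemma det_setrow0 i A : \det (setrow i 0 A) = 0.
Proof. by rewrite -(scale0r 0) det_setrowZ mul0r. Qed.

Lemma det_setrow_sum i (I : Type) (r : seq I) (P : pred I) (F : I -> 'rV[R[i]]_k) A :
  \det (setrow i (\sum_(l <- r | P l) F l) A) =
  \sum_(l <- r | P l) \det (setrow i (F l) A).
Proof.
elim/big_rec2: _ => [|l x u _ <-]; first exact: det_setrow0.
exact: det_setrowD.
Qed.

Lemma setrow_id i A : setrow i (row i A) A = A.
Proof. by apply/matrixP => r c; rewrite !mxE; case: eqP => // ->. Qed.

Lemma det_setrow_alt i l A : l != i -> \det (setrow i (row l A) A) = 0.
Proof.
move=> li; apply: (determinant_alternate li) => c.
by rewrite !mxE eqxx (negbTE li).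
Qed.

Lemma det_setrow_expand i u A :
  \det (setrow i u A) = \sum_m u 0 m * \det (setrow i (delta_mx 0 m) A).
Proof.
rewrite {1}(matrix_sum_delta u) big_ord1 det_setrow_sum.
by apply: eq_bigr => m _; rewrite det_setrowZ.
Qed.

Lemma det_setrow_mulmx i y A : \det (setrow i (y *m A) A) = y 0 i * \det A.
Proof.
rewrite mulmx_sum_row det_setrow_sum (bigD1 i)//= det_setrowZ setrow_id.
by rewrite big1 ?addr0// => l li; rewrite det_setrowZ det_setrow_alt ?mulr0.
Qed.

Lemma det_setrow_swap i j m m' A : i != j ->
  \det (setrow j (delta_mx 0 m') (setrow i (delta_mx 0 m) A)) =
  - \det (setrow j (delta_mx 0 m) (setrow i (delta_mx 0 m') A)).
Proof.
move=> ij; set B := setrow j (delta_mx 0 m) _.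
have -> : setrow j (delta_mx 0 m') (setrow i (delta_mx 0 m) A) = xrow i j B.
  apply/matrixP => r c; rewrite /B !mxE.
  case: tpermP => [->|->|/eqP ri /eqP rj].
  - by rewrite (negbTE ij) !eqxx.
  - by rewrite (negbTE ij) !eqxx.
  - by rewrite (negbTE ri) (negbTE rj).
by rewrite /xrow row_permE det_mulmx det_perm odd_tperm ij expr1 mulN1r.
Qed.

(** Piola's identity: the cofactors of a Jacobian matrix are divergence free.
    The matrix [dA m] holds the derivatives of the entries of [A] in the [m]-th
    direction; the hypothesis that the rows of [A] are gradients makes these
    derivatives symmetric in two indices in which the determinant is
    alternating, so that the terms cancel in pairs. *)
Lemma cofactor_divergence (A : 'M[R[i]]_k) (dA : 'I_k -> 'M[R[i]]_k) i :
  (forall m m' j, dA m j m' = dA m' j m) ->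
  \sum_m \sum_(j | j != i)
    \det (setrow j (row j (dA m)) (setrow i (delta_mx 0 m) A)) = 0.
Proof.
move=> dAC; rewrite exchange_big big1 // => j ji.
pose F m m' := dA m j m' *
  \det (setrow j (delta_mx 0 m') (setrow i (delta_mx 0 m) A)).
have FN m m' : F m m' = - F m' m.
  by rewrite /F det_setrow_swap 1?eq_sym// dAC mulrN.
under eq_bigr => m _.
  rewrite det_setrow_expand; under eq_bigr => m' _ do rewrite mxE -/(F m m').
  over.
set S := \sum_m _; have : S = - S.
  rewrite {1}/S exchange_big -sumrN; apply: eq_bigr => m _.
  by rewrite -sumrN; apply: eq_bigr => m' _; rewrite FN.
by move/eqP; rewrite -addr_eq0 -mulr2n mulrn_eq0 => /eqP.
Qed.

End RowReplacement.

Section DBar.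
Variables (R : realType) (k : nat) (D : set 'rV[R[i]]_k).
Implicit Types (f : 'rV[R[i]]_k -> R[i]) (g : 'I_k -> 'rV[R[i]]_k -> R[i]).

Definition close x y := [/\ D x, D y & vabs (y - x) <= 1].
Definition gap (x y : 'rV[R[i]]_k) : R := vabs (y - x).

Lemma gap01 x y : close x y -> 0 <= gap x y <= 1.
Proof. by case=> _ _ xy; rewrite vabs_ge0. Qed.

(** The derivative in a direction plus ['i] times the one in the direction turned
    by ['i] is twice the derivative with respect to the conjugate coordinate. *)
Definition dbar_of (d : 'rV[R[i]]_k -> 'rV[R[i]]_k -> R[i]) g :=
  forall x m (c : R), d x (x + c%:C *: delta_mx 0 m) +
    'i%C * d x (x + ('i%C * c%:C) *: delta_mx 0 m) = 2 * c%:C * g m x.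

Definition has_dbar f g := exists2 d, C11 close gap f d & dbar_of d g.

Lemma has_dbar_cst c : has_dbar (fun=> c) (fun _ _ => 0).
Proof.
exists (fun _ _ => 0); first exact: (C11_cst gap01).
by move=> x m t; rewrite !mulr0 addr0.
Qed.

Lemma has_dbar_eq f g f' g' : has_dbar f g -> f =1 f' -> (forall m, g m =1 g' m) ->
  has_dbar f' g'.
Proof.
move=> [d fd dg] ff gg; exists d; last by move=> x m c; rewrite dg gg.
by apply: C11_ext fd _ => x y _; rewrite !ff.
Qed.

Let dbar_alg (u u' v v' s t : R[i]) : u + 'i%C * u' = s -> v + 'i%C * v' = t ->
  (u + v) + 'i%C * (u' + v') = s + t.
Proof. by move=> <- <-; ring. Qed.

Let dbar_algZ (r u u' s t : R[i]) : u + 'i%C * u' = t * s -> r * u + 'i%C * (r * u') = t * (r * s).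
Proof. by move=> E; rewrite [RHS]mulrCA -E; ring. Qed.

Let dbar_algZr (r u u' s t : R[i]) : u + 'i%C * u' = t * s -> u * r + 'i%C * (u' * r) = t * (s * r).
Proof. by move=> E; rewrite mulrA -mulrDl E mulrA. Qed.

Lemma has_dbarD f1 g1 f2 g2 : has_dbar f1 g1 -> has_dbar f2 g2 ->
  has_dbar (fun x => f1 x + f2 x) (fun m x => g1 m x + g2 m x).
Proof.
move=> [d1 fd1 dg1] [d2 fd2 dg2]; exists (fun x y => d1 x y + d2 x y).
  exact: C11D.
by move=> x m c; rewrite [RHS]mulrDr; exact: dbar_alg (dg1 x m c) (dg2 x m c).
Qed.

Lemma has_dbarM f1 g1 f2 g2 : has_dbar f1 g1 -> has_dbar f2 g2 ->
  has_dbar (fun x => f1 x * f2 x) (fun m x => g1 m x * f2 x + f1 x * g2 m x).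
Proof.
move=> [d1 fd1 dg1] [d2 fd2 dg2].
exists (fun x y => d1 x y * f2 x + f1 x * d2 x y); first exact: (C11M gap01).
move=> x m c; rewrite [RHS]mulrDr.
exact: dbar_alg (dbar_algZr (f2 x) (dg1 x m c)) (dbar_algZ (f1 x) (dg2 x m c)).
Qed.

Lemma has_dbar_sum (I : Type) (r : seq I) (F : I -> 'rV[R[i]]_k -> R[i])
    (G : I -> 'I_k -> 'rV[R[i]]_k -> R[i]) :
  (forall i, has_dbar (F i) (G i)) ->
  has_dbar (fun x => \sum_(i <- r) F i x) (fun m x => \sum_(i <- r) G i m x).
Proof.
move=> FG; elim: r => [|i r IHr].
  by apply: has_dbar_eq (has_dbar_cst 0) _ _ => [x|m x]; rewrite big_nil.
by apply: has_dbar_eq (has_dbarD (FG i) IHr) _ _ => [x|m x]; rewrite big_cons.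
Qed.

Lemma has_dbar_det m (A : 'rV[R[i]]_k -> 'M[R[i]]_m)
    (dA : 'I_k -> 'rV[R[i]]_k -> 'M[R[i]]_m) :
  (forall i j, has_dbar (fun x => A x i j) (fun m x => dA m x i j)) ->
  has_dbar (fun x => \det (A x))
    (fun n x => \sum_j \det (setrow j (row j (dA n x)) (A x))).
Proof.
move=> AdA.
have /(_ _ _)/cid2 AdA' : forall i j, exists2 d, C11 close gap (fun x => A x i j) d
   & dbar_of d (fun m x => dA m x i j) by [].
pose d i j := projT1 (AdA' i j).
pose dM x y : 'M[R[i]]_m := \matrix_(i, j) d i j x y.
exists (fun x y => \sum_j \det (setrow j (row j (dM x y)) (A x))).
  apply: (C11_det gap01) => i j.
  have [fd _] := projT2 (AdA' i j).
  by apply: C11_ext (projT2 (AdA' i j)).1 _ => x y _; rewrite mxE.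
move=> x n c; rewrite !mulr_sumr -big_split; apply: eq_bigr => j _.
rewrite /= -!det_setrowZ -det_setrowD; congr (\det (setrow j _ _)).
by apply/rowP => l; rewrite !mxE; case: (projT2 (AdA' j l)) => _ /(_ x n c).
Qed.

(** The linear part is complex linear, which is the holomorphic case. *)
Definition hol11 f (df : 'I_k -> 'rV[R[i]]_k -> R[i]) :=
  C11 close gap f (fun x y => pairing (df ^~ x) (y - x)).

Let pairing_dbar df : dbar_of (fun x y => pairing (df ^~ x) (y - x)) (fun _ _ => 0).
Proof.
move=> x m c; rewrite !(addrC x) !addrK !pairingZ pairing_delta !mulrA -expr2 sqr_i.
by ring.
Qed.

Let conj_pairing_dbar df :
  dbar_of (fun x y => conjc (pairing (df ^~ x) (y - x))) (fun m x => conjc (df m x)).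
Proof.
move=> x m c.
rewrite !(addrC x) !addrK !pairingZ pairing_delta !conjcM !conjc_real.
have -> : conjc 'i%C = - 'i%C :> R[i] by simpc.
have ii : 'i%C * 'i%C = -1 :> R[i] by rewrite -expr2 sqr_i.
move: ii; set I := 'i%C => ii.
transitivity (c%:C * conjc (df m x) * (1 - I * I)); first by ring.
by rewrite ii; ring.
Qed.

Lemma hol11_dbar f df : hol11 f df -> has_dbar f (fun _ _ => 0).
Proof. by move=> fd; exists (fun x y => pairing (df ^~ x) (y - x)). Qed.

Lemma hol11_conj_dbar f df : hol11 f df ->
  has_dbar (fun x => conjc (f x)) (fun m x => conjc (df m x)).
Proof.
by move=> fd; exists (fun x y => conjc (pairing (df ^~ x) (y - x))); first exact: C11_conj.
Qed.

(** Cut-off functions of a real variable can only be composed with functions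
    whose values and differentials are real. *)
Definition has_dbar_real f g := exists2 d, C11 close gap f d /\
  (forall x y, (complex.Re (d x y))%:C = d x y) & dbar_of d g.

Lemma has_dbar_real_sqr f df : hol11 f df ->
  has_dbar_real (fun x => f x * conjc (f x)) (fun m x => f x * conjc (df m x)).
Proof.
move=> fd; have fdc := C11_conj fd; have := C11M gap01 fd fdc.
set d := (X in C11 _ _ _ X) => ffd.
have dE x y : d x y = pairing (df^~ x) (y - x) * conjc (f x) +
   f x * conjc (pairing (df^~ x) (y - x)) by [].
exists d; first split=> // x y.
  rewrite dE; case: (f x) => ? ?; case: (pairing _ _) => ? ?; simpc.
  by congr (_ +i* _); ring.
move=> x m c; transitivity (2 * c%:C * (0 * conjc (f x)) + 2 * c%:C * (f x * conjc (df m x))).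
  exact: dbar_alg (dbar_algZr (conjc (f x)) (pairing_dbar df x m c))
    (dbar_algZ (f x) (conj_pairing_dbar df x m c)).
by rewrite mul0r mulr0 add0r.
Qed.

Lemma has_dbar_realD f1 g1 f2 g2 : has_dbar_real f1 g1 -> has_dbar_real f2 g2 ->
  has_dbar_real (fun x => f1 x + f2 x) (fun m x => g1 m x + g2 m x).
Proof.
move=> [d1 [fd1 r1] dg1] [d2 [fd2 r2] dg2]; exists (fun x y => d1 x y + d2 x y).
  split=> [|x y]; first exact: C11D.
  by rewrite -[in RHS]r1 -[in RHS]r2; case: (d1 x y) => ? ?; case: (d2 x y) => ? ?; simpc.
by move=> x m c; rewrite [RHS]mulrDr; exact: dbar_alg (dg1 x m c) (dg2 x m c).
Qed.

Lemma has_dbar_realZ (t : R) f g : has_dbar_real f g ->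
  has_dbar_real (fun x => t%:C * f x) (fun m x => t%:C * g m x).
Proof.
move=> [d [fd r] dg]; exists (fun x y => t%:C * d x y).
  split=> [|x y].
    have := C11M gap01 (C11_cst gap01 t%:C) fd.
    by move=> H; apply: C11_ext H _ => x y _; rewrite mul0r add0r.
  by rewrite -[in RHS]r; case: (d x y) => ? ?; simpc.
by move=> x m c; exact: dbar_algZ (dg x m c).
Qed.

Lemma has_dbar_real_cst (t : R) : has_dbar_real (fun=> t%:C) (fun _ _ => 0).
Proof.
exists (fun _ _ => 0); first by split=> //; exact: (C11_cst gap01).
by move=> x m c; rewrite !mulr0 addr0.
Qed.

Lemma has_dbar_real_eq f g f' g' : has_dbar_real f g -> f =1 f' ->
  (forall m, g m =1 g' m) -> has_dbar_real f' g'.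
Proof.
move=> [d [fd r] dg] ff gg; exists d; last by move=> x m c; rewrite dg gg.
by split=> //; apply: C11_ext fd _ => x y _; rewrite !ff.
Qed.

Lemma has_dbar_real_sum (I : Type) (r : seq I) (F : I -> 'rV[R[i]]_k -> R[i])
    (G : I -> 'I_k -> 'rV[R[i]]_k -> R[i]) :
  (forall i, has_dbar_real (F i) (G i)) ->
  has_dbar_real (fun x => \sum_(i <- r) F i x) (fun m x => \sum_(i <- r) G i m x).
Proof.
move=> FG; elim: r => [|i r IHr].
  by apply: has_dbar_real_eq (has_dbar_real_cst 0) _ _ => [x|m x]; rewrite big_nil.
by apply: has_dbar_real_eq (has_dbar_realD (FG i) IHr) _ _ => [x|m x]; rewrite big_cons.
Qed.

Lemma has_dbar_comp (phi phi' : R -> R) f g :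
  (forall N, exists2 c : R, 0 <= c & forall s t, `|s| <= N -> `|t| <= N ->
     [/\ `|phi t - phi s - phi' s * (t - s)| <= c * (t - s) ^+ 2, `|phi s| <= c
       & `|phi' s| <= c]) ->
  has_dbar_real f g ->
  has_dbar (fun x => (phi (complex.Re (f x)))%:C)
           (fun m x => (phi' (complex.Re (f x)))%:C * g m x).
Proof.
move=> phiP [d [fd r] dg].
exists (fun x y => (phi' (complex.Re (f x)) * complex.Re (d x y))%:C).
  exact: (C11_real gap01 phiP fd).
have E x y : (phi' (complex.Re (f x)) * complex.Re (d x y))%:C =
  (phi' (complex.Re (f x)))%:C * d x y by rewrite realcM r.
by move=> x m c; rewrite -(dbar_algZ _ (dg x m c)); congr (_ + _ * _); exact: E.
Qed.

End DBar.

(** * Divergences and lattice sums *)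

Section CutOff.
Variable R : realType.

(** For [m >= 2] this is once differentiable with a Lipschitz derivative, which is
    all the smoothness that is needed, and its derivative is [- m] times the
    cut-off with [m - 1]. *)
Definition cutoff (e : R) (m : nat) (s : R) : R := Num.max (e - s) 0 ^+ m.

Lemma cutoff0 (e s : R) m : e <= s -> cutoff e m.+1 s = 0.
Proof. by move=> es; rewrite /cutoff max_r ?expr0n// subr_le0. Qed.

Lemma cutoff_ge0 e m s : 0 <= cutoff e m s.
Proof. by rewrite exprn_ge0// le_max lexx orbT. Qed.

Lemma cutoff_max_bound (e s N : R) : `|s| <= N ->
  0 <= Num.max (e - s) 0 <= `|e| + N.
Proof.
move=> sN; have N0 : 0 <= N by apply: le_trans sN.
rewrite le_max lexx orbT /= ge_max addr_ge0// andbT.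
by apply: le_trans (ler_norm _) (le_trans (ler_normB _ _) _); rewrite lerD2l.
Qed.

Lemma cutoff2_C11 (e N : R) : exists2 c : R, 0 <= c & forall s t, `|s| <= N -> `|t| <= N ->
  [/\ `|cutoff e 2 t - cutoff e 2 s - (- 2 * cutoff e 1 s) * (t - s)| <= c * (t - s) ^+ 2,
      `|cutoff e 2 s| <= c & `|- 2 * cutoff e 1 s| <= c].
Proof.
pose B : R := `|e| + `|N|; have B0 : 0 <= B by rewrite addr_ge0.
exists (3 + 2 * B + B ^+ 2) => [|s t sN tN]; first by rewrite !addr_ge0// ?mulr_ge0// exprn_ge0.
have B2 : 0 <= B ^+ 2 by rewrite exprn_ge0.
have /andP[u0 uB] := cutoff_max_bound e (le_trans sN (ler_norm _)).
rewrite /cutoff expr1 -/B in uB *.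
have S0 : 0 <= (t - s) ^+ 2 by rewrite sqr_ge0.
split.
- apply: (@le_trans _ _ (3 * (t - s) ^+ 2)); last by rewrite ler_wpM2r//; lra.
  rewrite ler_norml.
  case: (leP (e - s) 0) => es; case: (leP (e - t) 0) => et.
  + by apply/andP; split; lra.
  + have t1 : (e - t) ^+ 2 <= (t - s) ^+ 2 by nra.
    have t2 : 0 <= (e - t) ^+ 2 by rewrite sqr_ge0.
    by apply/andP; split; lra.
  + have t1 : (e - s) ^+ 2 <= (e - s) * (t - s) by rewrite expr2 ler_wpM2l//; lra.
    have t2 : (e - s) * (t - s) <= (t - s) ^+ 2 by rewrite expr2 ler_wpM2r//; lra.
    have t3 : 0 <= (e - s) ^+ 2 by rewrite sqr_ge0.
    by apply/andP; split; lra.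
  + have E : (e - t) ^+ 2 - (e - s) ^+ 2 - - 2 * (e - s) * (t - s) = (t - s) ^+ 2 by ring.
    by rewrite E; apply/andP; split; lra.
- by rewrite ger0_norm ?exprn_ge0//; nra.
- by rewrite normrM normrN ger0_norm// ger0_norm//; nra.
Qed.

Lemma cutoff3_C11 (e N : R) : exists2 c : R, 0 <= c & forall s t, `|s| <= N -> `|t| <= N ->
  [/\ `|cutoff e 3 t - cutoff e 3 s - (- 3 * cutoff e 2 s) * (t - s)| <= c * (t - s) ^+ 2,
      `|cutoff e 3 s| <= c & `|- 3 * cutoff e 2 s| <= c].
Proof.
pose B : R := `|e| + `|N|; have B0 : 0 <= B by rewrite addr_ge0.
exists (3 + 9 * B + 3 * B ^+ 2 + B ^+ 3) => [|s t sN tN].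
  by rewrite !addr_ge0// ?mulr_ge0// exprn_ge0.
have B2 : 0 <= B ^+ 2 by rewrite exprn_ge0.
have B3 : 0 <= B ^+ 3 by rewrite exprn_ge0.
have /andP[u0 uB] := cutoff_max_bound e (le_trans sN (ler_norm _)).
have /andP[v0 vB] := cutoff_max_bound e (le_trans tN (ler_norm _)).
rewrite /cutoff -/B in uB vB *.
set u := Num.max (e - s) 0 in u0 uB *; set v := Num.max (e - t) 0 in v0 vB *.
have u2 : u ^+ 2 <= B ^+ 2 by rewrite lerXn2r// nnegrE.
have u3 : u ^+ 3 <= B ^+ 3 by rewrite lerXn2r// nnegrE.
split; last 2 first.
- by rewrite ger0_norm ?exprn_ge0//; lra.
- by rewrite normrM normrN !ger0_norm ?exprn_ge0//; lra.
have S0 : 0 <= (t - s) ^+ 2 by rewrite sqr_ge0.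
have [c c0 cP] : exists2 c : R, 0 <= c <= 9 * B &
    `|v ^+ 3 - u ^+ 3 - - 3 * u ^+ 2 * (t - s)| <= c * (t - s) ^+ 2.
  exists (9 * B); first by rewrite mulr_ge0//=.
  rewrite /u /v in u0 v0 uB vB *; rewrite ler_norml.
  case: (leP (e - s) 0) u0 uB => es u0 uB; case: (leP (e - t) 0) v0 vB => et v0 vB.
  - by apply/andP; split; nra.
  - have t1 : (e - t) ^+ 2 <= (t - s) ^+ 2 by nra.
    have t2 : (e - t) ^+ 3 <= B * (t - s) ^+ 2.
      by rewrite exprS; apply: ler_pM => //; rewrite ?exprn_ge0//; lra.
    have t3 : 0 <= (e - t) ^+ 3 by rewrite exprn_ge0.
    by apply/andP; split; nra.
  - have t1 : (e - s) ^+ 2 <= (t - s) ^+ 2 by nra.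
    have t2 : (e - s) ^+ 3 <= B * (t - s) ^+ 2.
      by rewrite exprS; apply: ler_pM => //; rewrite ?exprn_ge0//; lra.
    have t3 : 0 <= (e - s) ^+ 3 by rewrite exprn_ge0.
    have t4 : (e - s) ^+ 2 * (t - s) <= B * (t - s) ^+ 2.
      by rewrite expr2 -mulrA [X in _ <= _ * X]expr2; apply: ler_pM => //;
         rewrite ?mulr_ge0//; nra.
    have t5 : 0 <= (e - s) ^+ 2 * (t - s) by rewrite mulr_ge0// ?exprn_ge0//; lra.
    have t6 : 0 <= B * (t - s) ^+ 2 by rewrite mulr_ge0.
    by apply/andP; split; lra.
  - have E : (e - t) ^+ 3 - (e - s) ^+ 3 - - 3 * (e - s) ^+ 2 * (t - s) =
       (3 * (e - s) - (t - s)) * (t - s) ^+ 2 by ring.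
    rewrite -ler_norml E normrM [`|_ ^+ 2|]ger0_norm// ler_wpM2r//.
    by rewrite ler_norml; apply/andP; split; lra.
move: c0 => /andP[_ c0]; apply: le_trans cP _; rewrite ler_wpM2r//; lra.
Qed.

End CutOff.

Section Divergence.
Variables (R : realType) (k : nat) (D : set 'rV[R[i]]_k).
Variables (phi phi' : R -> R).
Hypothesis phiP : forall N, exists2 c : R, 0 <= c & forall s t, `|s| <= N -> `|t| <= N ->
     [/\ `|phi t - phi s - phi' s * (t - s)| <= c * (t - s) ^+ 2, `|phi s| <= c
       & `|phi' s| <= c].
Variables (A : 'rV[R[i]]_k -> 'M[R[i]]_k) (dA : 'I_k -> 'rV[R[i]]_k -> 'M[R[i]]_k).
Hypothesis AdA : forall i j, has_dbar D (fun x => A x i j) (fun m x => dA m x i j).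
Hypothesis dAC : forall x m m' j, dA m x j m' = dA m' x j m.
Variables (y : 'rV[R[i]]_k -> 'rV[R[i]]_k) (q : 'rV[R[i]]_k -> R[i]).
Hypothesis qdbar : has_dbar_real D q (fun m x => (y x *m A x) 0 m).
Variables (w : 'rV[R[i]]_k -> 'rV[R[i]]_k) (dw : 'I_k -> 'rV[R[i]]_k -> 'rV[R[i]]_k).
Hypothesis wdw : forall i, has_dbar D (fun x => w x 0 i) (fun m x => dw m x 0 i).

(** The vector field whose divergence is studied: a cut-off of [q] times the
    contraction of [w] with the cofactors of [A]. *)
Definition flux m x : R[i] :=
  (phi (complex.Re (q x)))%:C * \sum_i w x 0 i * \det (setrow i (delta_mx 0 m) (A x)).

Definition dflux m n x : R[i] :=
  (phi' (complex.Re (q x)))%:C * (y x *m A x) 0 n *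
     \sum_i w x 0 i * \det (setrow i (delta_mx 0 m) (A x)) +
  (phi (complex.Re (q x)))%:C * \sum_i (dw n x 0 i * \det (setrow i (delta_mx 0 m) (A x)) +
     w x 0 i * \sum_(j | j != i)
        \det (setrow j (row j (dA n x)) (setrow i (delta_mx 0 m) (A x)))).

Lemma flux_dbar m : has_dbar D (flux m) (dflux m).
Proof.
have cofP i : has_dbar D (fun x => \det (setrow i (delta_mx 0 m) (A x)))
    (fun n x => \sum_(j | j != i)
        \det (setrow j (row j (dA n x)) (setrow i (delta_mx 0 m) (A x)))).
  pose dB n x := setrow i 0 (dA n x).
  have BdB r c : has_dbar D (fun x => setrow i (delta_mx 0 m) (A x) r c)
      (fun n x => dB n x r c).
    case: (eqVneq r i) => [ri|ri].
      apply: has_dbar_eq (has_dbar_cst _ (delta_mx 0 m 0 c)) _ _ => [x|n x].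
        by rewrite [RHS]mxE ri eqxx.
      by rewrite /dB [RHS]mxE ri eqxx mxE.
    by apply: has_dbar_eq (AdA r c) _ _ => [x|n x]; rewrite /dB [RHS]mxE (negbTE ri).
  apply: has_dbar_eq (has_dbar_det BdB) _ _ => // n x.
  rewrite (bigD1 i)//= [X in X + _](_ : _ = 0) ?add0r.
    apply: eq_bigr => j ji; congr (\det (setrow j _ _)).
    by apply/rowP => c; rewrite !mxE (negbTE ji).
  rewrite (_ : row i _ = 0) ?det_setrow0//.
  by apply/rowP => c; rewrite !mxE eqxx.
have := has_dbarM (has_dbar_comp phiP qdbar)
  (has_dbar_sum (index_enum 'I_k) (fun i => has_dbarM (wdw i) (cofP i))).
by move=> H; apply: has_dbar_eq H _ _ => [x|n x].
Qed.

Lemma dflux_eq0 m n x : phi (complex.Re (q x)) = 0 -> phi' (complex.Re (q x)) = 0 ->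
  dflux m n x = 0.
Proof. by move=> p p'; rewrite /dflux p p' !mul0r addr0. Qed.

Lemma flux_eq0 m x : phi (complex.Re (q x)) = 0 -> flux m x = 0.
Proof. by move=> p; rewrite /flux p mul0r. Qed.

(** By Piola's identity the cofactors are not differentiated; the derivative of
    the cut-off brings in [y *m A], which Cramer's rule turns into [\det A]. *)
Lemma divergence_flux x : \sum_m dflux m m x =
  (phi' (complex.Re (q x)))%:C * (\sum_i w x 0 i * y x 0 i) * \det (A x) +
  (phi (complex.Re (q x)))%:C *
     \sum_i \det (setrow i (\row_m dw m x 0 i) (A x)).
Proof.
rewrite big_split /=; congr (_ + _).
  under eq_bigr do rewrite -mulrA.
  rewrite -mulr_sumr -mulrA; congr (_ * _); rewrite mulr_suml.
  under eq_bigr do rewrite mulr_sumr.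
  rewrite exchange_big; apply: eq_bigr => i _ /=.
  rewrite -mulrA -det_setrow_mulmx det_setrow_expand mulr_sumr.
  by apply: eq_bigr => m _; rewrite mulrCA.
rewrite -mulr_sumr; congr (_ * _); rewrite exchange_big; apply: eq_bigr => i _ /=.
rewrite big_split /= -[X in _ + X]mulr_sumr cofactor_divergence ?mulr0 ?addr0 => [|m m' j]; last exact: dAC.
by rewrite det_setrow_expand; apply: eq_bigr => m _; rewrite mxE.
Qed.

End Divergence.

Section Lattice.
Variables (R : realType) (k : nat) (rho : R).
Hypothesis rho0 : 0 < rho.

Local Notation node N := {ffun 'I_k * bool -> 'I_N}.

(** The node with indices [u] of a lattice with [N] steps per real coordinate in
    the cube of half-side [rho]; the shift is cyclic. *)
Definition grid (N : nat) (u : nat) : R := rho * (2 * u%:R / N%:R - 1).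

Definition point (N : nat) (o : node N) : 'rV[R[i]]_k :=
  \row_l ((grid N (o (l, false)))%:C + 'i%C * (grid N (o (l, true)))%:C).

Definition shift (N : nat) (i : 'I_k * bool) (o : node N) : node N :=
  [ffun j => if j == i then ordS (o j) else o j].

Lemma grid_bound N (u : 'I_N) : `|grid N u| <= rho.
Proof.
have N0 : 0 < N%:R :> R by rewrite ltr0n (leq_ltn_trans _ (ltn_ord u)).
have u1 : u%:R / N%:R <= 1 :> R by rewrite ler_pdivrMr// mul1r ler_nat ltnW.
have u0 : 0 <= u%:R / N%:R :> R by rewrite divr_ge0.
rewrite /grid normrM gtr0_norm// -[leRHS]mulr1; apply: ler_wpM2l; first exact: ltW.
rewrite ler_norml -mulrA.
by apply/andP; split; lra.
Qed.

Lemma point_bound N (o : node N) : vabs (point o) <= 2 * k%:R * rho.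
Proof.
apply: (@le_trans _ _ (\sum_(l < k) 2 * rho)); last first.
  by rewrite sumr_const card_ord -[leLHS]mulr_natl mulrCA mulrA.
apply: ler_sum => l _; rewrite mxE; apply: le_trans (cabsD _ _) _.
rewrite cabsM cabs_i mul1r !cabs_real (_ : 2 * rho = rho + rho); last by ring.
by rewrite lerD ?grid_bound.
Qed.

Lemma sum_shift N i (F : node N -> R[i]) : \sum_o F (shift i o) = \sum_o F o.
Proof.
have sh_inj : injective (@shift N i).
  pose unshift (o : node N) : node N := [ffun j => if j == i then ord_pred (o j) else o j].
  suff shK : cancel (@shift N i) unshift by exact: can_inj shK.
  by move=> o; apply/ffunP => j; rewrite !ffunE; case: (j == i); rewrite ?ordSK.
by rewrite [RHS](reindex_inj sh_inj).
Qed.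

Definition dirc (b : bool) : R[i] := if b then 'i%C else 1.

Lemma point_shift N m b (o : node N) : ((o (m, b)).+1 < N)%N ->
  point (shift (m, b) o) = point o + (dirc b * (2 * rho / N%:R)%:C) *: delta_mx 0 m.
Proof.
move=> oN; have N0 : N%:R != 0 :> R by rewrite pnatr_eq0 -lt0n (leq_ltn_trans _ oN).
have gS : grid N (ordS (o (m, b))) = grid N (o (m, b)) + 2 * rho / N%:R.
  by rewrite /grid /= modn_small// -natr1; field.
apply/rowP => l; rewrite !mxE !ffunE !xpair_eqE.
case: (eqVneq l m) => [->|lm] /=; last by rewrite ?eqxx !mulr0 addr0.
rewrite ?eqxx mulr1; case: b oN gS => oN gS /=.
  by rewrite gS rmorphD /= mulrDr addrA.
by rewrite gS rmorphD /= mul1r addrAC.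
Qed.

Lemma point_wrap N m b (o : node N) : (4 <= N)%N -> ~~ ((o (m, b)).+1 < N)%N ->
  [/\ rho / 2 <= vabs (point o), rho / 2 <= vabs (point (shift (m, b) o)) &
      rho / 2 <= vabs (point (shift (m, ~~ b) o))].
Proof.
move=> N4 oN; have {}oN : nat_of_ord (o (m, b)) = N.-1.
  by move: oN; rewrite -leqNgt; have := ltn_ord (o (m, b)); case: N N4 o => //= N _ o; rewrite !ltnS => oN No; apply/eqP; rewrite eqn_leq oN.
have N0 : 0 < N%:R :> R by rewrite ltr0n (leq_trans _ N4).
have g1 : rho / 2 <= `|grid N N.-1|.
  rewrite /grid; have -> : (N.-1)%:R = N%:R - 1 :> R.
    by rewrite -[in RHS](ltn_predK N4) -natr1 addrK.
  apply: le_trans (ler_norm _); rewrite -subr_ge0.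
  have iN : (N%:R)^-1 <= 4%:R^-1 :> R by rewrite lef_pV2 ?posrE// ler_nat.
  have -> : rho * (2 * (N%:R - 1) / N%:R - 1) - rho / 2 = rho * (1 / 2 - 2 / N%:R).
    by field; rewrite gt_eqF.
  by apply: mulr_ge0; [exact: ltW | lra].
have g2 : rho / 2 <= `|grid N 0|.
  rewrite /grid mulr0 mul0r sub0r mulrN1 normrN gtr0_norm//; have := rho0; lra.
have coordP (o' : node N) : rho / 2 <= `|grid N (o' (m, b))| -> rho / 2 <= vabs (point o').
  move=> h; apply: le_trans (vabs_coord _ m); apply: le_trans h _.
  rewrite mxE; case: b {oN} => /=.
    apply: le_trans (Im_le_cabs _); rewrite (_ : complex.Im _ = grid N (o' (m, true)))//.
    by rewrite /=; ring.
  apply: le_trans (Re_le_cabs _); rewrite (_ : complex.Re _ = grid N (o' (m, false)))//.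
  by rewrite /=; ring.
split; apply: coordP.
- by rewrite oN.
- rewrite ffunE eqxx (_ : nat_of_ord _ = 0%N)//= oN.
  by case: N N4 {o oN N0 g1 g2} => // N _; rewrite /= modnn.
- by rewrite ffunE xpair_eqE eqxx; case: b oN => oN /=; rewrite oN.
Qed.

(** The discrete version of the vanishing of the integral of the conjugate
    derivative of a function with compact support: up to a quadratic error, the
    derivative is a combination of differences between neighbouring nodes, and
    the sum of these over the cyclic lattice is zero.  The support condition
    takes care of the nodes where the shift wraps around. *)
Lemma sum_dbar (D : set 'rV[R[i]]_k) (K : 'rV[R[i]]_k -> R[i]) g (m : 'I_k) :
  (forall x, vabs x <= 2 * k%:R * rho -> D x) -> has_dbar D K g ->
  (forall x, rho / 2 <= vabs x <= 2 * k%:R * rho -> K x = 0 /\ g m x = 0) ->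
  exists2 M : R, 0 <= M & forall N, (4 <= N)%N -> 2 * rho / N%:R <= 1 ->
    cabs (\sum_(o : node N) g m (point o)) <= M * #|{: node N}|%:R / N%:R.
Proof.
move=> DP [d [M M0 dM] dg] supp; exists (2 * M * rho); first by rewrite !mulr_ge0// ltW.
move=> N N4 c1; have N0 : 0 < N%:R :> R by rewrite ltr0n (leq_trans _ N4).
set c := 2 * rho / N%:R in c1; have c0 : 0 < c by rewrite divr_gt0 ?mulr_gt0.
have Dpt (o : node N) : D (point o) by apply: DP; apply: point_bound.
pose E (o : node N) := (K (point (shift (m, false) o)) - K (point o)) +
  'i%C * (K (point (shift (m, true) o)) - K (point o)) - 2 * c%:C * g m (point o).
have sumE : \sum_o E o = - (2 * c%:C) * \sum_(o : node N) g m (point o).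
  rewrite /E sumrB big_split /= -mulr_sumr !sumrB.
  rewrite (sum_shift (m, false) (fun o => K (point o))).
  by rewrite (sum_shift (m, true) (fun o => K (point o))) !subrr mulr0 !add0r -mulr_sumr mulNr.
have stepP b (o : node N) : ((o (m, b)).+1 < N)%N ->
    cabs (K (point (shift (m, b) o)) - K (point o) -
          d (point o) (point o + (dirc b * c%:C) *: delta_mx 0 m)) <= M * c ^+ 2.
  move=> oN; rewrite -point_shift//.
  have sz : vabs (point (shift (m, b) o) - point o) = c.
    rewrite point_shift// addrC addKr vabs_delta cabsM cabs_real gtr0_norm//.
    by rewrite /dirc; case: (b); rewrite ?cabs_i ?cabs1 mul1r.
  have [|h _ _ _] := dM (point o) (point (shift (m, b) o)).
    by split; rewrite ?sz.
  by rewrite /gap sz in h.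
have EP (o : node N) : cabs (E o) <= 2 * M * c ^+ 2.
  have [[w0 w1]|wrap] : (((o (m, false)).+1 < N)%N /\ ((o (m, true)).+1 < N)%N) \/
     exists b, ~~ ((o (m, b)).+1 < N)%N.
  - case: (boolP ((o (m, false)).+1 < N)%N) => h0; last by right; exists false.
    by case: (boolP ((o (m, true)).+1 < N)%N) => h1; [left | right; exists true].
  - have h0 := stepP _ _ w0; have h1 := stepP _ _ w1.
    have dgE := dg (point o) m c.
    rewrite /dirc /= in h0 h1; rewrite mul1r in h0.
    rewrite /E -dgE; move: h0 h1.
    set K0 := K (point o); set K1 := K (point (shift (m, false) o)).
    set K2 := K (point (shift (m, true) o)).
    set d1 := d _ (_ + c%:C *: _); set d2 := d _ _ => h0 h1.
    rewrite (_ : _ - _ = (K1 - K0 - d1) + 'i%C * (K2 - K0 - d2)); last by ring.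
    apply: le_trans (cabsD _ _) _; rewrite cabsM cabs_i mul1r.
    by apply: le_trans (lerD h0 h1) _; rewrite -mulrA mulr_natl mulr2n.
  - have E0 : E o = 0.
      have suppP (o' : node N) : rho / 2 <= vabs (point o') ->
          K (point o') = 0 /\ g m (point o') = 0.
        by move=> h; apply: supp; rewrite h point_bound.
      rewrite /E; case: wrap => b /(point_wrap N4)[/suppP a0 /suppP a1 /suppP a2].
      have [-> ->] := a0; rewrite mulr0 subr0 !subr0.
      by case: b a1 a2 => /= a1 a2; have [-> _] := a1; have [-> _] := a2; rewrite mulr0 addr0.
    by rewrite E0 cabs0; apply: mulr_ge0; [apply: mulr_ge0 | exact: sqr_ge0].
have : cabs (\sum_o E o) <= #|{: node N}|%:R * (2 * M * c ^+ 2).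
  apply: le_trans (cabs_sum _ _ _) _; rewrite mulr_natl -sumr_const.
  by apply: ler_sum => o _.
rewrite sumE cabsM cabsN cabsM cabs_real gtr0_norm//.
have -> : cabs 2 = 2 :> R.
  by rewrite (_ : 2 = 2%:R%:C :> R[i]) ?cabs_real ?ger0_norm// rmorph_nat.
have -> : #|{: node N}|%:R * (2 * M * c ^+ 2) = 2 * c * (#|{: node N}|%:R * M * c).
  by ring.
have c2 : 0 < 2 * c by apply: mulr_gt0.
rewrite ler_pM2l// => h; apply: le_trans h _.
by rewrite /c le_eqVlt; apply/orP; left; apply/eqP; ring.
Qed.

(** A fixed proportion of the nodes lies in a given neighbourhood of the origin. *)
Lemma sum_bump (F : 'rV[R[i]]_k -> R) (sigma kappa : R) : 0 < sigma -> 0 < kappa ->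
  (forall x, 0 <= F x) -> (forall x, vabs x <= sigma -> kappa <= F x) ->
  exists (P : nat) (c0 : R), [/\ (0 < P)%N, 0 < c0 & forall n, (0 < n)%N ->
    c0 * #|{: node (P * n)}|%:R <= \sum_(o : node (P * n)) F (point o)].
Proof.
move=> s0 kap0 F0 Fk.
pose Q := (Num.truncn (2 * k%:R * rho / sigma)).+1.
have Q0 : 0 < Q%:R :> R by rewrite ltr0n.
have Qb : 2 * k%:R * rho / Q%:R <= sigma.
  by rewrite ler_pdivrMr// -ler_pdivrMl// mulrC; apply/ltW/truncnS_gt.
pose I := ('I_k * bool)%type.
exists (2 * Q)%N, (kappa / (2 * Q)%:R ^+ #|{: I}|); split=> [//||n n0].
  by rewrite divr_gt0// exprn_gt0// ltr0n muln_gt0.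
have bnd (u : 'I_n) : (Q * n + u < 2 * Q * n)%N.
  by rewrite -mulnA mul2n -addnn ltn_add2l (leq_trans (ltn_ord u))// leq_pmull.
pose emb (o : node n) : node (2 * Q * n) := [ffun i => Ordinal (bnd (o i))].
have emb_inj : injective emb.
  move=> o o' /ffunP oo; apply/ffunP => i; apply: val_inj.
  by have := congr1 val (oo i); rewrite !ffunE /= => /addnI.
have n1 : 0 < n%:R :> R by rewrite ltr0n.
have embP o : vabs (point (emb o)) <= sigma.
  apply: le_trans Qb; apply: (@le_trans _ _ (\sum_(l < k) 2 * (rho / Q%:R))); last first.
    rewrite sumr_const card_ord -[leLHS]mulr_natl le_eqVlt; apply/orP; left; apply/eqP.
    by ring.
  have gP i : `|grid (2 * Q * n) (emb o i)| <= rho / Q%:R.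
    rewrite /grid ffunE /= natrD !natrM.
    have -> : rho * (2 * (Q%:R * n%:R + (o i)%:R) / (2 * Q%:R * n%:R) - 1) =
       rho / Q%:R * ((o i)%:R / n%:R) by field; rewrite !gt_eqF.
    have rQ : 0 <= rho / Q%:R by apply: divr_ge0; exact: ltW.
    rewrite ger0_norm; last by apply: mulr_ge0 => //; apply: divr_ge0.
    rewrite -[leRHS]mulr1; apply: ler_wpM2l => //.
    by rewrite ler_pdivrMr// mul1r ler_nat ltnW.
  apply: ler_sum => l _; rewrite mxE; apply: le_trans (cabsD _ _) _.
  rewrite cabsM cabs_i mul1r !cabs_real (_ : 2 * (rho / Q%:R) = rho / Q%:R + rho / Q%:R); last by ring.
  by rewrite lerD ?gP.
apply: (@le_trans _ _ (\sum_(o in emb @: [set: node n]%SET) F (point o))); last first.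
  rewrite [leRHS](bigID (mem (emb @: [set: node n]%SET))) /= lerDl.
  by apply: sumr_ge0.
rewrite big_imset /=; last by move=> o o' _ _; exact: emb_inj.
apply: (@le_trans _ _ (\sum_(o in [set: node n]%SET) kappa)); last first.
  by apply: ler_sum => o _; apply: Fk.
rewrite sumr_const cardsT !card_ffun !card_ord -[leRHS]mulr_natl !natrX.
rewrite (natrM _ (2 * Q) n) exprMn mulrA divfK 1?mulrC//.
by rewrite expf_neq0// pnatr_eq0.
Qed.

End Lattice.

(** * Transition determinants at an isolated zero *)

Section Compactness.
Variable R : realType.

Lemma square_compact (r : R) :
  compact [set z : R[i] | `|complex.Re z| <= r /\ `|complex.Im z| <= r].
Proof.
have -> : [set z : R[i] | `|complex.Re z| <= r /\ `|complex.Im z| <= r] =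
    (fun u : R * R => (u.1 +i* u.2 : R[i])) @` (`[- r, r] `*` `[- r, r]).
  apply/seteqP; split=> [[x y] /= [xr yr]|z [[x y] /= [xr yr] <-] /=].
    by exists (x, y) => //=; rewrite !in_itv /= -!ler_norml.
  by move: xr yr; rewrite !in_itv /= -!ler_norml.
apply: continuous_compact; last by apply: compact_setX; exact: segment_compact.
apply: continuous_subspaceT => -[x y].
apply/cvg_ballP => e e0; have [e1 eE] := gtr0_realpart e0.
have e2 : 0 < complex.Re e / 2 by rewrite divr_gt0.
apply: filterS (nbhsx_ballx ((x, y) : R * R) _ e2) => -[x' y'] [/= bx by'].
change (`|(x +i* y : R[i]) - (x' +i* y')| < e).
rewrite cabsE eE ltcR; apply: le_lt_trans (cabs_le_ReIm _) _ => /=.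
rewrite [X in _ < X](splitr (complex.Re e)).
exact: ltrD.
Qed.

Variable k : nat.

(** Compactness of the shell, through the compactness of squares in each
    coordinate. *)
Lemma shell_min (F : 'rV[R[i]]_k -> R) (L s r : R) : 0 < s -> 0 <= L ->
  (forall x y, vabs x <= r -> vabs y <= r -> vabs (y - x) <= 1 ->
     `|F y - F x| <= L * vabs (y - x)) ->
  (forall x, s <= vabs x <= r -> 0 < F x) ->
  exists2 e : R, 0 < e & forall x, s <= vabs x <= r -> e <= F x.
Proof.
move=> s0 L0 FL F0; apply: contrapT => noe.
have smallP e : 0 < e -> exists2 x, s <= vabs x <= r & F x < e.
  move=> e0; apply: contrapT => nox; apply: noe; exists e => // x xs.
  by rewrite leNgt; apply/negP => xe; apply: nox; exists x.
pose S e := [set x : 'rV[R[i]]_k | s <= vabs x <= r /\ F x < e].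
pose G := filter_from [set e : R | 0 < e] S.
have GP : ProperFilter G.
  apply: filter_from_proper => [|e /smallP[x xs xe]]; last by exists x.
  apply: filter_from_filter; first by exists 1 => /=.
  move=> e e' /= e0 e'0; exists (Num.min e e'); first by rewrite /= lt_min e0 e'0.
  by move=> x [xs]; rewrite lt_min => /andP[xe xe']; split.
pose Sq : set R[i] := [set z | `|complex.Re z| <= r /\ `|complex.Im z| <= r].
have Kc : compact [set v : 'rV[R[i]]_k | forall l, Sq (v ord0 l)].
  by apply: (@rV_compact _ _ (fun=> Sq)) => _; exact: square_compact.
have [|x [_ xG]] := Kc G GP.
  exists 1 => //= x [/andP[_ xr] _] l.
  by split; [apply: le_trans (Re_le_cabs _) _|apply: le_trans (Im_le_cabs _) _];
    apply: le_trans (vabs_coord _ _) xr.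
have closeP d e : 0 < d -> 0 < e -> exists y, [/\ s <= vabs y <= r, F y < e & vabs (y - x) < d].
  move=> d0 e0.
  have [|y [[ys ye] yx]] := xG (S e) [set y | vabs (y - x) < d] (ex_intro2 _ _ e e0 (@subset_refl _ _)).
    by apply/near_vabsP; exists d.
  by exists y.
have xs : s <= vabs x <= r.
  apply/andP; split; apply/ler_addgt0Pr => d d0; have [y [/andP[ys yr] _ yx]] := closeP d 1 d0 ltr01.
    apply: le_trans ys _; rewrite -[y](subrK x) addrC; apply: le_trans (vabsD _ _) _.
    by rewrite lerD2l ltW.
  rewrite -[x](subrK y) addrC; apply: le_trans (vabsD _ _) _; rewrite lerD// vabsB ltW//.
have Fx := F0 _ xs.
have d0 : 0 < Num.min 1 (F x / 2 / (L + 1)).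
  by rewrite lt_min ltr01 !divr_gt0// ltr_wpDl.
have F2 : 0 < F x / 2 by rewrite divr_gt0.
have [y [/andP[_ yr] yF yx]] := closeP _ _ d0 F2.
have /andP[_ xr] := xs; move: yx; rewrite lt_min => /andP[y1 y2].
have := FL x y xr yr (ltW y1).
have : L * vabs (y - x) <= F x / 2.
  apply: (@le_trans _ _ ((L + 1) * vabs (y - x))); first by rewrite ler_wpM2r ?vabs_ge0// lerDl.
  by rewrite mulrC -ler_pdivlMr ?ltr_wpDl// ltW.
by rewrite ler_norml => h1 /andP[h2 _]; lra.
Qed.

End Compactness.

Section Transition.
Variables (R : realType) (k : nat) (r : R).
Hypotheses (k0 : (0 < k)%N) (r0 : 0 < r).
Let D := [set x : 'rV[R[i]]_k | vabs x <= r].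
Variables (B : 'I_k -> 'I_k -> 'rV[R[i]]_k -> R[i]).
Variables (dB : 'I_k -> 'I_k -> 'I_k -> 'rV[R[i]]_k -> R[i]).
Hypothesis BdB : forall i l, hol11 D (B i l) (dB i l).
Let h i x : R[i] := \sum_l B i l x * x 0 l.
Variables (H : 'I_k -> 'I_k -> 'rV[R[i]]_k -> R[i]).
Hypothesis hH : forall i, hol11 D (h i) (H i).
Variables (HH : 'I_k -> 'I_k -> 'I_k -> 'rV[R[i]]_k -> R[i]).
Hypothesis HHH : forall i m, hol11 D (H i m) (HH i m).
Hypothesis HHC : forall i m n x, HH i m n x = HH i n m x.
Variables (g : 'I_k -> 'rV[R[i]]_k -> R[i]).
Variables (dg : 'I_k -> 'I_k -> 'rV[R[i]]_k -> R[i]).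
Hypothesis gdg : forall i, hol11 D (g i) (dg i).
Hypothesis h_isolated : forall x, vabs x <= r -> (forall i, h i x = 0) -> x = 0.

Let hol_coord l : hol11 D (fun x : 'rV[R[i]]_k => x 0 l) (fun m _ => (m == l)%:R).
Proof.
exists (r + 1) => [|x y [Dx Dy xy]]; first by rewrite addr_ge0// ltW.
have E : pairing (fun m : 'I_k => (m == l)%:R) (y - x) = y 0 l - x 0 l.
  rewrite /pairing (bigD1 l)//= eqxx mul1r big1 ?addr0 ?mxE// => m /negbTE ->.
  by rewrite mul0r.
rewrite E subrr cabs0; split.
- by rewrite mulr_ge0 ?sqr_ge0// addr_ge0// ltW.
- by apply: le_trans (vabs_coord _ _) (le_trans Dx _); rewrite lerDl.
- by apply: le_trans (vabs_coord _ _) (le_trans Dy _); rewrite lerDl.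
- have := vabs_coord (y - x) l; rewrite !mxE => /le_trans; apply.
  by rewrite ler_peMl ?vabs_ge0// lerDr ltW.
Qed.

Let sqh x : R[i] := \sum_i h i x * conjc (h i x).
Let sqx (x : 'rV[R[i]]_k) : R[i] := \sum_l x 0 l * conjc (x 0 l).

Let sqE (I : finType) (z : I -> R[i]) :
  \sum_i z i * conjc (z i) = (\sum_i cabs (z i) ^+ 2)%:C.
Proof. by rewrite rmorph_sum; apply: eq_bigr => i _ /=; rewrite -sqr_cabs. Qed.

Let hol11_sqr_lip f df : hol11 D f df -> exists2 L : R, 0 <= L &
  forall x y, vabs x <= r -> vabs y <= r -> vabs (y - x) <= 1 ->
     `|cabs (f y) ^+ 2 - cabs (f x) ^+ 2| <= L * vabs (y - x).
Proof.
move=> [M M0 fM]; exists (4 * M * M) => [|x y Dx Dy xy]; first by rewrite !mulr_ge0.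
have [//|a1 a2 a3 a4] := fM x y; rewrite /gap in a1 a4.
have v0 := vabs_ge0 (y - x).
have a5 : cabs (f y - f x) <= 2 * M * vabs (y - x).
  rewrite (_ : f y - f x = (f y - f x - pairing (df^~ x) (y - x)) + pairing (df^~ x) (y - x));
    last by ring.
  apply: le_trans (cabsD _ _) _.
  have : M * vabs (y - x) ^+ 2 <= M * vabs (y - x) by rewrite ler_wpM2l// expr2 ler_piMr.
  lra.
have a6 : `|cabs (f y) - cabs (f x)| <= 2 * M * vabs (y - x).
  apply: le_trans a5; rewrite ler_norml; apply/andP; split.
    have := cabsD (f y) (f x - f y); rewrite addrC subrK cabsB; lra.
  have := cabsD (f x) (f y - f x); rewrite addrC subrK; lra.
rewrite subr_sqr normrM (_ : 4 * M * M * _ = (2 * M * vabs (y - x)) * (M + M)); last by ring.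
apply: ler_pM => //; rewrite ger0_norm ?addr_ge0 ?cabs_ge0//; exact: lerD.
Qed.

Let sum_lip (I : finType) (F : I -> 'rV[R[i]]_k -> R) :
  (forall i, exists2 L : R, 0 <= L &
  forall x y, vabs x <= r -> vabs y <= r -> vabs (y - x) <= 1 ->
     `|F i y - F i x| <= L * vabs (y - x)) ->
  exists2 L : R, 0 <= L &
  forall x y, vabs x <= r -> vabs y <= r -> vabs (y - x) <= 1 ->
     `|\sum_i F i y - \sum_i F i x| <= L * vabs (y - x).
Proof.
move=> FL; have {}FL i := cid2 (FL i).
exists (\sum_i projT1 (FL i)) => [|x y Dx Dy xy].
  by apply: sumr_ge0 => i _; case: (projT2 (FL i)).
rewrite -sumrB mulr_suml; apply: le_trans (ler_norm_sum _ _ _) _.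
by apply: ler_sum => i _; case: (projT2 (FL i)) => _; apply.
Qed.

Let rho := r / (2 * k%:R).
Let k1 : 0 < k%:R :> R. Proof. by rewrite ltr0n. Qed.
Let rho0 : 0 < rho. Proof. by rewrite divr_gt0 ?mulr_gt0. Qed.
Let rhoE : 2 * k%:R * rho = r. Proof. by rewrite /rho mulrC divfK// mulf_neq0// gt_eqF. Qed.

Let shellP : exists2 e : R, 0 < e & forall x, rho / 2 <= vabs x <= r ->
  e <= complex.Re (sqh x) /\ e <= complex.Re (sqx x).
Proof.
have rho2 : 0 < rho / 2 by rewrite divr_gt0.
have xneq0 x : rho / 2 <= vabs x -> x != 0.
  by apply: contraTneq => ->; rewrite vabs0 -ltNge.
have sum_sqr_gt0 (I : finType) (z : I -> R[i]) :
    (exists i, z i != 0) -> 0 < \sum_i cabs (z i) ^+ 2.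
  move=> [i zi]; rewrite (bigD1 i)//= ltr_pwDl ?exprn_gt0 ?cabs_gt0//.
  by apply: sumr_ge0 => ? _; rewrite exprn_ge0 ?cabs_ge0.
have [L1 L10 L1P] := sum_lip (fun i => hol11_sqr_lip (hH i)).
have [L2 L20 L2P] := sum_lip (fun l => hol11_sqr_lip (hol_coord l)).
have [|e1 e10 e1P] := shell_min rho2 L10 L1P.
  move=> x /andP[/xneq0 xn0 xr]; apply: sum_sqr_gt0; apply: contrapT => hx.
  move/eqP: xn0; apply; apply: h_isolated => // i; apply/eqP; apply: contrapT => /negP hi.
  by apply: hx; exists i.
have [|e2 e20 e2P] := shell_min rho2 L20 L2P.
  move=> x /andP[/xneq0 xn0 xr]; apply: sum_sqr_gt0; apply: contrapT => hx.
  move/eqP: xn0; apply; apply/rowP => i; rewrite mxE; apply/eqP; apply: contrapT => /negP hi.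
  by apply: hx; exists i.
exists (Num.min e1 e2) => [|x xs]; first by rewrite lt_min e10.
by rewrite /sqh /sqx !sqE /= !ge_min e1P// e2P// orbT.
Qed.

(* [A t] is the conjugate Jacobian matrix of [(1 - t) B^T conj h + t conj x], and
   [q t] is the product of this vector with [x]; at [t = 0] and [t = 1] this is
   the square norm of [h] and of [x].  [w] is the derivative in [t] of the
   vector. *)
Let A (t : R) x : 'M[R[i]]_k :=
  \matrix_(l, m) ((1 - t)%:C * \sum_i B i l x * conjc (H i m x) + t%:C * (l == m)%:R).
Let dA (t : R) n x : 'M[R[i]]_k :=
  \matrix_(l, m) ((1 - t)%:C * \sum_i B i l x * conjc (HH i m n x)).
Let q (t : R) x : R[i] := (1 - t)%:C * sqh x + t%:C * sqx x.
Let w (x : 'rV[R[i]]_k) : 'rV[R[i]]_k := \row_l (conjc (x 0 l) - \sum_i B i l x * conjc (h i x)).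
Let dw (n : 'I_k) (x : 'rV[R[i]]_k) : 'rV[R[i]]_k :=
  \row_l ((n == l)%:R - \sum_i B i l x * conjc (H i n x)).

Let AdA t l m : has_dbar D (fun x => A t x l m) (fun n x => dA t n x l m).
Proof.
have E i := has_dbarM (hol11_dbar (BdB i l)) (hol11_conj_dbar (HHH i m)).
have S := has_dbarM (has_dbar_cst D (1 - t)%:C) (has_dbar_sum (index_enum 'I_k) E).
have S' := has_dbarD S (has_dbar_cst D (t%:C * (l == m)%:R)).
apply: has_dbar_eq S' _ _ => [x|n x]; rewrite mxE // mul0r add0r addr0.
by congr (_ * _); apply: eq_bigr => i _; rewrite mul0r add0r.
Qed.

Let dAC t x m m' l : dA t m x l m' = dA t m' x l m.
Proof. by rewrite !mxE; congr (_ * _); apply: eq_bigr => i _; rewrite HHC. Qed.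

Let qdbar t : has_dbar_real D (q t) (fun m x => (x *m A t x) 0 m).
Proof.
have Sh := has_dbar_real_sum (index_enum 'I_k) (fun i => has_dbar_real_sqr (hH i)).
have Sx := has_dbar_real_sum (index_enum 'I_k) (fun l => has_dbar_real_sqr (hol_coord l)).
have S := has_dbar_realD (has_dbar_realZ (1 - t) Sh) (has_dbar_realZ t Sx).
apply: has_dbar_real_eq S _ _ => // m x; rewrite mxE.
under [RHS]eq_bigr do rewrite mxE mulrDr.
rewrite big_split /=; congr (_ + _).
  under [RHS]eq_bigr do rewrite mulrCA mulr_sumr.
  rewrite -mulr_sumr exchange_big; congr (_ * _); apply: eq_bigr => i _ /=.
  by rewrite /h mulr_suml; apply: eq_bigr => l _; rewrite mulrCA mulrA.
rewrite mulr_sumr; apply: eq_bigr => l _.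
by rewrite mulrCA conjc_nat eq_sym.
Qed.

Let wdw l : has_dbar D (fun x => w x 0 l) (fun n x => dw n x 0 l).
Proof.
have E i := has_dbarM (hol11_dbar (BdB i l)) (hol11_conj_dbar (hH i)).
have S := has_dbarM (has_dbar_cst D (-1)) (has_dbar_sum (index_enum 'I_k) E).
have S' := has_dbarD (hol11_conj_dbar (hol_coord l)) S.
apply: has_dbar_eq S' _ _ => [x|n x]; rewrite mxE ?mulN1r // mul0r add0r conjc_nat.
by congr (_ - _); apply: eq_bigr => i _; rewrite mul0r add0r.
Qed.

Section Shell.
Variable e : R.
Hypothesis e0 : 0 < e.
Hypothesis shell_e : forall x, rho / 2 <= vabs x <= r ->
  e <= complex.Re (sqh x) /\ e <= complex.Re (sqx x).

Let kern (t : R) x : R[i] := (cutoff e 2 (complex.Re (q t x)))%:C * \det (A t x).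
Let dkern (t : R) x : R[i] := \sum_m
  dflux (cutoff e 2) (fun s => - 2 * cutoff e 1 s) (A t) (dA t) id (q t) w dw m m x.

(* The divergence of the flux is the derivative in [t] of [kern t], so that the
   lattice sum of [kern t] is almost independent of [t]. *)
Let dkernE t x : dkern t x =
  (- 2 * cutoff e 1 (complex.Re (q t x)))%:C * (sqx x - sqh x) * \det (A t x) +
  (cutoff e 2 (complex.Re (q t x)))%:C *
    \sum_l \det (setrow l (\row_m ((l == m)%:R - \sum_i B i l x * conjc (H i m x))) (A t x)).
Proof.
rewrite /dkern divergence_flux; last exact: dAC.
congr (_ * _ * _ + _ * _).
  under eq_bigr do rewrite mxE mulrBl.
  rewrite sumrB; congr (_ - _); first by apply: eq_bigr => l _; rewrite mulrC.
  under eq_bigr do rewrite mulr_suml.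
  rewrite exchange_big; apply: eq_bigr => i _ /=.
  by rewrite /h mulr_suml; apply: eq_bigr => l _; rewrite mulrAC.
apply: eq_bigr => l _; congr (\det (setrow _ _ _)).
by apply/rowP => m; rewrite !mxE eq_sym.
Qed.

Let q_real t x : q t x = ((1 - t) * complex.Re (sqh x) + t * complex.Re (sqx x))%:C.
Proof. by rewrite /q /sqh /sqx !sqE -!realcM -rmorphD. Qed.

Let sum_dkern t : 0 <= t <= 1 -> exists2 M : R, 0 <= M &
  forall N, (4 <= N)%N -> 2 * rho / N%:R <= 1 ->
  cabs (\sum_(o : {ffun 'I_k * bool -> 'I_N}) dkern t (point rho o)) <=
    M * #|{: {ffun 'I_k * bool -> 'I_N}}|%:R / N%:R.
Proof.
move=> /andP[t0 t1].
pose fl m := flux (cutoff e 2) (A t) (q t) w m.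
pose dfl m := dflux (cutoff e 2) (fun s => - 2 * cutoff e 1 s) (A t) (dA t) id (q t) w dw m.
have flP m : has_dbar D (fl m) (dfl m).
  by apply: flux_dbar; [exact: cutoff2_C11 | exact: AdA | exact: qdbar | exact: wdw].
have sup m x : rho / 2 <= vabs x <= 2 * k%:R * rho -> fl m x = 0 /\ dfl m m x = 0.
  rewrite rhoE => /shell_e[s1 s2].
  have eq : e <= complex.Re (q t x).
    rewrite q_real /=; have := ler_wpM2l (_ : 0 <= 1 - t) s1; have := ler_wpM2l t0 s2.
    rewrite subr_ge0 => h1 /(_ t1) h2; lra.
  by split; [apply: flux_eq0 | apply: dflux_eq0]; rewrite ?cutoff0 ?mulr0//.
have DP x : vabs x <= 2 * k%:R * rho -> D x by rewrite rhoE.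
have MP m := cid2 (sum_dbar rho0 DP (flP m) (sup m)).
exists (\sum_m projT1 (MP m)) => [|N N4 c1].
  by apply: sumr_ge0 => m _; case: (projT2 (MP m)).
rewrite exchange_big /= !mulr_suml; apply: le_trans (cabs_sum _ _ _) _.
by apply: ler_sum => m _; case: (projT2 (MP m)) => _; apply.
Qed.

Let bdd (u : 'rV[R[i]]_k -> R[i]) :=
  exists2 M : R, 0 <= M & forall x, D x -> cabs (u x) <= M.

Let hol11_bdd f df : hol11 D f df -> bdd f.
Proof.
move=> [M M0 fM]; exists M => // x Dx; case: (fM x x) => //.
by split; rewrite // subrr vabs0.
Qed.

Let bddM u v : bdd u -> bdd v -> bdd (fun x => u x * v x).
Proof.
move=> [M M0 uM] [N N0 vN]; exists (M * N) => [|x Dx]; first exact: mulr_ge0.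
by rewrite cabsM; apply: ler_pM; rewrite ?cabs_ge0// ?uM// vN.
Qed.

Let bdd_conj u : bdd u -> bdd (fun x => conjc (u x)).
Proof. by move=> [M M0 uM]; exists M => // x Dx; rewrite cabs_conj uM. Qed.

Let bdd_sum (u : 'I_k -> 'rV[R[i]]_k -> R[i]) : (forall i, bdd (u i)) ->
  bdd (fun x => \sum_i u i x).
Proof.
move=> uM; have {}uM i := cid2 (uM i); exists (\sum_i projT1 (uM i)) => [|x Dx].
  by apply: sumr_ge0 => i _; case: (projT2 (uM i)).
apply: le_trans (cabs_sum _ _ _) _; apply: ler_sum => i _.
by case: (projT2 (uM i)) => _; apply.
Qed.

Let X2 := ('rV[R[i]]_k * R)%type.
Let adm2 (u v : X2) := [/\ v.1 = u.1, D u.1, 0 <= u.2 <= 1 & 0 <= v.2 <= 1].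
Let sz2 (u v : X2) : R := `|v.2 - u.2|.

Let sz201 u v : adm2 u v -> 0 <= sz2 u v <= 1.
Proof.
move=> [_ _ /andP[u0 u1] /andP[v0 v1]]; rewrite /sz2 normr_ge0 /= ler_norml.
by apply/andP; split; lra.
Qed.

Let aff_C11 u v : bdd u -> bdd v ->
  C11 adm2 sz2 (fun z => (1 - z.2)%:C * u z.1 + z.2%:C * v z.1)
               (fun z z' => (z'.2 - z.2)%:C * (v z.1 - u z.1)).
Proof.
move=> [M M0 uM] [N N0 vN]; exists (M + N) => [|[x t] [x' t'] [/= -> Dx t1 t'1]].
  exact: addr_ge0.
have affb (t2 : R) : 0 <= t2 <= 1 -> cabs ((1 - t2)%:C * u x + t2%:C * v x) <= M + N.
  move=> /andP[a0 a1]; apply: le_trans (cabsD _ _) _; rewrite !cabsM !cabs_real.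
  rewrite !ger0_norm ?subr_ge0//; apply: lerD.
    apply: le_trans (uM x Dx); rewrite ler_piMl ?cabs_ge0//; lra.
  by apply: le_trans (vN x Dx); rewrite ler_piMl ?cabs_ge0.
split; rewrite ?affb//.
  rewrite (_ : _ - _ - _ = 0); last by rewrite !rmorphB /=; ring.
  by rewrite cabs0 mulr_ge0 ?sqr_ge0// addr_ge0.
rewrite cabsM cabs_real mulrC ler_wpM2r//; apply: le_trans (cabsBD _ _) _.
by rewrite addrC lerD ?uM ?vN.
Qed.

Let kern_C11 : C11 adm2 sz2 (fun z => kern z.2 z.1)
  (fun z z' => (z'.2 - z.2)%:C * dkern z.2 z.1).
Proof.
have bh i := hol11_bdd (hH i); have bx l := hol11_bdd (hol_coord l).
have qC := aff_C11 (bdd_sum (fun i => bddM (bh i) (bdd_conj (bh i))))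
                   (bdd_sum (fun i => bddM (bx i) (bdd_conj (bx i)))).
pose Ad (z z' : X2) : 'M[R[i]]_k := \matrix_(l, m)
  ((z'.2 - z.2)%:C * ((l == m)%:R - \sum_i B i l z.1 * conjc (H i m z.1))).
have bc (c : R[i]) : bdd (fun=> c).
  by exists (cabs c) => [|x Dx]; rewrite ?cabs_ge0.
have AC l m : C11 adm2 sz2 (fun z => A z.2 z.1 l m) (fun z z' => Ad z z' l m).
  have := aff_C11 (bdd_sum (fun i => bddM (hol11_bdd (BdB i l)) (bdd_conj (hol11_bdd (HHH i m)))))
     (bc (l == m)%:R).
  by move=> C; apply: C11_ext C _ => x y _; rewrite !mxE.
have := C11M sz201 (C11_real sz201 (cutoff2_C11 e) qC) (C11_det sz201 AC).
move=> C; apply: C11_ext C _ => -[x t] [x' t'] _; split=> //=.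
rewrite dkernE mulrDr; congr (_ + _).
  have sqb : (complex.Re (sqx x - sqh x))%:C = sqx x - sqh x.
    by rewrite /sqx /sqh !sqE -rmorphB.
  set X := - 2 * cutoff e 1 (complex.Re (q t x)).
  have -> : (X * complex.Re ((t' - t)%:C * (sqx x - sqh x)))%:C =
      (t' - t)%:C * (X%:C * (sqx x - sqh x)).
    rewrite realcM mulrCA; congr (_ * _).
    by rewrite -sqb -realcM.
  by rewrite !mulrA.
rewrite mulrCA; congr (_ * _); rewrite mulr_sumr; apply: eq_bigr => l _.
rewrite -det_setrowZ; congr (\det (setrow _ _ _)).
by apply/rowP => m; rewrite !mxE.
Qed.

Let A2 x : 'M[R[i]]_k := \matrix_(i, m) conjc (H i m x).

Let kern0E x : kern 0 x =
  (cutoff e 2 (complex.Re (sqh x)))%:C * (\det (\matrix_(i, l) B i l x) * \det (A2 x)).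
Proof.
rewrite /kern; congr (_%:C * _).
  by rewrite /q subr0 mul1r mul0r addr0.
rewrite -(det_tr (\matrix_(i, l) B i l x)) -det_mulmx; congr (\det _).
apply/matrixP => l m; rewrite !mxE subr0 mul1r mul0r addr0.
by apply: eq_bigr => i _; rewrite /A2 !mxE.
Qed.

Let kern1E x : kern 1 x = (cutoff e 2 (complex.Re (sqx x)))%:C.
Proof.
rewrite /kern /q subrr mul0r mul1r add0r (_ : A 1 x = 1%:M) ?det1 ?mulr1//.
by apply/matrixP => l m; rewrite !mxE subrr mul0r mul1r add0r.
Qed.

Hypothesis detB_ideal : forall x, D x ->
  \det (\matrix_(i, l) B i l x) = \sum_i g i x * h i x.

(* If [\det B] is in the ideal of [h], then [kern 0] is itself a divergence: take
   for [w] its coefficients and for [q] the square norm of [h]. *)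
Let sum_kern0 : exists2 M : R, 0 <= M & forall N, (4 <= N)%N -> 2 * rho / N%:R <= 1 ->
  cabs (\sum_(o : {ffun 'I_k * bool -> 'I_N}) kern 0 (point rho o)) <=
    M * #|{: {ffun 'I_k * bool -> 'I_N}}|%:R / N%:R.
Proof.
pose dA2 n x : 'M[R[i]]_k := \matrix_(i, m) conjc (HH i m n x).
pose y2 x : 'rV[R[i]]_k := \row_i h i x.
pose w2 x : 'rV[R[i]]_k := \row_i g i x.
pose dw2 (n : 'I_k) (x : 'rV[R[i]]_k) : 'rV[R[i]]_k := 0.
pose fl m := flux (cutoff e 3) A2 sqh w2 m.
pose dfl m := dflux (cutoff e 3) (fun s => - 3 * cutoff e 2 s) A2 dA2 y2 sqh w2 dw2 m.
have flP m : has_dbar D (fl m) (dfl m).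
  apply: flux_dbar; first exact: cutoff3_C11.
  - move=> i l; apply: has_dbar_eq (hol11_conj_dbar (HHH i l)) _ _ => [x|n x]; by rewrite mxE.
  - apply: has_dbar_real_eq (has_dbar_real_sum (index_enum 'I_k) (fun i => has_dbar_real_sqr (hH i))) _ _ => // n x.
    by rewrite mxE; apply: eq_bigr => i _; rewrite !mxE.
  - by move=> i; apply: has_dbar_eq (hol11_dbar (gdg i)) _ _ => [x|n x]; rewrite mxE.
have sup m x : rho / 2 <= vabs x <= 2 * k%:R * rho -> fl m x = 0 /\ dfl m m x = 0.
  rewrite rhoE => /shell_e[s1 _].
  by split; [apply: flux_eq0 | apply: dflux_eq0]; rewrite ?cutoff0 ?mulr0//.
have divE x : D x -> \sum_m dfl m m x = - 3 * kern 0 x.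
  move=> Dx; rewrite divergence_flux; last first.
    by move=> z m m' i; rewrite !mxE HHC.
  rewrite [X in _ + _ * X]big1 ?mulr0 ?addr0 => [|i _]; last first.
    by rewrite (_ : \row_m _ = 0) ?det_setrow0//; apply/rowP => m; rewrite !mxE.
  have -> : \sum_i w2 x 0 i * y2 x 0 i = \det (\matrix_(i, l) B i l x).
    by rewrite detB_ideal//; apply: eq_bigr => i _; rewrite !mxE.
  by rewrite kern0E realcM rmorphN /= rmorph_nat !mulrA.
have DP x : vabs x <= 2 * k%:R * rho -> D x by rewrite rhoE.
have MP m := cid2 (sum_dbar rho0 DP (flP m) (sup m)).
exists (\sum_m projT1 (MP m)) => [|N N4 c1].
  by apply: sumr_ge0 => m _; case: (projT2 (MP m)).
have E : \sum_(o : {ffun 'I_k * bool -> 'I_N}) kern 0 (point rho o) =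
    (- 3)^-1 * \sum_m \sum_(o : {ffun 'I_k * bool -> 'I_N}) dfl m m (point rho o).
  rewrite exchange_big mulr_sumr; apply: eq_bigr => o _ /=.
  by rewrite divE ?mulKf ?oppr_eq0 ?pnatr_eq0//; apply: DP; apply: point_bound.
rewrite E cabsM cabsV cabsN.
have -> : cabs 3 = 3 :> R.
  by rewrite (_ : 3 = (3%:R)%:C :> R[i]) ?cabs_real ?ger0_norm// rmorph_nat.
apply: (@le_trans _ _ (cabs (\sum_m \sum_(o : {ffun 'I_k * bool -> 'I_N}) dfl m m (point rho o)))).
  by rewrite ler_piMl ?cabs_ge0// invf_le1// ler1n.
rewrite !mulr_suml; apply: le_trans (cabs_sum _ _ _) _.
by apply: ler_sum => m _; case: (projT2 (MP m)) => _; apply.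
Qed.

Let sum_kern1 : exists (P : nat) (c0 : R), [/\ (0 < P)%N, 0 < c0 &
  forall n, (0 < n)%N -> c0 * #|{: {ffun 'I_k * bool -> 'I_(P * n)}}|%:R <=
    cabs (\sum_(o : {ffun 'I_k * bool -> 'I_(P * n)}) kern 1 (point rho o))].
Proof.
pose F x := cutoff e 2 (complex.Re (sqx x)).
pose s := Num.min 1 (e / 2).
have s0 : 0 < s by rewrite lt_min ltr01 divr_gt0.
have [|||P [c0 [P0 c00 Pc]]] := @sum_bump R k rho rho0 F s ((e / 2) ^+ 2) s0.
- by rewrite exprn_gt0// divr_gt0.
- by move=> x; apply: cutoff_ge0.
- move=> x; rewrite le_min => /andP[x1 xe]; rewrite /F /cutoff lerXn2r ?nnegrE//.
  + by rewrite divr_ge0// ltW.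
  + by rewrite le_max lexx orbT.
  rewrite le_max; apply/orP; left; rewrite /sqx sqE /=.
  have : \sum_l cabs (x 0 l) ^+ 2 <= vabs x.
    apply: ler_sum => l _; rewrite expr2 ler_piMr ?cabs_ge0//.
    exact: le_trans (vabs_coord x l) x1.
  lra.
exists P, c0; split=> // n n0; apply: le_trans (Pc n n0) _.
under [X in cabs X]eq_bigr do rewrite kern1E.
by rewrite -rmorph_sum /= cabs_real ler_norm.
Qed.

(** Summation over [S] steps of the homotopy, with [S] chosen first and the
    number of nodes afterwards, contradicts the lower bound for [kern 1]. *)
Lemma transition_false : False.
Proof.
have [P [c0 [P0 c00 Pc]]] := sum_kern1.
have [M0 M00 M0P] := sum_kern0.
have [M1 M10 M1P] := kern_C11.
pose S := (Num.truncn (2 * M1 / c0)).+1.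
have S0 : 0 < S%:R :> R by rewrite ltr0n.
have SM : M1 / S%:R <= c0 / 2.
  rewrite ler_pdivrMr// -ler_pdivrMl ?divr_gt0// invf_div.
  by apply/ltW; rewrite mulrAC; exact: truncnS_gt.
pose t j : R := j%:R / S%:R.
have t01 (j : nat) : (j <= S)%N -> 0 <= t j <= 1.
  by move=> jS; rewrite /t divr_ge0//= ler_pdivrMr// mul1r ler_nat.
have MP (j : 'I_S) := cid2 (sum_dkern (t01 j (ltnW (ltn_ord j)))).
pose M2 := \sum_j projT1 (MP j).
have M20 : 0 <= M2 by apply: sumr_ge0 => j _; case: (projT2 (MP j)).
pose n := ((Num.truncn (2 * (M0 + M2) / c0)).+1 + (Num.truncn (2 * rho)).+1 + 4)%N.
have n0 : (0 < n)%N by rewrite /n addnS.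
pose N := (P * n)%N.
have nN : (n <= N)%N by rewrite leq_pmull.
have N4 : (4 <= N)%N by apply: leq_trans nN; rewrite leq_addl.
have Npos : 0 < N%:R :> R by rewrite ltr0n (leq_trans _ N4).
have N1 : 2 * rho / N%:R <= 1.
  rewrite ler_pdivrMr// mul1r; apply: (@le_trans _ _ (Num.truncn (2 * rho)).+1%:R).
    exact/ltW/truncnS_gt.
  by rewrite ler_nat (leq_trans _ nN)// /n -addnA addnCA leq_addr.
have NM : (M0 + M2) / N%:R < c0 / 2.
  rewrite ltr_pdivrMr// -ltr_pdivrMl ?divr_gt0// invf_div mulrAC.
  apply: (@lt_le_trans _ _ (Num.truncn (2 * (M0 + M2) / c0)).+1%:R); first exact: truncnS_gt.
  by rewrite ler_nat (leq_trans _ nN)// /n -addnA leq_addr.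
pose T s := \sum_(o : {ffun 'I_k * bool -> 'I_N}) kern s (point rho o).
pose C : R := #|{: {ffun 'I_k * bool -> 'I_N}}|%:R.
have C0 : 0 < C.
  by rewrite ltr0n card_ffun card_ord expn_gt0 (leq_trans _ N4).
have step (j : 'I_S) : cabs (T (t j.+1) - T (t j)) <=
    C * (M1 / S%:R / S%:R) + C * (projT1 (MP j) / N%:R / S%:R).
  have tj : t j.+1 - t j = S%:R^-1 by rewrite /t -natr1 mulrDl addrAC subrr add0r mul1r.
  pose dk := \sum_(o : {ffun 'I_k * bool -> 'I_N}) dkern (t j) (point rho o).
  have -> : T (t j.+1) - T (t j) = (T (t j.+1) - T (t j) - (t j.+1 - t j)%:C * dk) +
     (t j.+1 - t j)%:C * dk by rewrite subrK.
  apply: le_trans (cabsD _ _) _; apply: lerD.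
    rewrite /T /dk -sumrB mulr_sumr -sumrB; apply: le_trans (cabs_sum _ _ _) _.
    rewrite /C mulr_natl -sumr_const; apply: ler_sum => o _.
    have [|hd _ _ _] := M1P (point rho o, t j) (point rho o, t j.+1).
      split=> //=; last 2 first.
      - by apply: t01; apply: ltnW.
      - by apply: t01.
      - by rewrite /D /= -[leRHS]rhoE point_bound.
    apply: le_trans hd _; rewrite /sz2 /= tj ger0_norm ?invr_ge0//.
    by rewrite expr2 mulrA lexx.
  rewrite tj cabsM cabs_real ger0_norm ?invr_ge0//.
  have [_ hM] := projT2 (MP j); have := hM N N4 N1; rewrite -/dk -/C => hd.
  apply: (@le_trans _ _ (S%:R^-1 * (projT1 (MP j) * C / N%:R))).
    by rewrite ler_wpM2l ?invr_ge0.
  by rewrite le_eqVlt; apply/orP; left; apply/eqP; ring.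
have tele : cabs (T 1 - T 0) <= \sum_(j < S) (C * (M1 / S%:R / S%:R) + C * (projT1 (MP j) / N%:R / S%:R)).
  have -> : T 1 - T 0 = \sum_(j < S) (T (t j.+1) - T (t j)).
    exact: unit_telescope.
  by apply: le_trans (cabs_sum _ _ _) _; apply: ler_sum => j _.
have bound : \sum_(j < S) (C * (M1 / S%:R / S%:R) + C * (projT1 (MP j) / N%:R / S%:R))
    <= C * (M1 / S%:R) + C * (M2 / N%:R).
  rewrite big_split /= sumr_const card_ord; apply: lerD.
    rewrite -[leLHS]mulr_natl le_eqVlt; apply/orP; left; apply/eqP; field.
    by rewrite gt_eqF.
  rewrite -mulr_sumr ler_pM2l// /M2 mulr_suml; apply: ler_sum => j _.
  rewrite ler_pdivrMr// ler_peMr// ?ler1n//.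
  by rewrite divr_ge0//; case: (projT2 (MP j)).
have h1 := Pc n n0; have h0 := M0P N N4 N1.
rewrite -/N -/C -/(T 1) in h1; rewrite -/C -/(T 0) in h0.
have h2 : cabs (T 1) <= cabs (T 1 - T 0) + cabs (T 0).
  by apply: le_trans (cabsD _ _); rewrite subrK.
have : C * c0 <= C * (M1 / S%:R + (M0 + M2) / N%:R).
  rewrite mulrC; apply: le_trans h1 _; apply: le_trans h2 _.
  rewrite mulrDr [(M0 + M2) / _]mulrDl [C * (_ + _)]mulrDr [C * (M0 / _)]mulrA [C * M0]mulrC.
  apply: le_trans (lerD (le_trans tele bound) h0) _.
  by rewrite le_eqVlt; apply/orP; left; apply/eqP; ring.
by rewrite ler_pM2l// leNgt [c0]splitr ler_ltD.
Qed.

End Shell.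

(** The residue of [\det B] at an isolated zero of [h = B x] is that of [1] at the
    zero of [x], which is not zero, whereas residues vanish on the ideal. *)
Lemma det_notin_ideal : (forall x, vabs x <= r ->
  \det (\matrix_(i, l) B i l x) = \sum_i g i x * h i x) -> False.
Proof. by move=> detB; have [e e0 eP] := shellP; exact: (transition_false e0 eP). Qed.

End Transition.

(** * Goursat's theorem *)

Section Primitive.
Variable R : realType.

Lemma real_primitive (g : R -> R) (m : R) : continuous g ->
  exists G : R -> R, forall x, m < x -> is_derive x 1 G (g x).
Proof.
move=> gc; exists (fun x => \int[lebesgue_measure]_(t in [set` `[m, x]]) g t)%R => x mx.
have xx : x < x + 1 by rewrite ltrDl.
have gi : lebesgue_measure.-integrable [set` `[m, x + 1]] (EFin \o g).
  apply: continuous_compact_integrable; first exact: segment_compact.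
  exact: continuous_subspaceT.
have [dG GE] := continuous_FTC1_closed xx gi mx (gc x).
by split; [exact: dG | rewrite -derive1E].
Qed.

Lemma real_primitive_affine (g G : R -> R) (m c0 c1 eta x y : R) :
  (forall x, m < x -> is_derive x 1 G (g x)) -> m < x -> x <= y ->
  (forall s, x <= s <= y -> `|g s - (c0 + c1 * s)| <= eta) ->
  `|G y - G x - (c0 * (y - x) + c1 * (y ^+ 2 - x ^+ 2) / 2)| <= eta * (y - x).
Proof.
move=> Gg mx xy gs; have [->|xy'] := eqVneq x y.
  by rewrite !subrr !mulr0 mul0r addr0 subrr normr0.
pose K s := G s - (c0 * s + c1 / 2 * s ^+ 2).
have dK s : m < s -> is_derive s 1 K (g s - (c0 + c1 * s)).
  move=> ms; have Gs := Gg s ms.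
  apply: is_derive_eq; rewrite /GRing.scale /=.
  by field.
have xly : x < y by rewrite lt_neqAle xy' xy.
have [||s /[!in_itv] /= /andP[xs sy] sE] := @MVT R K (fun s => g s - (c0 + c1 * s)) x y xly.
- move=> s; rewrite in_itv /= => /andP[xs _]; apply: dK; exact: lt_trans xs.
- apply: derivable_within_continuous => s; rewrite in_itv /= => /andP[xs _].
  by have [] := dK s (lt_le_trans mx xs).
have -> : G y - G x - (c0 * (y - x) + c1 * (y ^+ 2 - x ^+ 2) / 2) = K y - K x.
  by rewrite /K; field.
rewrite sE normrM [`|y - x|]ger0_norm ?subr_ge0// ler_wpM2r ?subr_ge0//.
by apply: gs; rewrite !ltW.
Qed.

(** The estimate is stated against an affine function, since in Goursat's
    argument [f] is compared with its first-order expansion. *)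
Lemma complex_primitive (g : R -> R[i]) (m : R) :
  (forall x e, 0 < e -> exists2 d, 0 < d & forall x', `|x' - x| < d -> cabs (g x' - g x) < e) ->
  exists G : R -> R[i], forall (a b : R[i]) (eta x y : R), m < x -> x <= y ->
  (forall s, x <= s <= y -> cabs (g s - (a + b * s%:C)) <= eta) ->
  cabs (G y - G x - (a * (y - x)%:C + b * (y ^+ 2 - x ^+ 2)%:C / 2)) <= 2 * eta * (y - x).
Proof.
move=> gc.
have ReB (u v : R[i]) : complex.Re (u - v) = complex.Re u - complex.Re v.
  by case: u v => [? ?] [? ?].
have ImB (u v : R[i]) : complex.Im (u - v) = complex.Im u - complex.Im v.
  by case: u v => [? ?] [? ?].
have rc : continuous (fun x => complex.Re (g x)).
  move=> x; apply/(@cvgrPdist_lt _ _ _ (nbhs x)) => e e0; have [d d0 dP] := gc x e e0.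
  near=> x'; rewrite distrC -ReB; apply: le_lt_trans (Re_le_cabs _) (dP _ _).
  by near: x'; apply/nbhs_ballP; exists d => //= z xz; rewrite distrC; exact: xz.
have ic : continuous (fun x => complex.Im (g x)).
  move=> x; apply/(@cvgrPdist_lt _ _ _ (nbhs x)) => e e0; have [d d0 dP] := gc x e e0.
  near=> x'; rewrite distrC -ImB; apply: le_lt_trans (Im_le_cabs _) (dP _ _).
  by near: x'; apply/nbhs_ballP; exists d => //= z xz; rewrite distrC; exact: xz.
have [G1 G1P] := real_primitive m rc; have [G2 G2P] := real_primitive m ic.
exists (fun x => G1 x +i* G2 x) => a b eta x y mx xy gs.
apply: le_trans (cabs_le_ReIm _) _; rewrite (_ : 2 * eta * (y - x) = eta * (y - x) + eta * (y - x)); last by ring.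
case: a b gs => [a1 a2] [b1 b2] gs.
have two : (2 : R[i])^-1 = (2^-1)%:C by rewrite fmorphV rmorph_nat.
rewrite two; apply: lerD.
- have := @real_primitive_affine _ _ m a1 b1 eta x y G1P mx xy.
  rewrite (_ : complex.Re _ = G1 y - G1 x - (a1 * (y - x) + b1 * (y ^+ 2 - x ^+ 2) / 2)); last first.
    by simpc => /=; ring.
  apply => s /gs; apply: le_trans; rewrite -[_ - _]/(complex.Re (_ +i* 0)).
  apply: le_trans (Re_le_cabs _); case: (g s) => [u v] /=.
  by rewrite (_ : _ - _ = u - (a1 + (b1 * s - b2 * 0)))//; ring.
- have := @real_primitive_affine _ _ m a2 b2 eta x y G2P mx xy.
  rewrite (_ : complex.Im _ = G2 y - G2 x - (a2 * (y - x) + b2 * (y ^+ 2 - x ^+ 2) / 2)); last first.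
    by simpc => /=; ring.
  apply => s /gs; apply: le_trans.
  apply: le_trans (Im_le_cabs _); case: (g s) => [u v] /=.
  by rewrite (_ : _ - _ = v - (a2 + (b1 * 0 + b2 * s)))//; ring.
Unshelve. all: by end_near. Qed.

End Primitive.

Section Goursat.
Variables (R : realType) (rho : R).
Hypothesis rho0 : 0 < rho.

Definition square (z : R[i]) := `|complex.Re z| <= rho /\ `|complex.Im z| <= rho.

(** Only points of the square are compared, so that the derivative is one-sided
    on its boundary. *)
Definition derivative_at (f : R[i] -> R[i]) (z c : R[i]) := forall e, 0 < e ->
  exists2 d, 0 < d & forall z', square z' -> cabs (z' - z) < d ->
    cabs (f z' - f z - c * (z' - z)) <= e * cabs (z' - z).

Variable f : R[i] -> R[i].
Hypothesis fd : forall z, square z -> exists c, derivative_at f z c.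

Let interval_dist (a b s t : R) : a <= s -> s <= b -> a <= t -> t <= b -> `|s - t| <= b - a.
Proof. by move=> ? ? ? ?; rewrite ler_norml; apply/andP; split; lra. Qed.

(* Extending [f] constantly in each direction gives continuous functions on
   whole lines, to which the existence of primitives applies. *)
Let clamp (x : R) := Num.max (- rho) (Num.min x rho).

Let clamp_in x : `|clamp x| <= rho.
Proof. by rewrite ler_norml /clamp le_max lexx /= ge_max ge_min lexx orbT andbT; have := rho0; lra. Qed.

Let clamp_id x : `|x| <= rho -> clamp x = x.
Proof.
by rewrite ler_norml => /andP[x1 x2]; rewrite /clamp min_l// max_r.
Qed.

Let clamp_lip x x' : `|clamp x' - clamp x| <= `|x' - x|.
Proof.
wlog xx : x x' / x <= x'.
  by move=> H; have [/H//|/ltW/H] := leP x x'; rewrite distrC [`|x - x'|]distrC.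
have d0 : 0 <= x' - x by rewrite subr_ge0.
have mono : clamp x <= clamp x'.
  rewrite /clamp ge_max le_max lexx /= le_max; apply/orP; right.
  by rewrite le_min !ge_min lexx xx orbT.
have up : clamp x' <= clamp x + (x' - x).
  rewrite {1}/clamp ge_max; apply/andP; split.
    by apply: (@le_trans _ _ (clamp x)); rewrite ?lerDl// /clamp le_max lexx.
  apply: (@le_trans _ _ (Num.min x rho + (x' - x))); last by rewrite lerD2r /clamp le_max lexx orbT.
  rewrite addr_minl le_min addrC subrK !ge_min lexx /=; apply/orP; right.
  by rewrite lerDl.
by rewrite !ger0_norm ?subr_ge0// lerBlDl.
Qed.

Let fc x y := f (clamp x +i* clamp y).

Let square_clamp x y : square (clamp x +i* clamp y).
Proof. by split; apply: clamp_in. Qed.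

Let cont_at z : square z -> forall e, 0 < e -> exists2 d, 0 < d &
  forall z', square z' -> cabs (z' - z) < d -> cabs (f z' - f z) < e.
Proof.
move=> Qz e e0; have [c cP] := fd Qz; have [d d0 dP] := cP 1 ltr01.
have c1 : 0 < cabs c + 2 by rewrite ltr_wpDl ?cabs_ge0.
exists (Num.min d (e / (cabs c + 2))); first by rewrite lt_min d0 divr_gt0.
move=> z' Qz'; rewrite lt_min => /andP[zd ze].
rewrite (_ : f z' - f z = (f z' - f z - c * (z' - z)) + c * (z' - z)); last by ring.
apply: le_lt_trans (cabsD _ _) _; have := dP z' Qz' zd; rewrite cabsM mul1r.
move: ze; rewrite ltr_pdivlMr// mulrC => ze h.
have := cabs_ge0 (z' - z); nra.
Qed.

Let fc_contx y x e : 0 < e -> exists2 d, 0 < d &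
  forall x', `|x' - x| < d -> cabs (fc x' y - fc x y) < e.
Proof.
move=> e0; have [d d0 dP] := cont_at (square_clamp x y) e0.
exists d => // x' xd; apply: dP; first exact: square_clamp.
apply: le_lt_trans (cabs_le_ReIm _) _; rewrite /= subrr normr0 addr0.
exact: le_lt_trans (clamp_lip _ _) xd.
Qed.

Let fc_conty x y e : 0 < e -> exists2 d, 0 < d &
  forall y', `|y' - y| < d -> cabs (fc x y' - fc x y) < e.
Proof.
move=> e0; have [d d0 dP] := cont_at (square_clamp x y) e0.
exists d => // x' xd; apply: dP; first exact: square_clamp.
apply: le_lt_trans (cabs_le_ReIm _) _; rewrite /= subrr normr0 add0r.
exact: le_lt_trans (clamp_lip _ _) xd.
Qed.

Let Hex y := cid (complex_primitive (- rho - 1) (fc_contx y)).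
Let Vex x := cid (complex_primitive (- rho - 1) (fc_conty x)).
Let H y := projT1 (Hex y).
Let V x := projT1 (Vex x).

Let in_seg (a b : R) := [/\ - rho <= a, a <= b & b <= rho].

Let seg_norm a b s : in_seg a b -> a <= s <= b -> `|s| <= rho.
Proof. by move=> [h1 h2 h3] /andP[h4 h5]; rewrite ler_norml; apply/andP; split; lra. Qed.

Let HP (y a b : R) (al be : R[i]) eta : `|y| <= rho -> in_seg a b ->
  (forall s, a <= s <= b -> cabs (f (s +i* y) - (al + be * s%:C)) <= eta) ->
  cabs (H y b - H y a - (al * (b - a)%:C + be * (b ^+ 2 - a ^+ 2)%:C / 2)) <= 2 * eta * (b - a).
Proof.
move=> yr ab fP; have [h1 h2 h3] := ab; apply: (projT2 (Hex y)) => //; first by lra.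
move=> s sab; have := fP s sab.
by rewrite /fc !clamp_id//; apply: seg_norm sab.
Qed.

Let VP (x a b : R) (al be : R[i]) eta : `|x| <= rho -> in_seg a b ->
  (forall s, a <= s <= b -> cabs (f (x +i* s) - (al + be * s%:C)) <= eta) ->
  cabs (V x b - V x a - (al * (b - a)%:C + be * (b ^+ 2 - a ^+ 2)%:C / 2)) <= 2 * eta * (b - a).
Proof.
move=> yr ab fP; have [h1 h2 h3] := ab; apply: (projT2 (Vex x)) => //; first by lra.
move=> s sab; have := fP s sab.
by rewrite /fc !clamp_id//; apply: seg_norm sab.
Qed.

(* The contour integral of [f] along the boundary of a rectangle. *)
Let I a b c d := (H c b - H c a) + 'i%C * (V b d - V b c)
  - (H d b - H d a) - 'i%C * (V a d - V a c).

Let I_affine a b c d (al be : R[i]) eta : in_seg a b -> in_seg c d ->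
  (forall x y, a <= x <= b -> c <= y <= d ->
     cabs (f (x +i* y) - (al + be * (x +i* y))) <= eta) ->
  cabs (I a b c d) <= 4 * eta * ((b - a) + (d - c)).
Proof.
move=> ab cd fP; have [a1 a2 a3] := ab; have [c1 c2 c3] := cd.
have cplxE (x y : R) : x +i* y = x%:C + 'i%C * y%:C :> R[i] by rewrite [LHS]complexE.
have aa : a <= a <= b by rewrite lexx. have bb : a <= b <= b by rewrite lexx andbT.
have cc : c <= c <= d by rewrite lexx. have dd : c <= d <= d by rewrite lexx andbT.
have nrm x : a <= x <= b -> `|x| <= rho by apply: seg_norm.
have nrm' x : c <= x <= d -> `|x| <= rho by apply: seg_norm.
have Hy y : c <= y <= d -> cabs (H y b - H y a -
    ((al + be * 'i%C * y%:C) * (b - a)%:C + be * (b ^+ 2 - a ^+ 2)%:C / 2)) <= 2 * eta * (b - a).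
  move=> yc; apply: HP => //; first exact: nrm'.
  move=> s sab; rewrite (_ : al + _ + _ = al + be * (s +i* y)) ?fP//.
  by rewrite (cplxE s y); ring.
have Vx x : a <= x <= b -> cabs (V x d - V x c -
    ((al + be * x%:C) * (d - c)%:C + be * 'i%C * (d ^+ 2 - c ^+ 2)%:C / 2)) <= 2 * eta * (d - c).
  move=> xa; apply: VP => //; first exact: nrm.
  move=> s sab; rewrite (_ : al + _ + _ = al + be * (x +i* s)) ?fP//.
  by rewrite (cplxE x s); ring.
move: (Hy c cc) (Hy d dd) (Vx a aa) (Vx b bb).
set X1 := H c b - _ - _; set X2 := H d b - _ - _; set Y1 := V a d - _ - _; set Y2 := V b d - _ - _.
move=> hX1 hX2 hY1 hY2.
have -> : I a b c d = X1 + 'i%C * Y2 - X2 - 'i%C * Y1.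
  rewrite /I /X1 /X2 /Y1 /Y2 !rmorphB !rmorphXn /=.
  by field.
apply: le_trans (cabsBD _ _) _; rewrite cabsM cabs_i mul1r.
apply: le_trans (lerD (cabsBD _ _) (lexx _)) _.
apply: le_trans (lerD (lerD (cabsD _ _) (lexx _)) (lexx _)) _.
by rewrite cabsM cabs_i mul1r; lra.
Qed.

Let rect := ((R * R) * (R * R))%type.
Let good (r : rect) := in_seg r.1.1 r.1.2 /\ in_seg r.2.1 r.2.2.
Let size (r : rect) := (r.1.2 - r.1.1) + (r.2.2 - r.2.1).
Let bad e (r : rect) := good r /\ e * size r ^+ 2 < cabs (I r.1.1 r.1.2 r.2.1 r.2.2).
Let sub (r r' : rect) := [/\ r.1.1 <= r'.1.1, r'.1.2 <= r.1.2, r.2.1 <= r'.2.1 &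
  r'.2.2 <= r.2.2] /\ size r' = size r / 2.

Let bisect e r : bad e r -> exists r', bad e r' /\ sub r r'.
Proof.
case: r => -[a b] [c d]; rewrite /bad /good /sub /size /= => -[[[a1 a2 a3] [c1 c2 c3]] lt].
pose m := (a + b) / 2; pose l := (c + d) / 2.
have IE : I a b c d = I a m c l + I m b c l + (I a m l d + I m b l d).
  by rewrite /I; ring.
apply: contrapT => nor.
have small a' b' c' d' : [/\ a <= a', a' <= b' & b' <= b] -> [/\ c <= c', c' <= d' & d' <= d] ->
    b' - a' = (b - a) / 2 -> d' - c' = (d - c) / 2 ->
    cabs (I a' b' c' d') <= e * ((b - a + (d - c)) / 2) ^+ 2.
  move=> [h1 h2 h3] [h4 h5 h6] h7 h8.
  have h9 : b' - a' + (d' - c') = (b - a + (d - c)) / 2 by rewrite h7 h8 -mulrDl.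
  rewrite -h9 leNgt; apply/negP => br; apply: nor; exists ((a', b'), (c', d')).
  have h10 : in_seg a' b' by split; [exact: le_trans a1 h1|exact: h2|exact: le_trans h3 a3].
  have h11 : in_seg c' d' by split; [exact: le_trans c1 h4|exact: h5|exact: le_trans h6 c3].
  split; first by split.
  by split; first by split.
have am := midf_le a2; have cl := midf_le c2.
have half x y : (x + y) / 2 - x = (y - x) / 2 :> R by field.
have half' x y : y - (x + y) / 2 = (y - x) / 2 :> R by field.
have [am1 am2] : a <= m /\ m <= b by move: am => [? ?].
have [cl1 cl2] : c <= l /\ l <= d by move: cl => [? ?].
have s1 : cabs (I a m c l) <= e * ((b - a + (d - c)) / 2) ^+ 2 by apply: small => //; [exact: half|exact: half].
have s2 : cabs (I m b c l) <= e * ((b - a + (d - c)) / 2) ^+ 2 by apply: small => //; [exact: half'|exact: half].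
have s3 : cabs (I a m l d) <= e * ((b - a + (d - c)) / 2) ^+ 2 by apply: small => //; [exact: half|exact: half'].
have s4 : cabs (I m b l d) <= e * ((b - a + (d - c)) / 2) ^+ 2 by apply: small => //; [exact: half'|exact: half'].
move: lt; rewrite IE ltNge => /negP; apply.
apply: le_trans (cabsD _ _) _; apply: le_trans (lerD (cabsD _ _) (cabsD _ _)) _.
have -> : e * (b - a + (d - c)) ^+ 2 = 4 * (e * ((b - a + (d - c)) / 2) ^+ 2) by field.
by move: (e * _) s1 s2 s3 s4 => S; lra.
Qed.

(* Goursat's argument: nested rectangles shrink to a point, where the
   first-order expansion of [f] contradicts the bound from below. *)
Let no_bad e r : 0 < e -> ~ bad e r.
Proof.
move=> e0 br.
have /(_ _)/cid-/all_sig[next nextP] : forall r, exists r', bad e r -> bad e r' /\ sub r r'.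
  by move=> r'; case: (pselect (bad e r')) => [/bisect[r'' ?]|?]; [exists r''|exists r'].
pose q n := iter n next r.
have qbad n : bad e (q n) by elim: n => //= n /nextP[].
have qsub n : sub (q n) (q n.+1) by case: (nextP _ (qbad n)).
have qsize n : size (q n) = size r / 2 ^+ n.
  elim: n => [|n IHn]; first by rewrite expr0 divr1.
  by have [_ ->] := qsub n; rewrite IHn exprS; field; rewrite expf_neq0.
have mono n m : [/\ (q n).1.1 <= (q (n + m)%N).1.1, (q (n + m)%N).1.2 <= (q n).1.2,
    (q n).2.1 <= (q (n + m)%N).2.1 & (q (n + m)%N).2.2 <= (q n).2.2].
  elim: m => [|m [i1 i2 i3 i4]]; first by rewrite addn0.
  rewrite addnS; have [[j1 j2 j3 j4] _] := qsub (n + m)%N.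
  by split; [exact: le_trans j1|exact: le_trans j2 _|exact: le_trans j3|exact: le_trans j4 _].
have qgood n : good (q n) by case: (qbad n).
have cross1 n m : (q n).1.1 <= (q m).1.2.
  have [h _ _ _] := mono n m; have [_ h' _ _] := mono m n.
  have [[_ g _] _] := qgood (n + m)%N; rewrite addnC in h'.
  exact: le_trans h (le_trans g h').
have cross2 n m : (q n).2.1 <= (q m).2.2.
  have [_ _ h _] := mono n m; have [_ _ _ h'] := mono m n.
  have [_ [_ g _]] := qgood (n + m)%N; rewrite addnC in h'.
  exact: le_trans h (le_trans g h').
pose x := sup (range (fun n => (q n).1.1)); pose y := sup (range (fun n => (q n).2.1)).
have xP n : (q n).1.1 <= x <= (q n).1.2.
  apply/andP; split.
    by apply: ub_le_sup; [exists (q 0%N).1.2 => _ [m _ <-]; exact: cross1 | exists n].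
  by apply: ge_sup; [exists (q 0%N).1.1, 0%N | move=> _ [m _ <-]; exact: cross1].
have yP n : (q n).2.1 <= y <= (q n).2.2.
  apply/andP; split.
    by apply: ub_le_sup; [exists (q 0%N).2.2 => _ [m _ <-]; exact: cross2 | exists n].
  by apply: ge_sup; [exists (q 0%N).2.1, 0%N | move=> _ [m _ <-]; exact: cross2].
have Qz : square (x +i* y).
  have [g1 g2] := qgood 0%N.
  by split => /=; [apply: seg_norm g1 (xP 0%N) | apply: seg_norm g2 (yP 0%N)].
have [c cP] := fd Qz; have e8 : 0 < e / 8 by rewrite divr_gt0.
have [d d0 dP] := cP _ e8.
have s0 : 0 <= size r by have [[[_ h _] [_ h' _]] _] := br; rewrite /size; lra.
have [n sn] : exists n, size (q n) < d.
  pose n := (Num.truncn (size r / d)).+1; exists n.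
  rewrite qsize ltr_pdivrMr ?exprn_gt0// mulrC -ltr_pdivrMr//.
  apply: (@lt_le_trans _ _ n%:R); first exact: truncnS_gt.
  by rewrite -natrX ler_nat ltnW// ltn_expl.
have [gq lt] := qbad n; have [g1 g2] := gq.
have := @I_affine (q n).1.1 (q n).1.2 (q n).2.1 (q n).2.2
  (f (x +i* y) - c * (x +i* y)) c (e / 8 * size (q n)) g1 g2.
have zP x' y' : (q n).1.1 <= x' <= (q n).1.2 -> (q n).2.1 <= y' <= (q n).2.2 ->
    cabs ((x' +i* y') - (x +i* y)) <= size (q n).
  move=> /andP[k1 k2] /andP[k3 k4]; have /andP[k5 k6] := xP n; have /andP[k7 k8] := yP n.
  apply: le_trans (cabs_le_ReIm _) _; rewrite /size; apply: lerD => /=;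
    exact: interval_dist.
have hyp x' y' : (q n).1.1 <= x' <= (q n).1.2 -> (q n).2.1 <= y' <= (q n).2.2 ->
   cabs (f (x' +i* y') - (f (x +i* y) - c * (x +i* y) + c * (x' +i* y'))) <= e / 8 * size (q n).
  move=> hx hy; have zs := zP _ _ hx hy.
  rewrite (_ : _ - _ = f (x' +i* y') - f (x +i* y) - c * ((x' +i* y') - (x +i* y))); last by ring.
  apply: le_trans (dP _ _ _) _; last by rewrite ler_wpM2l// ltW.
    by split; [exact: seg_norm g1 hx | exact: seg_norm g2 hy].
  exact: le_lt_trans sn.
move=> /(_ hyp); rewrite -/(size (q n)) => h.
have sq : 0 <= e * size (q n) ^+ 2 by rewrite mulr_ge0 ?sqr_ge0// ltW.
have E : 4 * (e / 8 * size (q n)) * size (q n) = e * size (q n) ^+ 2 / 2 by field.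
by move: lt h; rewrite E; lra.
Qed.

Let I_eq0 a b c d : in_seg a b -> in_seg c d -> I a b c d = 0.
Proof.
move=> ab cd; apply/eqP; rewrite -cabs_eq0 eq_le cabs_ge0 andbT.
pose r : rect := ((a, b), (c, d)).
apply/ler_addgt0Pr => e e0; rewrite add0r.
have s0 : 0 <= size r ^+ 2 by rewrite sqr_ge0.
have e1 : 0 < e / (size r ^+ 2 + 1) by rewrite divr_gt0// ltr_wpDl.
rewrite leNgt; apply/negP => lt; apply: (@no_bad _ r e1); split => //.
apply: le_lt_trans lt; rewrite mulrAC ler_pdivrMr ?ltr_wpDl//.
by rewrite ler_pM2l// lerDl.
Qed.

Let I0 a b c d : `|a| <= rho -> `|b| <= rho -> `|c| <= rho -> `|d| <= rho -> I a b c d = 0.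
Proof.
rewrite !ler_norml => /andP[a1 a2] /andP[b1 b2] /andP[c1 c2] /andP[d1 d2].
have Ix x y z t : I x y z t = - I y x z t by rewrite /I; ring.
have Iy x y z t : I x y z t = - I x y t z by rewrite /I; ring.
by case: (leP a b) => ab; case: (leP c d) => cd;
  [|rewrite Iy|rewrite Ix|rewrite Ix Iy]; rewrite I_eq0 ?oppr0//; split => //; exact: ltW.
Qed.

Let between (a b s : R) := (a <= s <= b) || (b <= s <= a).

Let between_sym a b s : between b a s -> between a b s.
Proof. by rewrite /between orbC. Qed.

Let between_norm a b s : between a b s -> `|s - a| <= `|b - a|.
Proof.
by move=> /orP[] /andP[h1 h2]; [rewrite !ger0_norm|rewrite !ler0_norm]; lra.
Qed.

Let between_in a b s : `|a| <= rho -> `|b| <= rho -> between a b s -> `|s| <= rho.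
Proof.
rewrite !ler_norml => /andP[h1 h2] /andP[h3 h4] /orP[] /andP[h5 h6]; apply/andP; split; lra.
Qed.

Let HS (y a b : R) z eta : `|y| <= rho -> `|a| <= rho -> `|b| <= rho ->
  (forall s, between a b s -> cabs (f (s +i* y) - z) <= eta) ->
  cabs (H y b - H y a - z * (b - a)%:C) <= 2 * eta * `|b - a|.
Proof.
move=> yr; wlog : a b / a <= b => [W ar br fP|ab ar br fP].
  case: (leP a b) => [ab|/ltW ba]; first exact: W.
  have := W b a ba br ar (fun s bs => fP s (between_sym bs)).
  rewrite -[X in cabs X]opprK cabsN distrC.
  rewrite (_ : - (_ - _ - _) = H y b - H y a - z * (b - a)%:C); last by rewrite !rmorphB /=; ring.
  exact.
rewrite (ger0_norm (_ : 0 <= b - a)) ?subr_ge0//.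
have ab' : in_seg a b.
  by move: ar br; rewrite !ler_norml => /andP[? _] /andP[_ ?]; split.
have := @HP y a b z 0 eta yr ab'; rewrite !mul0r addr0; apply => s sab.
by rewrite mul0r addr0; apply: fP; rewrite /between sab.
Qed.

Let VS (x a b : R) z eta : `|x| <= rho -> `|a| <= rho -> `|b| <= rho ->
  (forall s, between a b s -> cabs (f (x +i* s) - z) <= eta) ->
  cabs (V x b - V x a - z * (b - a)%:C) <= 2 * eta * `|b - a|.
Proof.
move=> yr; wlog : a b / a <= b => [W ar br fP|ab ar br fP].
  case: (leP a b) => [ab|/ltW ba]; first exact: W.
  have := W b a ba br ar (fun s bs => fP s (between_sym bs)).
  rewrite -[X in cabs X]opprK cabsN distrC.
  rewrite (_ : - (_ - _ - _) = V x b - V x a - z * (b - a)%:C); last by rewrite !rmorphB /=; ring.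
  exact.
rewrite (ger0_norm (_ : 0 <= b - a)) ?subr_ge0//.
have ab' : in_seg a b.
  by move: ar br; rewrite !ler_norml => /andP[? _] /andP[_ ?]; split.
have := @VP x a b z 0 eta yr ab'; rewrite !mul0r addr0; apply => s sab.
by rewrite mul0r addr0; apply: fP; rewrite /between sab.
Qed.

(** The primitive is obtained by integrating along an L-shaped path. *)
Lemma holomorphic_primitive : exists F : R[i] -> R[i], forall z z' eta,
  square z -> square z' ->
  (forall w, square w -> cabs (w - z) <= 2 * cabs (z' - z) -> cabs (f w - f z) <= eta) ->
  cabs (F z' - F z - f z * (z' - z)) <= 4 * eta * cabs (z' - z).
Proof.
exists (fun z => H 0 (complex.Re z) - H 0 0 +
   'i%C * (V (complex.Re z) (complex.Im z) - V (complex.Re z) 0)).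
move=> [x y] [x' y'] eta [/= xr yr] [/= xr' yr'] fP.
set d := (x' +i* y') - (x +i* y).
have d1 : `|x' - x| <= cabs d by apply: (Re_le_cabs d).
have d2 : `|y' - y| <= cabs d by apply: (Im_le_cabs d).
have r0 : `|(0 : R)| <= rho by rewrite normr0 ltW.
have I1 := I0 xr xr' r0 yr.
have h1 : cabs (H y x' - H y x - f (x +i* y) * (x' - x)%:C) <= 2 * eta * `|x' - x|.
  apply: HS => // s bs; apply: fP; first by split => //=; exact: between_in bs.
  apply: le_trans (cabs_le_ReIm _) _; rewrite /= subrr normr0 addr0.
  by have := between_norm bs; have := cabs_ge0 d; lra.
have h2 : cabs (V x' y' - V x' y - f (x +i* y) * (y' - y)%:C) <= 2 * eta * `|y' - y|.
  apply: VS => // s bs; apply: fP; first by split => //=; exact: between_in bs.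
  apply: le_trans (cabs_le_ReIm _) _ => /=.
  by have := between_norm bs; lra.
have eta0 : 0 <= eta.
  have := fP (x +i* y); rewrite subrr cabs0 subrr cabs0; apply => //.
  by rewrite mulr_ge0 ?cabs_ge0.
have dE : d = (x' - x)%:C + 'i%C * (y' - y)%:C by rewrite [LHS]complexE.
rewrite (_ : _ - _ - _ = (H y x' - H y x - f (x +i* y) * (x' - x)%:C) +
    'i%C * (V x' y' - V x' y - f (x +i* y) * (y' - y)%:C)).
  apply: le_trans (cabsD _ _) _; rewrite cabsM cabs_i mul1r.
  have := ler_wpM2l eta0 d1; have := ler_wpM2l eta0 d2; lra.
rewrite /= dE -[RHS]add0r -I1 /I; ring.
Qed.

End Goursat.

(** * Cauchy's formula from averages over roots of unity *)

Section UltraLimit.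
Variable R : realType.

Definition ultra : set_system nat := projT1 (cid (ultraFilterLemma eventually_filter)).

Lemma ultra_ultra : UltraFilter ultra.
Proof. by rewrite /ultra; case: cid => /= F []. Qed.

Lemma ultra_filter : ProperFilter ultra.
Proof. exact: (@ultra_proper _ _ ultra_ultra). Qed.

Lemma ultra_eventually (P : nat -> Prop) N : (forall n, (N <= n)%N -> P n) -> ultra [set n | P n].
Proof.
move=> NP; rewrite /ultra; case: cid => /= F [_]; apply; exists N => // n /=.
Qed.

(** Every bounded sequence has such a limit, which makes it possible to average a
    bounded function over a circle without any regularity. *)
Definition ulim (u : nat -> R[i]) (l : R[i]) :=
  forall e, 0 < e -> ultra [set n | cabs (u n - l) < e].

Lemma ulim_ex u M : (forall n, cabs (u n) <= M) -> exists l, ulim u l.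
Proof.
move=> uM; pose F := u @ ultra; have UP := ultra_filter.
have FP : ProperFilter F by apply: fmap_proper_filter.
have [|l [_ lF]] := @square_compact R M F FP.
  rewrite /F /=; apply: filterS (@filterT _ _ UP) => n _ /=.
  by split; [apply: le_trans (Re_le_cabs _) _|apply: le_trans (Im_le_cabs _) _].
exists l => e e0.
have [//|nB] := in_ultra_setVsetC [set n | cabs (u n - l) < e] ultra_ultra.
have Bl : nbhs l [set z : R[i] | cabs (z - l) < e].
  apply/nbhs_ballP; exists e%:C; first by rewrite /= ltcR.
  by move=> z lz; have : `|l - z| < e%:C := lz; rewrite cabsE ltcR cabsB.
have [|z [zn zl]] := lF [set z | ~ (cabs (z - l) < e)] _ _ Bl.
  exact: nB.
by [].
Qed.

Lemma ulim_unique u l l' : ulim u l -> ulim u l' -> l = l'.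
Proof.
move=> ul ul'; apply/eqP; rewrite -subr_eq0 -cabs_eq0 eq_le cabs_ge0 andbT.
apply/ler_addgt0Pr => e e0; rewrite add0r; have UP := ultra_filter.
have e2 : 0 < e / 2 by rewrite divr_gt0.
have hh : ultra ([set n | cabs (u n - l) < e / 2] `&` [set n | cabs (u n - l') < e / 2]).
  by apply: filterI; [exact: ul | exact: ul'].
have [n [/= h h']] := filter_ex hh.
rewrite (_ : l - l' = (u n - l') - (u n - l)); last by ring.
by apply: le_trans (cabsBD _ _) _; lra.
Qed.

Lemma ulim_lin u v l m (c : R[i]) : ulim u l -> ulim v m ->
  ulim (fun n => u n + c * v n) (l + c * m).
Proof.
move=> ul vm e e0; have UP := ultra_filter.
have c1 : 0 < cabs c + 1 by rewrite ltr_wpDl ?cabs_ge0.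
have e2 : 0 < e / 2 by rewrite divr_gt0.
have e3 : 0 < e / 2 / (cabs c + 1) by rewrite divr_gt0.
move: (ul _ e2) (vm _ e3); apply: filterS2 => n /= h; rewrite ltr_pdivlMr// => h'.
rewrite (_ : _ - _ = (u n - l) + c * (v n - m)); last by ring.
apply: le_lt_trans (cabsD _ _) _; rewrite cabsM.
by have := cabs_ge0 (v n - m); nra.
Qed.

Lemma ulim_cst l : ulim (fun=> l) l.
Proof.
move=> e e0; apply: (@ultra_eventually _ 0%N) => n _.
by rewrite subrr cabs0.
Qed.

Lemma ulim_bound u l M : ulim u l -> (forall n, cabs (u n) <= M) -> cabs l <= M.
Proof.
move=> ul uM; apply/ler_addgt0Pr => e e0; have UP := ultra_filter.
have [n /= h] := filter_ex (ul _ e0).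
rewrite (_ : l = u n - (u n - l)); last by ring.
by apply: le_trans (cabsBD _ _) _; rewrite lerD ?uM// ltW.
Qed.

End UltraLimit.

Section RootsOfUnity.
Variable R : realType.

Definition cis (t : R) : R[i] := cos t +i* sin t.

Lemma cisD s t : cis (s + t) = cis s * cis t.
Proof. by rewrite /cis cosD sinD; simpc; congr (_ +i* _); ring. Qed.

Lemma cis0 : cis 0 = 1.
Proof. by rewrite /cis cos0 sin0. Qed.

Lemma cisX t n : cis t ^+ n = cis (t * n%:R).
Proof.
elim: n => [|n IHn]; first by rewrite mulr0 cis0.
by rewrite exprS IHn -cisD -natr1 mulrDr mulr1 addrC.
Qed.

Lemma cabs_cis t : cabs (cis t) = 1.
Proof.
apply: (@complexI R); rewrite -cabsE normc_def /= cos2Dsin2 sqrtr1 //.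
Qed.

Definition root1 (n : nat) : R[i] := cis (2 * pi / n.+1%:R).

Lemma cabs_root1 n : cabs (root1 n) = 1.
Proof. exact: cabs_cis. Qed.

Lemma root1X n : root1 n ^+ n.+1 = 1.
Proof.
by rewrite /root1 cisX divfK ?pnatr_eq0// /cis mulr_natl cos2pi sin2pi.
Qed.

Lemma root1_neq1 n : root1 n.+1 != 1.
Proof.
apply/eqP => h; have pi0 := pi_gt0 R.
have t0 : 0 < 2 * pi / n.+2%:R :> R by rewrite divr_gt0// mulr_gt0.
have t1 : 2 * pi / n.+2%:R <= pi :> R.
  by rewrite ler_pdivrMr// mulrC ler_pM2l// ler_nat.
have T0 : 2 * pi / n.+2%:R \in `[0, (pi : R)] by rewrite in_itv /= t1 (ltW t0).
have Z0 : 0 \in `[0, (pi : R)] by rewrite in_itv /= lexx (ltW pi0).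
have E : cos (2 * pi / n.+2%:R) = cos (0 : R).
  by rewrite [RHS]cos0; exact: (congr1 (@complex.Re R) h).
by move: t0; rewrite (cos_inj T0 Z0 E) ltxx.
Qed.

Lemma root1_cvg e : 0 < e -> exists N, forall n, (N <= n)%N -> cabs (root1 n - 1) < e.
Proof.
move=> e0; have e2 : 0 < e / 2 by rewrite divr_gt0.
have [d1 /= d10 c1] : \forall t \near (0 : R), `|cos 0 - cos t| < e / 2.
  by have /(@cvgrPdist_lt _ _ _ (nbhs (0 : R))) := @continuous_cos R 0; apply.
have [d2 /= d20 c2] : \forall t \near (0 : R), `|sin 0 - sin t| < e / 2.
  by have /(@cvgrPdist_lt _ _ _ (nbhs (0 : R))) := @continuous_sin R 0; apply.
pose d := Num.min d1 d2; have d0 : 0 < d by rewrite lt_min d10.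
exists (Num.truncn (2 * pi / d)).+1 => n Nn.
have t0 : 0 <= 2 * pi / n.+1%:R :> R by rewrite divr_ge0// mulr_ge0// pi_ge0.
have td : 2 * pi / n.+1%:R < d.
  rewrite ltr_pdivrMr// -ltr_pdivrMl// mulrC.
  apply: (@lt_le_trans _ _ (Num.truncn (2 * pi / d)).+1%:R); first exact: truncnS_gt.
  by rewrite ler_nat leqW.
move: td; rewrite lt_min => /andP[td1 td2].
apply: le_lt_trans (cabs_le_ReIm _) _; rewrite [e]splitr.
have n1 : `|0 - 2 * pi / n.+1%:R| < d1 by rewrite sub0r normrN ger0_norm.
have n2 : `|0 - 2 * pi / n.+1%:R| < d2 by rewrite sub0r normrN ger0_norm.
apply: ltrD.
  by have := c1 _ n1; rewrite cos0 distrC.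
by have := c2 _ n2; rewrite sin0 sub0r normrN /root1 /= subr0.
Qed.

End RootsOfUnity.

Section CircleMean.
Variables (R : realType) (r : R).
Hypothesis r0 : 0 < r.
Implicit Types phi psi : R[i] -> R[i].

Definition node n (j : nat) : R[i] := r%:C * root1 R n ^+ j.

Definition average phi n : R[i] := n.+1%:R^-1 * \sum_(j < n.+1) phi (node n j).

Lemma cabs_node n j : cabs (node n j) = r.
Proof. by rewrite /node cabsM cabs_real gtr0_norm// cabsX cabs_root1 expr1n mulr1. Qed.

Definition circle_bdd phi := exists M, forall z, cabs z = r -> cabs (phi z) <= M.

Definition mean phi : R[i] := get (ulim (average phi)).

Lemma cabs_nat n : cabs (n%:R : R[i]) = n%:R.
Proof. by rewrite -(rmorph_nat (@real_complex R)) cabs_real ger0_norm. Qed.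

Lemma average_bound phi M : (forall z, cabs z = r -> cabs (phi z) <= M) ->
  forall n, cabs (average phi n) <= M.
Proof.
move=> pM n; rewrite /average cabsM cabsV cabs_nat ler_pdivrMl//.
apply: le_trans (cabs_sum _ _ _) _.
apply: (@le_trans _ _ (\sum_(j < n.+1) M)); last by rewrite sumr_const card_ord mulr_natl.
by apply: ler_sum => j _; apply: pM; apply: cabs_node.
Qed.

Lemma meanP phi : circle_bdd phi -> ulim (average phi) (mean phi).
Proof.
move=> [M /average_bound pM]; have [l ul] := ulim_ex pM.
exact: (getPex (ex_intro _ l ul)).
Qed.

Lemma mean_eq phi l : circle_bdd phi -> ulim (average phi) l -> mean phi = l.
Proof. by move=> /meanP h h'; apply: ulim_unique h h'. Qed.

Lemma mean_bound phi M : (forall z, cabs z = r -> cabs (phi z) <= M) -> cabs (mean phi) <= M.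
Proof.
move=> pM; apply: ulim_bound (average_bound pM).
by apply: meanP; exists M.
Qed.

Lemma mean_ext phi psi : (forall z, cabs z = r -> phi z = psi z) -> mean phi = mean psi.
Proof.
move=> E; congr (get _); congr ulim; apply/funext => n; congr (_ * _).
by apply: eq_bigr => j _; apply: E; apply: cabs_node.
Qed.

Lemma mean_lin phi psi c : circle_bdd phi -> circle_bdd psi ->
  mean (fun z => phi z + c * psi z) = mean phi + c * mean psi.
Proof.
move=> bp bs; apply: mean_eq.
  case: bp bs => M pM [N sN]; exists (M + cabs c * N) => z zr.
  apply: le_trans (cabsD _ _) _; rewrite cabsM lerD ?pM//.
  by rewrite ler_wpM2l ?cabs_ge0// sN.
have := ulim_lin c (meanP bp) (meanP bs); congr ulim; apply/funext => n.
rewrite /average mulrCA -mulrDr; congr (_ * _).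
by rewrite mulr_sumr -big_split.
Qed.

Lemma circle_bdd_cst c : circle_bdd (fun=> c).
Proof. by exists (cabs c). Qed.

Lemma mean_cst c : mean (fun=> c) = c.
Proof.
apply: mean_eq; first exact: circle_bdd_cst.
have := ulim_cst c; congr ulim; apply/funext => n.
by rewrite /average sumr_const card_ord -[c *+ _]mulr_natl mulKf// pnatr_eq0.
Qed.

Lemma meanZ c psi : circle_bdd psi -> mean (fun z => c * psi z) = c * mean psi.
Proof.
move=> bs; rewrite -[RHS]add0r -[X in X + _](mean_cst 0) -mean_lin//; last exact: circle_bdd_cst.
by apply: mean_ext => z _; rewrite add0r.
Qed.

Lemma meanB phi psi : circle_bdd phi -> circle_bdd psi ->
  mean (fun z => phi z - psi z) = mean phi - mean psi.
Proof.
move=> bp bs; rewrite -[in RHS](mulN1r (mean psi)) -mean_lin//.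
by apply: mean_ext => z _; rewrite mulN1r.
Qed.

(** The discrete version of the vanishing of the integral of a differential
    along a closed curve: the increments of [G] between consecutive roots of
    unity telescope to zero. *)
Lemma mean_derivative (G G' : R[i] -> R[i]) (C : R) : 0 <= C ->
  (forall z z', cabs z = r -> cabs z' = r ->
     cabs (G z' - G z - G' z * (z' - z)) <= C * cabs (z' - z) ^+ 2) ->
  circle_bdd G' -> mean (fun z => G' z * z) = 0.
Proof.
move=> C0 GC [M GM]; apply: mean_eq.
  by exists (M * r) => z zr; rewrite cabsM zr; apply: ler_wpM2r; [exact: ltW | exact: GM].
have avP n : cabs (average (fun z => G' z * z) n.+1) <= C * r ^+ 2 * cabs (root1 R n.+1 - 1).
  set w := root1 R n.+1; have w1 : w - 1 != 0 by rewrite subr_eq0 root1_neq1.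
  have nodeS j : node n.+1 j.+1 - node n.+1 j = (w - 1) * node n.+1 j.
    by rewrite /node exprS -/w; ring.
  pose E j := G (node n.+1 j.+1) - G (node n.+1 j) - G' (node n.+1 j) * ((w - 1) * node n.+1 j).
  have EP j : cabs (E j) <= C * (r * cabs (w - 1)) ^+ 2.
    have := GC (node n.+1 j) (node n.+1 j.+1) (cabs_node _ _) (cabs_node _ _).
    by rewrite nodeS /E cabsM cabs_node mulrC [cabs _ * r]mulrC [C * _]mulrC.
  have sE : \sum_(j < n.+2) E j = - ((w - 1) * \sum_(j < n.+2) (G' (node n.+1 j) * node n.+1 j)).
    rewrite sumrB -(big_mkord xpredT (fun j => G (node n.+1 j.+1) - G (node n.+1 j))).
    rewrite telescope_sumr// /node root1X expr0 subrr sub0r mulr_sumr; congr (- _).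
    by apply: eq_bigr => j _; ring.
  have : cabs (\sum_(j < n.+2) E j) <= n.+2%:R * (C * (r * cabs (w - 1)) ^+ 2).
    apply: le_trans (cabs_sum _ _ _) _.
    apply: (@le_trans _ _ (\sum_(j < n.+2) C * (r * cabs (w - 1)) ^+ 2)); first exact: ler_sum.
    by rewrite sumr_const card_ord mulr_natl.
  rewrite sE cabsN cabsM /average cabsM cabsV cabs_nat => h.
  rewrite ler_pdivrMl// -(ler_pM2l (_ : 0 < cabs (w - 1))) ?cabs_gt0//.
  by apply: le_trans h _; rewrite le_eqVlt; apply/orP; left; apply/eqP; ring.
move=> e e0.
have K0 : 0 < C * r ^+ 2 + 1 by rewrite ltr_wpDl// mulr_ge0 ?sqr_ge0.
have [N NP] := @root1_cvg R (e / (C * r ^+ 2 + 1)) (divr_gt0 e0 K0).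
apply: (@ultra_eventually _ N.+1) => -[//|n] Nn; rewrite subr0.
apply: le_lt_trans (avP n) _; have := NP n.+1 (leqW Nn).
rewrite ltr_pdivlMr// => h; apply: le_lt_trans h; rewrite mulrC ler_wpM2l ?cabs_ge0//.
by rewrite lerDl.
Qed.

End CircleMean.

Section MeanC11.
Variables (R : realType) (r : R) (X : Type) (adm : X -> X -> Prop) (sz : X -> X -> R).
Hypothesis r0 : 0 < r.

Definition circle_adm (u v : R[i] * X) := [/\ u.1 = v.1, cabs u.1 = r & adm u.2 v.2].
Definition circle_sz (u v : R[i] * X) := sz u.2 v.2.

Lemma C11_mean (phi : R[i] * X -> R[i]) d : C11 circle_adm circle_sz phi d ->
  C11 adm sz (fun x => mean r (fun z => phi (z, x)))
             (fun x y => mean r (fun z => d (z, x) (z, y))).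
Proof.
move=> [M M0 pM]; exists M => // x y xy.
have P z : cabs z = r -> circle_adm (z, x) (z, y) by move=> zr; split.
have bx : circle_bdd r (fun z => phi (z, x)) by exists M => z /P/pM[].
have by' : circle_bdd r (fun z => phi (z, y)) by exists M => z /P/pM[].
have bd : circle_bdd r (fun z => d (z, x) (z, y)) by exists (M * sz x y) => z /P/pM[].
have bb : circle_bdd r (fun z => phi (z, y) - phi (z, x)).
  by exists (M + M) => z /P/pM[_ h1 h2 _]; apply: le_trans (cabsBD _ _) _; rewrite lerD.
split; [|by apply: mean_bound => // z /P/pM[]..].
by rewrite -!meanB//; apply: mean_bound => // z /P/pM[].
Qed.

End MeanC11.

Section Quadratic.
Variable R : realType.

(** The derivative vanishes; subdividing the interval avoids a mean value
    theorem for complex values. *)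
Lemma quadratic_const (g : R -> R[i]) K : 0 <= K ->
  (forall s t, 0 <= s <= 1 -> 0 <= t <= 1 -> cabs (g t - g s) <= K * (t - s) ^+ 2) ->
  g 1 = g 0.
Proof.
move=> K0 gK; apply/eqP; rewrite -subr_eq0 -cabs_eq0 eq_le cabs_ge0 andbT.
apply/ler_addgt0Pr => e e0; rewrite add0r.
pose S := (Num.truncn (K / e)).+1; have S0 : 0 < S%:R :> R by rewrite ltr0n.
have SK : K / S%:R <= e.
  by rewrite ler_pdivrMr// -ler_pdivrMl// mulrC; apply/ltW/truncnS_gt.
pose t (j : nat) : R := j%:R / S%:R.
have t01 (j : nat) : (j <= S)%N -> 0 <= t j <= 1.
  by move=> jS; rewrite /t divr_ge0//= ler_pdivrMr// mul1r ler_nat.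
have -> : g 1 - g 0 = \sum_(j < S) (g (t j.+1) - g (t j)) by exact: unit_telescope.
apply: le_trans (cabs_sum _ _ _) _; apply: (@le_trans _ _ (\sum_(j < S) (K * (S%:R^-1) ^+ 2))).
  apply: ler_sum => j _; apply: le_trans (gK _ _ _ _) _; [exact/t01/ltnW|exact: t01|].
  by rewrite /t -mulrBl -natrB ?leqnSn// subSnn mul1r.
apply: le_trans SK; rewrite sumr_const card_ord -[leLHS]mulr_natl.
by rewrite le_eqVlt; apply/orP; left; apply/eqP; field; rewrite gt_eqF.
Qed.

End Quadratic.

Section CauchyFormula.
Variables (R : realType) (r : R).
Hypothesis r0 : 0 < r.

Lemma circle_dist (z w : R[i]) : cabs z = r -> r - cabs w <= cabs (z - w).
Proof. by move=> <-; have := cabsD (z - w) w; rewrite subrK; lra. Qed.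

Lemma circle_neq (z w : R[i]) : cabs z = r -> cabs w < r -> z - w != 0.
Proof. by move=> zr wr; rewrite -cabs_gt0; apply: lt_le_trans (circle_dist w zr); rewrite subr_gt0. Qed.

Lemma circle_inv (z w : R[i]) : cabs z = r -> cabs w < r -> cabs (z - w)^-1 <= (r - cabs w)^-1.
Proof.
move=> zr wr; rewrite cabsV lef_pV2 ?posrE ?cabs_gt0 ?subr_gt0 ?circle_neq//.
exact: circle_dist.
Qed.

(** Contracting [z] to [0] does not change the average, as the derivative of the
    kernel along this homotopy is a differential on the circle. *)
Lemma mean_kernel (z : R[i]) : cabs z < r -> mean r (fun w => w / (w - z)) = 1.
Proof.
move=> zr; pose de := r - cabs z; have de0 : 0 < de by rewrite subr_gt0.
have szr (s : R) : 0 <= s <= 1 -> cabs (s%:C * z) <= cabs z.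
  by move=> /andP[s0 s1]; rewrite cabsM cabs_real ger0_norm// ler_piMl ?cabs_ge0.
have szr' (s : R) : 0 <= s <= 1 -> cabs (s%:C * z) < r by move=> /szr h; exact: le_lt_trans zr.
have inv s w : cabs w = r -> 0 <= s <= 1 -> cabs (w - s%:C * z)^-1 <= de^-1.
  move=> wr s1; apply: le_trans (circle_inv wr (szr' s s1)) _.
  by rewrite lef_pV2 ?posrE ?subr_gt0 ?szr'// lerD2l lerN2 szr.
have invn s w : cabs w = r -> 0 <= s <= 1 -> w - s%:C * z != 0.
  by move=> wr s1; apply: circle_neq (szr' s s1).
pose g s := mean r (fun w => w * (w - s%:C * z)^-1).
have E1 : g 1 = mean r (fun w => w / (w - z)) by rewrite /g mul1r.
have E0 : g 0 = 1.
  rewrite -(mean_cst r0 1); apply: mean_ext => // w wr.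
  by rewrite mul0r subr0 divff// -cabs_gt0 wr.
rewrite -E1 -E0; apply: (@quadratic_const _ _ (cabs z ^+ 2 * r / de ^+ 3)).
  by rewrite !mulr_ge0 ?invr_ge0 ?exprn_ge0 ?cabs_ge0 ?ltW.
move=> s t s1 t1.
have bg u : 0 <= u <= 1 -> circle_bdd r (fun w => w * (w - u%:C * z)^-1).
  by move=> u1; exists (r / de) => w wr; rewrite cabsM wr; apply: ler_wpM2l; [exact: ltW | exact: inv].
pose D w := z * (w - s%:C * z)^-1 ^+ 2.
have bD : circle_bdd r D.
  exists (cabs z * de^-1 ^+ 2) => w wr; rewrite cabsM cabsX ler_wpM2l ?cabs_ge0// lerXn2r ?nnegrE ?cabs_ge0 ?invr_ge0 ?(ltW de0)//.
  exact: inv.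
have D0 : mean r (fun w => D w * w) = 0.
  apply: (@mean_derivative _ _ r0 (fun w => - z * (w - s%:C * z)^-1) _ (cabs z / de ^+ 3)) => //.
    by rewrite mulr_ge0 ?cabs_ge0// invr_ge0 exprn_ge0// ltW.
  move=> w w' wr w'r; have n := invn s w wr s1; have n' := invn s w' w'r s1.
  rewrite (_ : _ - _ - _ = - z * ((w' - s%:C * z)^-1 * (w - s%:C * z)^-1 ^+ 2) * (w' - w) ^+ 2).
    rewrite !cabsM cabsN -!expr2 -exprVn; apply: ler_wpM2r; first by rewrite exprn_ge0 ?cabs_ge0.
    apply: ler_wpM2l; first exact: cabs_ge0.
    rewrite [X in _ <= X]exprS; apply: ler_pM; rewrite ?exprn_ge0 ?cabs_ge0 ?inv//.
    by rewrite lerXn2r ?nnegrE ?cabs_ge0 ?invr_ge0 ?(ltW de0) ?inv.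
  by rewrite /D; field; rewrite n n'.
have bDw : circle_bdd r (fun w => D w * w).
  by case: bD => M DM; exists (M * r) => w wr; rewrite cabsM wr; apply: ler_wpM2r; [exact: ltW | exact: DM].
have -> : g t - g s = mean r (fun w => (w * (w - t%:C * z)^-1 - w * (w - s%:C * z)^-1) -
    (t - s)%:C * (D w * w)).
  have bt : circle_bdd r (fun w => w * (w - t%:C * z)^-1 - w * (w - s%:C * z)^-1).
    have [M1 h1] := bg t t1; have [M2 h2] := bg s s1; exists (M1 + M2) => w wr.
    by apply: le_trans (cabsBD _ _) _; rewrite lerD ?h1 ?h2.
  rewrite (mean_ext r0 (psi := fun w => (w * (w - t%:C * z)^-1 - w * (w - s%:C * z)^-1) +
    (- (t - s)%:C) * (D w * w))); last by move=> w _; rewrite mulNr.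
  by rewrite mean_lin// D0 mulr0 addr0 meanB//; apply: bg.
apply: mean_bound => // w wr; have n := invn s w wr s1; have n' := invn t w wr t1.
rewrite (_ : _ - _ = z ^+ 2 * w * ((w - t%:C * z)^-1 * (w - s%:C * z)^-1 ^+ 2) * (t - s)%:C ^+ 2).
  rewrite !cabsM wr cabs_real -!expr2 -normrX [`|(t - s) ^+ 2|]ger0_norm ?sqr_ge0//.
  apply: ler_wpM2r; first exact: sqr_ge0.
  rewrite -exprVn; apply: ler_wpM2l; first by rewrite mulr_ge0 ?exprn_ge0 ?cabs_ge0 ?ltW.
  rewrite [X in _ <= X]exprS; apply: ler_pM; rewrite ?exprn_ge0 ?cabs_ge0 ?inv//.
  by rewrite lerXn2r ?nnegrE ?cabs_ge0 ?invr_ge0 ?(ltW de0) ?inv.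
by rewrite /D rmorphB /=; field; rewrite n n'.
Qed.

Variables (E E1 : R[i] -> R[i]) (C M : R).
Hypothesis C0 : 0 <= C.
Hypothesis EC : forall z z', cabs z <= r -> cabs z' <= r ->
  cabs (E z' - E z - E1 z * (z' - z)) <= C * cabs (z' - z) ^+ 2.
Hypothesis EM : forall z, cabs z <= r -> cabs (E z) <= M.
Hypothesis E1M : forall z, cabs z <= r -> cabs (E1 z) <= M.

(** Contracting the circle to [z]: the derivative of the average along this
    homotopy is again the average of a differential. *)
Lemma cauchy_formula (z : R[i]) : cabs z < r -> mean r (fun w => E w * (w / (w - z))) = E z.
Proof.
move=> zr; pose de := r - cabs z; have de0 : 0 < de by rewrite subr_gt0.
pose pt (t : R) w := z + t%:C * (w - z).
have ptr t w : cabs w = r -> 0 <= t <= 1 -> cabs (pt t w) <= r.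
  move=> wr /andP[t0 t1]; rewrite /pt (_ : _ + _ = (1 - t)%:C * z + t%:C * w); last by rewrite rmorphB /=; ring.
  apply: le_trans (cabsD _ _) _; rewrite !cabsM !cabs_real !ger0_norm ?subr_ge0// wr.
  have : (1 - t) * cabs z <= (1 - t) * r by rewrite ler_wpM2l ?subr_ge0// ltW.
  lra.
have kb w : cabs w = r -> cabs (w / (w - z)) <= r / de.
  by move=> wr; rewrite cabsM wr; apply: ler_wpM2l; [exact: ltW | exact: circle_inv].
have rde : 0 <= r / de by rewrite divr_ge0 ?ltW.
pose g t := mean r (fun w => E (pt t w) * (w / (w - z))).
have bE t : 0 <= t <= 1 -> circle_bdd r (fun w => E (pt t w) * (w / (w - z))).
  move=> t1; exists (M * (r / de)) => w wr; rewrite cabsM.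
  by apply: ler_pM; rewrite ?cabs_ge0 ?EM ?kb ?ptr.
have g1 : g 1 = mean r (fun w => E w * (w / (w - z))).
  by apply: mean_ext => // w _; rewrite /pt mul1r addrC subrK.
have g0 : g 0 = E z.
  rewrite -[RHS]mulr1 -(mean_kernel zr) -meanZ//; last by exists (r / de).
  by apply: mean_ext => // w _; rewrite /pt mul0r addr0.
rewrite -g1 -g0; apply: (@quadratic_const _ _ (C * (2 * r) ^+ 2 * (r / de))).
  by apply: mulr_ge0 => //; apply: mulr_ge0 => //; exact: sqr_ge0.
move=> s t s1 t1.
have bE1 : circle_bdd r (fun w => E1 (pt s w)) by exists M => w wr; rewrite E1M ?ptr.
have distr2 w : cabs w = r -> cabs (w - z) <= 2 * r.
  by move=> wr; apply: le_trans (cabsBD _ _) _; rewrite wr; lra.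
have mE1 : mean r (fun w => E1 (pt s w) * w) = 0.
  have [s0|s0] := eqVneq s 0.
    apply: (@mean_derivative _ _ r0 (fun w => E1 z * w) _ 0) => // w w' _ _.
    rewrite (_ : _ - _ - _ = 0) ?cabs0 ?mul0r//.
    by rewrite /pt s0 mul0r addr0; ring.
  have sC : s%:C != 0 by rewrite -cabs_gt0 cabs_real normr_gt0.
  apply: (mulfI sC); rewrite mulr0.
  have bw : circle_bdd r (fun w => E1 (pt s w) * w).
    by exists (M * r) => w wr; rewrite cabsM wr; apply: ler_wpM2r; [exact: ltW | rewrite E1M ?ptr].
  rewrite -meanZ// (mean_ext r0 (psi := fun w => s%:C * E1 (pt s w) * w)); last by move=> w _; rewrite mulrA.
  apply: (@mean_derivative _ _ r0 (fun w => E (pt s w)) _ (C * s ^+ 2)) => //.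
  - by rewrite mulr_ge0 ?sqr_ge0.
  - move=> w w' wr w'r; have := EC (ptr s w wr s1) (ptr s w' w'r s1).
    have -> : pt s w' - pt s w = s%:C * (w' - w) by rewrite /pt; ring.
    rewrite cabsM cabs_real exprMn -normrX [`|s ^+ 2|]ger0_norm ?sqr_ge0//.
    by rewrite mulrA mulrA [s%:C * E1 _]mulrC.
  - by exists (cabs s%:C * M) => w wr; rewrite cabsM ler_wpM2l ?cabs_ge0// E1M ?ptr.
have -> : g t - g s = mean r (fun w => (E (pt t w) * (w / (w - z)) - E (pt s w) * (w / (w - z)))
    - (t - s)%:C * (E1 (pt s w) * w)).
  have bd : circle_bdd r (fun w => E (pt t w) * (w / (w - z)) - E (pt s w) * (w / (w - z))).
    have [M1 h1] := bE t t1; have [M2 h2] := bE s s1; exists (M1 + M2) => w wr.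
    by apply: le_trans (cabsBD _ _) _; rewrite lerD ?h1 ?h2.
  have bw : circle_bdd r (fun w => E1 (pt s w) * w).
    by exists (M * r) => w wr; rewrite cabsM wr; apply: ler_wpM2r; [exact: ltW | rewrite E1M ?ptr].
  rewrite (mean_ext r0 (psi := fun w => (E (pt t w) * (w / (w - z)) - E (pt s w) * (w / (w - z))) +
    (- (t - s)%:C) * (E1 (pt s w) * w))); last by move=> w _; rewrite mulNr.
  by rewrite mean_lin// mE1 mulr0 addr0 meanB//; apply: bE.
apply: mean_bound => // w wr; have n := circle_neq wr zr.
have ptB : pt t w - pt s w = (t - s)%:C * (w - z) by rewrite /pt rmorphB /=; ring.
rewrite (_ : _ - _ = (E (pt t w) - E (pt s w) - E1 (pt s w) * (pt t w - pt s w)) * (w / (w - z))).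
  rewrite cabsM mulrAC; apply: ler_pM; rewrite ?cabs_ge0 ?kb//.
  apply: le_trans (EC (ptr s w wr s1) (ptr t w wr t1)) _.
  rewrite ptB -mulrA; apply: ler_wpM2l => //.
  rewrite cabsM exprMn cabs_real -normrX [`|(t - s) ^+ 2|]ger0_norm ?sqr_ge0// mulrC.
  apply: ler_wpM2r; first exact: sqr_ge0.
  by rewrite lerXn2r ?nnegrE ?cabs_ge0 ?mulr_ge0 ?(ltW r0)// distr2.
by rewrite ptB; field.
Qed.

End CauchyFormula.

Section DerivativeUnique.
Variable R : realType.

Lemma derivative_unique (rho s C : R) (G : R[i] -> R[i]) (z a b : R[i]) :
  derivative_at rho G z a -> 0 <= C -> s <= rho -> cabs z < s ->
  (forall z', cabs z' <= s -> cabs (G z' - G z - b * (z' - z)) <= C * cabs (z' - z) ^+ 2) ->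
  a = b.
Proof.
move=> Ga C0 sr zs Gb; apply/eqP; rewrite -subr_eq0 -cabs_eq0 eq_le cabs_ge0 andbT.
apply/ler_addgt0Pr => e e0; rewrite add0r.
have e2 : 0 < e / 2 by rewrite divr_gt0.
have [d d0 dP] := Ga _ e2.
have C1 : 0 < C + 1 by rewrite ltr_wpDl.
have sz0 : 0 < s - cabs z by rewrite subr_gt0.
pose h := Num.min (d / 2) (Num.min (s - cabs z) (e / 2 / (C + 1))).
have h0 : 0 < h by rewrite !lt_min !divr_gt0// sz0.
have hd : h < d by rewrite /h gt_min; apply/orP; left; lra.
have hs : h <= s - cabs z by rewrite /h !ge_min lexx /= orbT.
have he : h <= e / 2 / (C + 1) by rewrite /h !ge_min lexx !orbT.
have ch : cabs h%:C = h by rewrite cabs_real gtr0_norm.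
have z's : cabs (z + h%:C) <= s by apply: le_trans (cabsD _ _) _; rewrite ch; lra.
have z'q : square rho (z + h%:C).
  by split; [apply: le_trans (Re_le_cabs _) _|apply: le_trans (Im_le_cabs _) _];
    exact: le_trans z's sr.
have E : z + h%:C - z = h%:C by rewrite addrC addKr.
have := Gb _ z's; have := dP _ z'q; rewrite E ch => /(_ hd) h1 h2.
have : cabs ((a - b) * h%:C) <= e / 2 * h + C * h ^+ 2.
  rewrite (_ : _ * _ = (G (z + h%:C) - G z - b * h%:C) - (G (z + h%:C) - G z - a * h%:C)); last by ring.
  by apply: le_trans (cabsBD _ _) _; lra.
rewrite cabsM ch expr2 mulrA -mulrDl ler_pM2r// => /le_trans; apply.
by move: he; rewrite ler_pdivlMr// => he; have := ltW h0; nra.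
Qed.

End DerivativeUnique.

Section KernelC11.
Variables (R : realType) (r : R).
Hypotheses (r0 : 0 < r) (r1 : r <= 1).

Let adm (z z' : R[i]) := cabs z <= r / 2 /\ cabs z' <= r / 2.
Let sz (z z' : R[i]) : R := cabs (z' - z).
Let cadm := circle_adm r adm.
Let csz := circle_sz sz.

Let sz01 z z' : adm z z' -> 0 <= sz z z' <= 1.
Proof.
move=> [h h']; rewrite /sz cabs_ge0 /=; apply: le_trans (cabsBD _ _) _; have := r1; lra.
Qed.

Let csz01 u v : cadm u v -> 0 <= csz u v <= 1.
Proof. by move=> [_ _]; apply: sz01. Qed.

Let kern (m : nat) (u : R[i] * R[i]) := (u.1 - u.2)^-1 ^+ m.

Let inv_bound w z : cabs w = r -> cabs z <= r / 2 -> cabs (w - z)^-1 <= 2 / r.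
Proof.
move=> wr zr; have h := r0; apply: le_trans (circle_inv wr _) _; first by lra.
by rewrite -[2 / r]invf_div lef_pV2 ?posrE ?divr_gt0//; lra.
Qed.

Lemma kern_C11 m : C11 cadm csz (kern m)
  (fun u v => m%:R * (u.1 - u.2)^-1 ^+ m.+1 * (v.2 - u.2)).
Proof.
elim: m => [|m IHm].
  by apply: C11_ext (C11_cst csz01 1) _ => u v _; rewrite /kern !expr0 !mul0r.
have K1 : C11 cadm csz (kern 1) (fun u v => (u.1 - u.2)^-1 ^+ 2 * (v.2 - u.2)).
  have c0 : 0 <= 2 / r by rewrite divr_ge0// ltW.
  exists ((2 / r) ^+ 3 + (2 / r) + (2 / r) ^+ 2) => [|[w z] [w' z'] [/= <- wr [zr zr']]].
    by rewrite !addr_ge0// exprn_ge0.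
  have n : w - z != 0 by apply: circle_neq wr _; have := r0; lra.
  have n' : w - z' != 0 by apply: circle_neq wr _; have := r0; lra.
  have c1 := inv_bound wr zr; have c2 := inv_bound wr zr'.
  have p2 : 0 <= (2 / r) ^+ 2 by rewrite exprn_ge0.
  have p3 : 0 <= (2 / r) ^+ 3 by rewrite exprn_ge0.
  have c3 : cabs (w - z)^-1 ^+ 2 <= (2 / r) ^+ 2.
    by rewrite lerXn2r ?nnegrE ?cabs_ge0.
  rewrite /kern /csz /circle_sz /sz /= !expr1; split.
  - rewrite (_ : _ - _ - _ = ((w - z')^-1 * (w - z)^-1 ^+ 2) * (z' - z) ^+ 2); last first.
      by field; rewrite n n'.
    rewrite cabsM cabsX; apply: ler_wpM2r; first exact: sqr_ge0.
    rewrite cabsM cabsX; apply: (@le_trans _ _ ((2 / r) ^+ 3)); last by lra.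
    by rewrite [X in _ <= X]exprS; apply: ler_pM; rewrite ?sqr_ge0 ?cabs_ge0.
  - by apply: le_trans c1 _; lra.
  - by apply: le_trans c2 _; lra.
  - rewrite cabsM cabsX ler_wpM2r ?cabs_ge0//; apply: le_trans c3 _; lra.
apply: C11_ext (C11M csz01 IHm K1) _ => u v _; rewrite /kern !expr1 !exprSr; split=> //.
by rewrite -natr1 !expr0 mul1r; ring.
Qed.

Variables (e : R[i] -> R[i]) (M : R).
Hypothesis eM : forall w, cabs w = r -> cabs (e w) <= M.

(** Differentiation under the average. *)
Lemma C11_cauchy_transform m : C11 adm sz (fun z => mean r (fun w => e w * (w - z)^-1 ^+ m))
  (fun z z' => m%:R * mean r (fun w => e w * (w - z)^-1 ^+ m.+1) * (z' - z)).
Proof.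
have M0 : 0 <= M.
  by apply: le_trans (cabs_ge0 _) (eM (_ : cabs r%:C = r)); rewrite cabs_real gtr0_norm.
have eC : C11 cadm csz (fun u => e u.1) (fun _ _ => 0).
  exists M => // -[w z] [w' z'] [/= <- wr _]; rewrite subrr subr0 cabs0.
  by split; rewrite ?eM// mulr_ge0 ?sqr_ge0 ?cabs_ge0.
have := C11_mean r0 (C11M csz01 eC (kern_C11 m)).
move=> H; apply: C11_ext H _ => z z' [zr zr'] /=; split=> //.
rewrite mulrAC -meanZ //; last first.
  exists (M * (2 / r) ^+ m.+1) => w wr; rewrite cabsM cabsX; apply: ler_pM; rewrite ?exprn_ge0 ?cabs_ge0 ?eM//.
  by rewrite lerXn2r ?nnegrE ?cabs_ge0 ?divr_ge0 ?(ltW r0)// inv_bound.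
apply: mean_ext => // w wr; rewrite /=; ring.
Qed.

End KernelC11.

Section HolomorphicCauchy.
Variables (R : realType) (rho M : R) (f : R[i] -> R[i]).
Hypotheses (rho0 : 0 < rho) (rho1 : rho <= 1).
Hypothesis fd : forall z, square rho z -> exists c, derivative_at rho f z c.
Hypothesis fM : forall z, square rho z -> cabs (f z) <= M.

Let disc_square z : cabs z <= rho -> square rho z.
Proof.
by move=> zr; split; [apply: le_trans (Re_le_cabs _) zr|apply: le_trans (Im_le_cabs _) zr].
Qed.

Let M0 : 0 <= M.
Proof. by apply: le_trans (cabs_ge0 _) (fM (disc_square (_ : cabs 0 <= rho))); rewrite cabs0 ltW. Qed.

Let F := projT1 (cid (holomorphic_primitive rho0 fd)).

Let FP := projT2 (cid (holomorphic_primitive rho0 fd)).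

Let F_lip z z' : square rho z -> square rho z' -> cabs (F z' - F z) <= 9 * M * cabs (z' - z).
Proof.
move=> zr zr'; have := FP (eta := 2 * M) zr zr'; rewrite -/F => h.
rewrite (_ : F z' - F z = (F z' - F z - f z * (z' - z)) + f z * (z' - z)); last by ring.
apply: le_trans (cabsD _ _) _.
have h1 : cabs (F z' - F z - f z * (z' - z)) <= 4 * (2 * M) * cabs (z' - z).
  apply: h => w wr _; apply: le_trans (cabsBD _ _) _.
  by rewrite (_ : 2 * M = M + M) ?lerD ?fM//; ring.
rewrite cabsM; have := ler_wpM2r (cabs_ge0 (z' - z)) (fM zr); lra.
Qed.

Let F_derivative z : square rho z -> derivative_at rho F z (f z).
Proof.
move=> zr e e0; have [c cP] := fd zr; have [d d0 dP] := cP 1 ltr01.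
have c1 : 0 < cabs c + 1 by rewrite ltr_wpDl ?cabs_ge0.
exists (Num.min (d / 2) (e / 8 / (cabs c + 1))) => [|z' zr']; first by rewrite lt_min !divr_gt0.
rewrite lt_min => /andP[zd ze].
have := FP (eta := e / 4) zr zr'; rewrite -/F (_ : 4 * (e / 4) = e); last by field.
apply => w wr wz.
have wd : cabs (w - z) < d by apply: le_lt_trans wz _; lra.
rewrite (_ : f w - f z = (f w - f z - c * (w - z)) + c * (w - z)); last by ring.
apply: le_trans (cabsD _ _) _; have := dP w wr wd; rewrite mul1r cabsM => h.
have : (cabs c + 1) * cabs (w - z) <= e / 4.
  apply: (@le_trans _ _ ((cabs c + 1) * (2 * cabs (z' - z)))); first by rewrite ler_wpM2l// ltW.
  by move: ze; rewrite ltr_pdivlMr//; lra.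
lra.
Qed.

Let E := projT1 (cid (holomorphic_primitive rho0 (fun z zr => ex_intro _ _ (F_derivative zr)))).
Let EP := projT2 (cid (holomorphic_primitive rho0 (fun z zr => ex_intro _ _ (F_derivative zr)))).

Let E_C11 z z' : cabs z <= rho -> cabs z' <= rho ->
  cabs (E z' - E z - F z * (z' - z)) <= 72 * M * cabs (z' - z) ^+ 2.
Proof.
move=> /disc_square zr /disc_square zr'.
have := EP (eta := 9 * M * (2 * cabs (z' - z))) zr zr'; rewrite -/E.
rewrite (_ : 4 * _ * _ = 72 * M * cabs (z' - z) ^+ 2); last by ring.
apply => w wr wz; apply: le_trans (F_lip zr wr) _.
by rewrite ler_wpM2l// mulr_ge0.
Qed.

Let F_bdd : exists2 N, 0 <= N & forall z, cabs z <= rho -> cabs (F z) <= N.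
Proof.
exists (cabs (F 0) + 9 * M * rho) => [|z zr].
  by rewrite addr_ge0 ?cabs_ge0// !mulr_ge0// ltW.
rewrite (_ : F z = F 0 + (F z - F 0)); last by ring.
apply: le_trans (cabsD _ _) _; rewrite lerD2l; apply: le_trans (F_lip _ (disc_square zr)) _.
  by apply: disc_square; rewrite cabs0 ltW.
by rewrite subr0 ler_wpM2l// mulr_ge0.
Qed.

Let E_bdd : exists2 N, 0 <= N & forall z, cabs z <= rho -> cabs (E z) <= N.
Proof.
have z0 : cabs 0 <= rho by rewrite cabs0 ltW.
exists (cabs (E 0) + (72 * M + cabs (F 0))) => [|z zr].
  by rewrite !addr_ge0 ?cabs_ge0// !mulr_ge0.
rewrite (_ : E z = E 0 + (E z - E 0 - F 0 * (z - 0)) + F 0 * z); last by ring.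
apply: le_trans (cabsD _ _) _; rewrite [leRHS]addrA; apply: lerD.
  apply: le_trans (cabsD _ _) _; rewrite lerD2l; apply: le_trans (E_C11 z0 zr) _.
  rewrite subr0; apply: ler_piMr; first by rewrite mulr_ge0.
  by rewrite exprn_ile1 ?cabs_ge0//; apply: le_trans zr rho1.
by rewrite cabsM ler_piMr ?cabs_ge0//; apply: le_trans zr rho1.
Qed.

Let e w : R[i] := E w * w.

Let e_bdd : exists N, forall w, cabs w = rho -> cabs (e w) <= N.
Proof.
have [N N0 NP] := E_bdd; exists (N * rho) => w wr.
by rewrite cabsM wr ler_wpM2r ?(ltW rho0)// NP// wr.
Qed.

Let EE z : cabs z < rho -> E z = mean rho (fun w => e w * (w - z)^-1 ^+ 1).
Proof.
move=> zr; have [N1 N10 N1P] := F_bdd; have [N2 N20 N2P] := E_bdd.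
have b1 w : cabs w <= rho -> cabs (E w) <= N1 + N2.
  by move=> /N2P; lra.
have b2 w : cabs w <= rho -> cabs (F w) <= N1 + N2 by move=> /N1P; lra.
have C0 : 0 <= 72 * M by rewrite mulr_ge0.
have := cauchy_formula (E := E) (E1 := F) rho0 C0 (@E_C11) b1 b2 zr.
by move=> <-; apply: mean_ext => // w _; rewrite expr1 /e mulrA.
Qed.

Let rho2 : rho / 2 <= rho. Proof. by have := rho0; lra. Qed.

Let derived m (G g : R[i] -> R[i]) (c : R[i]) :
  (forall z, cabs z < rho / 2 -> derivative_at rho G z (g z)) ->
  (forall z, cabs z < rho / 2 -> G z = c * mean rho (fun w => e w * (w - z)^-1 ^+ m)) ->
  forall z, cabs z < rho / 2 ->
   g z = c * m%:R * mean rho (fun w => e w * (w - z)^-1 ^+ m.+1).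
Proof.
move=> Gg GE z zr; have [N NP] := e_bdd.
have [K K0 KP] := C11_cauchy_transform rho0 rho1 NP m.
pose s := (cabs z + rho / 2) / 2.
have zs : cabs z < s by rewrite /s; lra.
have sr : s < rho / 2 by rewrite /s; lra.
apply: (derivative_unique (s := s) (C := cabs c * K) (Gg z zr)) => //.
- by rewrite mulr_ge0 ?cabs_ge0.
- by apply: le_trans (ltW sr) rho2.
move=> z' z's.
have [|h _ _ _] := KP z z'; first by split; lra.
rewrite !GE//; last exact: le_lt_trans sr.
rewrite -!mulrA -!mulrBr cabsM; apply: ler_wpM2l; first exact: cabs_ge0.
by move: h; rewrite /= -!mulrA.
Qed.

Let F_E z : cabs z < rho / 2 -> F z = mean rho (fun w => e w * (w - z)^-1 ^+ 2).
Proof.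
move=> zr; rewrite (derived (m := 1) (G := E) (g := F) (c := 1)) => [|z' z'r|z' z'r|//].
- by rewrite !mul1r.
- move=> eps e0; exists (eps / (72 * M + 1)) => [|w wr wz].
    by rewrite divr_gt0// ltr_wpDl// mulr_ge0.
  have := EP (eta := 9 * M * (2 * cabs (w - z'))) (disc_square (le_trans (ltW z'r) rho2)) wr; rewrite -/E => h.
  apply: le_trans (h _) _.
    move=> v vr vz; apply: le_trans (F_lip (disc_square (le_trans (ltW z'r) rho2)) vr) _.
    by rewrite ler_wpM2l// mulr_ge0.
  move: wz; rewrite ltr_pdivlMr ?ltr_wpDl ?mulr_ge0// => wz.
  have := cabs_ge0 (w - z'); move: wz; set t := cabs _ => wz t0.
  rewrite (_ : 4 * _ * t = t * (72 * M) * t); last by ring.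
  by rewrite ler_wpM2r//; lra.
- by rewrite mul1r EE//; apply: lt_le_trans z'r rho2.
Qed.

Let f_E z : cabs z < rho / 2 -> f z = 2 * mean rho (fun w => e w * (w - z)^-1 ^+ 3).
Proof.
move=> zr; rewrite (derived (m := 2) (G := F) (g := f) (c := 1)) => [|z' z'r|z' z'r|//].
- by rewrite mul1r.
- by apply: F_derivative; apply: disc_square; apply: le_trans (ltW z'r) rho2.
- by rewrite mul1r F_E.
Qed.

(** Cauchy's formula holds at once only for the second primitive [E] of [f], which
    has an expansion with a quadratic remainder.  Differentiating it twice
    expresses [f] as an average of a smooth kernel, so that [f] has such an
    expansion as well, and the formula applies to [f] itself. *)
Theorem holomorphic_cauchy z : cabs z < rho / 4 ->
  mean (rho / 4) (fun w => f w * (w / (w - z))) = f z.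
Proof.
move=> zr; have [N NP] := e_bdd; have r4 : 0 < rho / 4 by rewrite divr_gt0.
have [K K0 KP] := C11_cauchy_transform rho0 rho1 NP 3.
have small w : cabs w <= rho / 4 -> cabs w < rho / 2 by have := rho0; lra.
pose f1 z := 2 * (3 * mean rho (fun w => e w * (w - z)^-1 ^+ 4)).
have KP' w w' : cabs w <= rho / 4 -> cabs w' <= rho / 4 ->
   [/\ cabs (f w' - f w - f1 w * (w' - w)) <= 2 * K * cabs (w' - w) ^+ 2,
       cabs (f w) <= 2 * K & cabs (f1 w * (w' - w)) <= 2 * K * cabs (w' - w)].
  move=> wr wr'; have [|h1 h2 _ h3] := KP w w'; first by split; apply: ltW; apply: small.
  rewrite !f_E ?small// /f1 -!mulrA -!mulrBr !cabsM; have -> : cabs 2 = 2 :> R by exact: cabs_nat.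
  by move: h1 h2 h3; rewrite -!mulrA => h1 h2 h3; split; rewrite ler_wpM2l// -?cabsM//.
apply: (cauchy_formula r4 (E1 := f1) (C := 2 * K) (M := 2 * K)) => //.
- by rewrite mulr_ge0.
- by move=> w w' wr wr'; have [] := KP' w w' wr wr'.
- by move=> w wr; have [] := KP' w w wr wr.
move=> w wr.
have [w' w'r ww'] : exists2 w', cabs w' <= rho / 4 & 0 < cabs (w' - w).
  have [->|w0] := eqVneq w 0.
    by exists (rho / 4)%:C; rewrite ?subr0 cabs_real gtr0_norm.
  by exists 0; rewrite ?cabs0 ?ltW// sub0r cabsN cabs_gt0.
by have [_ _] := KP' w w' wr w'r; rewrite cabsM ler_pM2r.
Qed.

End HolomorphicCauchy.

(** * Holomorphic functions of several variables and Hadamard's lemma *)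

Section Slices.
Variables (R : realType) (k : nat).
Implicit Types (g : 'rV[R[i]]_k -> R[i]^o) (d : 'rV[R[i]]_k -> 'I_k -> R[i]).

Lemma slice_cauchy (R0 M : R) g d x u : 0 < R0 -> R0 <= 1 ->
  (forall y, vabs y <= 2 * R0 -> has_gradient g y (d y)) ->
  (forall y, vabs y <= 2 * R0 -> cabs (g y) <= M) ->
  vabs x <= R0 -> vabs u <= 1 ->
  [/\ forall s, cabs s <= R0 / 2 -> cabs (g (x + s *: u)) <= M,
      derivative_at (R0 / 2) (fun s => g (x + s *: u)) 0 (pairing (d x) u) &
      forall s, cabs s < R0 / 8 ->
        mean (R0 / 8) (fun w => g (x + w *: u) * (w / (w - s))) = g (x + s *: u)].
Proof.
move=> R00 R01 gd gM xR u1.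
have in_ball s : cabs s <= R0 -> vabs (x + s *: u) <= 2 * R0.
  move=> sR; apply: le_trans (vabsD _ _) _; rewrite vabsZ.
  have : cabs s * vabs u <= R0 * 1 by apply: ler_pM; rewrite ?cabs_ge0 ?vabs_ge0.
  lra.
have sq s : square (R0 / 2) s -> cabs s <= R0.
  by move=> [s1 s2]; apply: le_trans (cabs_le_ReIm _) _; lra.
have der s : square (R0 / 2) s ->
    derivative_at (R0 / 2) (fun s => g (x + s *: u)) s (pairing (d (x + s *: u)) u).
  move=> /sq/in_ball/gd gs e e0; have [r r0 rP] := gs e e0.
  exists r => // s' _ sr.
  have le : vabs ((s' - s) *: u) <= cabs (s' - s) by rewrite vabsZ ler_piMr ?cabs_ge0.
  have E : x + s *: u + (s' - s) *: u = x + s' *: u by rewrite -addrA -scalerDl [s + _]addrC subrK.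
  have := rP ((s' - s) *: u); rewrite E pairingZ mulrC => h.
  by apply: le_trans (h (le_lt_trans le sr)) _; rewrite ler_wpM2l// ltW.
split.
- by move=> s sR; apply/gM/in_ball; lra.
- have := der 0; rewrite scale0r addr0; apply.
  by split; rewrite normr0 divr_ge0 ?ltW.
move=> s sR.
have r2 : 0 < R0 / 2 by rewrite divr_gt0.
have E : R0 / 8 = R0 / 2 / 4 by field.
rewrite E; apply: (@holomorphic_cauchy _ (R0 / 2) M (fun s => g (x + s *: u))) => //.
- by lra.
- by move=> z /der; exists (pairing (d (x + z *: u)) u).
- by move=> z /sq/in_ball/gM.
- by rewrite -E.
Qed.

Let far_bounds (r s : R) : 0 < r -> r / 2 < s ->
  1 <= 4 * s ^+ 2 / r ^+ 2 /\ s / r <= 2 * s ^+ 2 / r ^+ 2.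
Proof.
move=> r0 sr; have s0 : 0 < s by apply: lt_trans sr; rewrite divr_gt0.
have s2 : 1 <= 4 * s ^+ 2 / r ^+ 2.
  rewrite ler_pdivlMr ?exprn_gt0// mul1r.
  have : r * r <= (2 * s) * (2 * s) by apply: ler_pM; rewrite ?(ltW r0)//; lra.
  by rewrite -expr2; lra.
have s3 : s / r <= 2 * s ^+ 2 / r ^+ 2.
  have : 1 <= 2 * s / r by rewrite ler_pdivlMr// mul1r; lra.
  have sr0 : 0 <= s / r by rewrite divr_ge0 ?ltW.
  move=> /(ler_wpM2l sr0); rewrite mulr1 => h; apply: le_trans h _.
  by rewrite le_eqVlt; apply/orP; left; apply/eqP; field; rewrite gt_eqF.
by split.
Qed.

(** Cauchy's estimates on the complex line through two points; the constant
    depends only on the radius and on the bound for [g]. *)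
Lemma uniform_C11 (R0 M : R) : 0 < R0 -> R0 <= 1 -> 0 <= M -> exists2 C : R, 0 <= C &
  forall g d, (forall y, vabs y <= 2 * R0 -> has_gradient g y (d y)) ->
  (forall y, vabs y <= 2 * R0 -> cabs (g y) <= M) ->
  forall x y, vabs x <= R0 -> vabs y <= R0 ->
  [/\ cabs (g y - g x - pairing (d x) (y - x)) <= C * vabs (y - x) ^+ 2,
      cabs (g x) <= C, cabs (g y) <= C & cabs (pairing (d x) (y - x)) <= C * vabs (y - x)].
Proof.
move=> R00 R01 M0; pose r := R0 / 8; have r0 : 0 < r by rewrite divr_gt0.
pose C := 10 * M / r ^+ 2 + M / r + M.
have p1 : 0 <= M / r by rewrite divr_ge0// ltW.
have p2 : 0 <= M / r ^+ 2 by rewrite divr_ge0// exprn_ge0// ltW.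
have C0 : 0 <= C by rewrite /C; lra.
have MC : M <= C by rewrite /C lerDr; lra.
have M1C : M / r <= C by rewrite /C; lra.
have M2C : 2 * M / r ^+ 2 <= C by rewrite /C; lra.
have invr2 : (r - r / 2)^-1 <= 2 / r by rewrite le_eqVlt; apply/orP; left; apply/eqP; field; rewrite gt_eqF.
have half s' : s' <= r / 2 -> s' < r /\ (r - s')^-1 <= 2 / r.
  move=> s'r; have s'r' : s' < r by have := r0; lra.
  split=> //; apply: le_trans invr2.
  by rewrite lef_pV2 ?posrE ?subr_gt0//; [rewrite lerD2l lerN2|have := r0; lra].
exists C => // g d gd gM x y xR yR.
have le2 t : t <= R0 -> t <= 2 * R0 by have := R00; lra.
have gx : cabs (g x) <= C by apply: le_trans (gM x (le2 _ xR)) MC.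
have gy : cabs (g y) <= C by apply: le_trans (gM y (le2 _ yR)) MC.
have [->|yx] := eqVneq y x.
  have p0 : pairing (d x) (x - x) = 0 by rewrite subrr -(scale0r 0) pairingZ mul0r.
  by rewrite p0 !subrr cabs0 vabs0 expr0n /= !mulr0.
pose s := vabs (y - x); pose u := (s^-1)%:C *: (y - x).
have s0 : 0 < s.
  rewrite /s lt0r vabs_ge0 andbT; apply: contraNneq yx => /vabs_eq0 /eqP.
  by rewrite subr_eq0.
have u1 : vabs u <= 1 by rewrite /u vabsZ cabs_real ger0_norm ?invr_ge0 ?(ltW s0)// mulVf ?gt_eqF.
have su : s%:C *: u = y - x.
  by rewrite /u scalerA -realcM divff ?gt_eqF// scale1r.
have [bd der cau] := slice_cauchy R00 R01 gd gM xR u1.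
pose phi w := g (x + w *: u).
have phi0 : phi 0 = g x by rewrite /phi scale0r addr0.
have phis : phi s%:C = g y by rewrite /phi su addrC subrK.
have bphi w : cabs w = r -> cabs (phi w) <= M by move=> wr; apply: bd; rewrite wr /r; lra.
pose De := mean r (fun w => phi w * w^-1).
have bDe : circle_bdd r (fun w => phi w * w^-1).
  exists (M / r) => w wr; rewrite cabsM cabsV wr; apply: ler_wpM2r; last exact: bphi.
  by rewrite invr_ge0 ltW.
have bk s' : cabs s' <= r / 2 -> circle_bdd r (fun w => phi w * (w / (w - s'))).
  move=> s'r; exists (M * (r * (2 / r))) => w wr; rewrite cabsM; apply: ler_pM; rewrite ?cabs_ge0 ?bphi//.
  rewrite cabsM wr; apply: ler_wpM2l; first exact: ltW.
  by have [h1 h2] := half _ s'r; exact: le_trans (circle_inv wr h1) h2.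
have taylor s' : cabs s' <= r / 2 ->
    cabs (phi s' - phi 0 - De * (s' - 0)) <= 2 * M / r ^+ 2 * cabs (s' - 0) ^+ 2.
  move=> s'r; rewrite subr0.
  have -> : phi s' - phi 0 - De * s' =
     mean r (fun w => (phi w * (w / (w - s')) - phi w * (w / (w - 0))) + - s' * (phi w * w^-1)).
    have b0 : circle_bdd r (fun w => phi w * (w / (w - 0))).
      by apply: bk; rewrite cabs0 divr_ge0 ?ltW.
    rewrite mean_lin//; last first.
      have [N1 h1] := bk _ s'r; have [N2 h2] := b0; exists (N1 + N2) => w wr.
      by apply: le_trans (cabsBD _ _) _; rewrite lerD ?h1 ?h2.
    rewrite meanB//; last exact: bk.
    rewrite /phi !cau ?cabs0//; last by rewrite -/r; lra.
    by rewrite -/(phi s') -/De mulNr [De * _]mulrC.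
  apply: mean_bound => // w wr.
  have n1 : w != 0 by rewrite -cabs_gt0 wr.
  have n2 : w - s' != 0 by have [h1 _] := half _ s'r; exact: circle_neq wr h1.
  rewrite (_ : _ + _ = phi w * (w^-1 * (w - s')^-1) * s' ^+ 2); last first.
    by rewrite subr0; field; rewrite n1 n2.
  rewrite cabsM cabsX; apply: ler_wpM2r; first exact: sqr_ge0.
  rewrite cabsM (_ : 2 * M / r ^+ 2 = M * (r^-1 * (2 / r))); last by field; rewrite gt_eqF.
  apply: ler_pM; rewrite ?cabs_ge0 ?bphi// cabsM cabsV wr; apply: ler_wpM2l.
    by rewrite invr_ge0 ltW.
  by have [h1 h2] := half _ s'r; exact: le_trans (circle_inv wr h1) h2.
have DeE : pairing (d x) u = De.
  apply: (derivative_unique (s := r / 2) (C := 2 * M / r ^+ 2) der).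
  - by lra.
  - by rewrite /r; lra.
  - by rewrite cabs0 divr_gt0.
  - exact: taylor.
have DeM : cabs De <= M / r.
  by apply: mean_bound => // w wr; rewrite cabsM cabsV wr; apply: ler_wpM2r; rewrite ?bphi// invr_ge0 ltW.
have pE : pairing (d x) (y - x) = De * s%:C by rewrite -su pairingZ DeE mulrC.
have cs : cabs s%:C = s by rewrite cabs_real gtr0_norm.
have pM : cabs (pairing (d x) (y - x)) <= M / r * s.
  by rewrite pE cabsM cs ler_wpM2r// ltW.
split=> //; last by apply: le_trans pM _; rewrite -/s ler_wpM2r ?(ltW s0).
rewrite -/s; case: (leP s (r / 2)) => sr.
  have := taylor s%:C; rewrite cs subr0 cs -phi0 -phis pE => /(_ sr) h.
  by apply: le_trans h _; apply: ler_wpM2r; first exact: sqr_ge0.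
have [s2 s3] := far_bounds r0 sr.
have a1 : cabs (g y - g x) <= M * (2 * (4 * s ^+ 2 / r ^+ 2)).
  apply: (@le_trans _ _ (M * 2)).
    by apply: le_trans (cabsBD _ _) _; rewrite mulr_natr mulr2n; apply: lerD; apply/gM/le2.
  by rewrite ler_wpM2l//; lra.
have a2 : M / r * s <= M * (2 * s ^+ 2 / r ^+ 2) by rewrite mulrAC -mulrA ler_wpM2l.
have a3 : 0 <= (M / r + M) * s ^+ 2 by rewrite mulr_ge0 ?sqr_ge0// addr_ge0.
apply: le_trans (cabsBD _ _) _; apply: le_trans (lerD a1 (le_trans pM a2)) _.
have -> : C * s ^+ 2 = M * (2 * (4 * s ^+ 2 / r ^+ 2)) + M * (2 * s ^+ 2 / r ^+ 2) + (M / r + M) * s ^+ 2.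
  by rewrite /C; field; rewrite gt_eqF.
by rewrite lerDl.
Qed.

End Slices.

Section CircleTransform.
Variables (R : realType) (k : nat).

Lemma C11_comp (X Y : Type) (adm : X -> X -> Prop) (sz : X -> X -> R) (adm' : Y -> Y -> Prop)
    (sz' : Y -> Y -> R) (h : Y -> X) f d : C11 adm sz f d ->
  (forall y y', adm' y y' -> [/\ adm (h y) (h y'), 0 <= sz (h y) (h y') & sz (h y) (h y') <= sz' y y']) ->
  C11 adm' sz' (f \o h) (fun y y' => d (h y) (h y')).
Proof.
move=> [M M0 fM] hP; exists M => // y y' /hP[a s0 s1]; have [h1 h2 h3 h4] := fM _ _ a.
split=> //=.
- apply: le_trans h1 _; apply: ler_wpM2l => //.
  by rewrite lerXn2r// nnegrE// (le_trans s0).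
- by apply: le_trans h4 _; apply: ler_wpM2l.
Qed.

Lemma mean_sum (r : R) (I : Type) (s : seq I) (F : I -> R[i] -> R[i]) (c : I -> R[i]) : 0 < r ->
  (forall i, circle_bdd r (F i)) ->
  circle_bdd r (fun w => \sum_(i <- s) F i w * c i) /\
  mean r (fun w => \sum_(i <- s) F i w * c i) = \sum_(i <- s) mean r (F i) * c i.
Proof.
move=> r0 Fb; elim: s => [|i s [[M bs] IHs]].
  split; first by exists 0 => w _; rewrite big_nil cabs0.
  by rewrite big_nil -[RHS](mean_cst r0 0); apply: mean_ext => // w _; rewrite big_nil.
have [N bi] := Fb i; split.
  exists (N * cabs (c i) + M) => w wr; rewrite big_cons; apply: le_trans (cabsD _ _) _.
  by rewrite lerD ?bs// cabsM ler_wpM2r ?cabs_ge0 ?bi.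
rewrite big_cons -IHs [mean r (F i) * _]mulrC addrC -mean_lin//; last by exists M.
by apply: mean_ext => // w _; rewrite big_cons addrC [c i * _]mulrC.
Qed.

Lemma mean_gradient (r rho : R) (phi : R[i] * 'rV[R[i]]_k -> R[i])
    (dphi : R[i] -> 'rV[R[i]]_k -> 'I_k -> R[i]) (x : 'rV[R[i]]_k) :
  0 < r -> rho <= 1 / 2 ->
  C11 (circle_adm r (close (fun x : 'rV[R[i]]_k => vabs x <= rho))) (circle_sz (@gap R k)) phi
    (fun u v => pairing (dphi u.1 u.2) (v.2 - u.2)) ->
  vabs x < rho ->
  has_gradient (fun x => mean r (fun w => phi (w, x))) x (fun m => mean r (fun w => dphi w x m)).
Proof.
move=> r0 rho1 phiC; have [M M0 pM] := phiC.
have dbd y m : vabs y < rho -> circle_bdd r (fun w => dphi w y m).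
  move=> yr; exists M => w wr; pose s := (rho - vabs y); have s0 : 0 < s by rewrite subr_gt0.
  pose y' := y + s%:C *: delta_mx 0 m.
  have ey : y' - y = s%:C *: delta_mx 0 m by rewrite /y' [y + _]addrC addrK.
  have sE : vabs (y' - y) = s by rewrite ey vabs_delta cabs_real gtr0_norm.
  have [|_ _ _] := pM (w, y) (w, y').
    split=> //; split => /=; [exact: ltW| |].
      by rewrite /y'; apply: le_trans (vabsD _ _) _; rewrite vabs_delta cabs_real gtr0_norm// /s addrC subrK.
    by rewrite sE /s; have := vabs_ge0 y; lra.
  rewrite /circle_sz /gap /= sE ey pairingZ pairing_delta cabsM cabs_real gtr0_norm//.
  by rewrite mulrC ler_pM2r.
have [C C0 fC] := C11_mean r0 phiC.
move=> xr; pose L y m := mean r (fun w => dphi w y m).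
move=> e e0; have C1 : 0 < C + 1 by rewrite ltr_wpDl.
exists (Num.min (rho - vabs x) (e / (C + 1))) => [|v].
  by rewrite lt_min subr_gt0 xr divr_gt0.
rewrite lt_min ltr_pdivlMr// => /andP[v1 v2].
have xv : vabs (x + v) <= rho by apply: le_trans (vabsD _ _) _; lra.
have [|h _ _ _] := fC x (x + v).
  split=> //; first exact: ltW.
  by apply: le_trans (vabsD _ _) _; rewrite vabsN; lra.
move: h; rewrite /gap /= [x + v - x]addrC addKr.
rewrite /pairing; have [_ ->] := mean_sum (index_enum 'I_k) (v 0) r0 (fun m => dbd x m xr).
move=> /le_trans; apply.
rewrite expr2 mulrA; apply: ler_wpM2r; first exact: vabs_ge0.
by have := vabs_ge0 v; nra.
Qed.
End CircleTransform.

Section Truncation.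
Variables (R : realType) (k : nat).
Implicit Types x y : 'rV[R[i]]_k.

Definition trunc (l : nat) x : 'rV[R[i]]_k := \row_m (if (m < l)%N then x 0 m else 0).

Lemma trunc0 x : trunc 0 x = 0.
Proof. by apply/rowP => m; rewrite !mxE. Qed.

Lemma trunc_id x : trunc k x = x.
Proof. by apply/rowP => m; rewrite !mxE ltn_ord. Qed.

Lemma truncS (l : 'I_k) x : trunc l.+1 x = trunc l x + x 0 l *: delta_mx 0 l.
Proof.
apply/rowP => m; rewrite !mxE eqxx /= ltnS leq_eqVlt -val_eqE /=.
case: eqP => [/val_inj ->|_]; first by rewrite ltnn add0r mulr1.
by rewrite mulr0 addr0.
Qed.

Lemma truncB l x y : trunc l y - trunc l x = trunc l (y - x).
Proof. by apply/rowP => m; rewrite !mxE; case: ifP; rewrite ?subr0. Qed.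

Lemma vabs_trunc l x : vabs (trunc l x) <= vabs x.
Proof. by apply: ler_sum => m _; rewrite mxE; case: ifP; rewrite ?cabs0 ?cabs_ge0. Qed.

Lemma pairing_trunc (d : 'I_k -> R[i]) l x :
  pairing d (trunc l x) = pairing (fun m => if (m < l)%N then d m else 0) x.
Proof. by apply: eq_bigr => m _; rewrite mxE; case: ifP; rewrite ?mulr0 ?mul0r. Qed.

End Truncation.

Section Hadamard.
Variables (R : realType) (k : nat).
Implicit Types (p x y : 'rV[R[i]]_k).

(** Boundedness follows from the expansion at [p] alone. *)
Lemma near_tame p (g : 'rV[R[i]]_k -> R[i]^o) : holomorphic_near p g ->
  exists R0 M : R, [/\ 0 < R0, R0 <= 1, 0 <= M,
    forall x, vabs x <= 2 * R0 ->
      has_gradient (fun x => g (p + x)) x (fun m => partial m g (p + x)) &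
    forall x, vabs x <= 2 * R0 -> cabs (g (p + x)) <= M].
Proof.
move=> /near_vabsP[r r0 rg].
have grad x : vabs x < r -> has_gradient (fun x => g (p + x)) x (fun m => partial m g (p + x)).
  move=> xr; have := rg (p + x); rewrite [p + x - p]addrC addKr => /(_ xr)/differentiable_gradient.
  by move=> H e e0; have [r' r'0 r'P] := H e e0; exists r' => // v vr; rewrite addrA; apply: r'P.
have [|s s0 sP] := grad 0 _ 1 ltr01; first by rewrite vabs0.
have [N N0 NP] := pairing_bound (fun m => partial m g (p + 0)).
pose R0 := Num.min (1 / 4) (Num.min (r / 4) (s / 4)).
have R00 : 0 < R0 by rewrite !lt_min !divr_gt0.
have R01 : R0 <= 1 / 4 by rewrite ge_min lexx.
have Rr : R0 <= r / 4 by rewrite !ge_min lexx /= orbT.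
have Rs : R0 <= s / 4 by rewrite !ge_min lexx !orbT.
exists R0, (cabs (g (p + 0)) + N + 1); split=> //.
- lra.
- by have := cabs_ge0 (g (p + 0)); lra.
- by move=> x xR; apply: grad; lra.
move=> x xR; have xs : vabs x < s by lra.
have := sP x xs; rewrite add0r mul1r => h1; have h2 := NP x.
have -> : g (p + x) = (g (p + x) - g (p + 0) - pairing (fun m => partial m g (p + 0)) x) +
   (g (p + 0) + pairing (fun m => partial m g (p + 0)) x) by ring.
apply: le_trans (cabsD _ _) _; apply: (le_trans (lerD h1 (cabsD _ _))).
have : N * vabs x <= N * 1 by rewrite ler_wpM2l ?(ltW N0)//; lra.
lra.
Qed.

Lemma near_hol11 p (g : 'rV[R[i]]_k -> R[i]^o) : holomorphic_near p g ->
  exists2 R0 : R, 0 < R0 & forall r, r <= R0 ->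
    hol11 [set x | vabs x <= r] (fun x => g (p + x)) (fun m x => partial m g (p + x)).
Proof.
move=> /near_tame[R0 [M [R00 R01 M0 gd gM]]]; exists R0 => // r rR.
have [C C0 CP] := @uniform_C11 R k R0 M R00 R01 M0.
exists C => // x y [/= xr yr _].
by apply: (CP _ _ gd gM); [exact: le_trans xr rR|exact: le_trans yr rR].
Qed.

Section Quotients.
Variables (R0 M : R) (g : 'rV[R[i]]_k -> R[i]) (d : 'rV[R[i]]_k -> 'I_k -> R[i]).
Hypotheses (R00 : 0 < R0) (R01 : R0 <= 1) (M0 : 0 <= M).
Hypothesis gd : forall y, vabs y <= 2 * R0 -> has_gradient g y (d y).
Hypothesis gM : forall y, vabs y <= 2 * R0 -> cabs (g y) <= M.

Let r := R0 / 8.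
Let rho := R0 / 16.
Let r0 : 0 < r. Proof. by have := R00; rewrite /r; lra. Qed.

(** This is [(g (trunc l.+1 x) - g (trunc l x)) / x 0 l] by Cauchy's formula in the
    [l]-th coordinate, in a form which is visibly holomorphic where the
    coordinate vanishes. *)
Definition hadamard_quotient (l : 'I_k) x : R[i] :=
  mean r (fun w => g (trunc l x + w *: delta_mx 0 l) * (w - x 0 l)^-1).

Let adm := close (fun x : 'rV[R[i]]_k => vabs x <= rho).
Let cadm := circle_adm r adm.
Let csz := circle_sz (@gap R k).

Lemma hadamard_gradient l x : vabs x < rho ->
  exists c, has_gradient (hadamard_quotient l) x c.
Proof.
move=> xr; pose at_ w x := trunc l x + w *: delta_mx 0 l.
have at_small w y : cabs w = r -> vabs y <= rho -> vabs (at_ w y) <= R0.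
  move=> wr yr; apply: le_trans (vabsD _ _) _; rewrite vabs_delta wr.
  by have := vabs_trunc l y; move: yr; rewrite /rho /r; have := R00; lra.
pose dphi w y (m : 'I_k) := (if (m < l)%N then d (at_ w y) m else 0) * (w - y 0 l)^-1 +
  g (at_ w y) * (w - y 0 l)^-1 ^+ 2 * (m == l)%:R.
exists (fun m => mean r (fun w => dphi w x m)).
apply: (@mean_gradient _ _ r rho (fun u => g (at_ u.1 u.2) * (u.1 - u.2 0 l)^-1)) => //.
  by have := R01; rewrite /rho; lra.
have csz01 u v : cadm u v -> 0 <= csz u v <= 1 by move=> [_ _ /gap01].
have c1 : C11 cadm csz (fun u => g (at_ u.1 u.2)) (fun u v => pairing (d (at_ u.1 u.2)) (trunc l (v.2 - u.2))).
  have [C C0 CP] := @uniform_C11 R k R0 M R00 R01 M0.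
  exists C => // -[w y] [w' y'] [/= <- wr [yr yr' _]].
  have E : at_ w y' - at_ w y = trunc l (y' - y).
    by rewrite /at_ opprD addrACA subrr addr0 truncB.
  have le : vabs (trunc l (y' - y)) <= csz (w, y) (w, y') by apply: vabs_trunc.
  have [] := CP _ _ gd gM (at_ w y) (at_ w y') (at_small _ _ wr yr) (at_small _ _ wr yr').
  rewrite E => h1 h2 h3 h4; split=> //=.
  - apply: le_trans h1 _; apply: ler_wpM2l => //.
    by rewrite lerXn2r// nnegrE ?(le_trans _ le)// vabs_ge0.
  - by apply: le_trans h4 _; apply: ler_wpM2l.
have r1 : r <= 1 by have := R01; rewrite /r; lra.
have c2 := C11_comp (adm' := cadm) (sz' := csz) (h := fun u => (u.1, u.2 0 l)) (kern_C11 r0 r1 1) _.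
have {}c2 : C11 cadm csz (fun u => (u.1 - u.2 0 l)^-1)
    (fun u v => (u.1 - u.2 0 l)^-1 ^+ 2 * (v.2 - u.2) 0 l).
  apply: C11_ext (c2 _) _ => [[w y] [w' y'] [/= <- wr [yr yr' yy]]|u v _]; last first.
    by rewrite /= !expr1 mul1r !mxE.
  split; [split=> //=| |].
  - split; [apply: le_trans (vabs_coord _ _) _|apply: le_trans (vabs_coord _ _) _]; move: yr yr';
     rewrite /rho /r; have := R00; lra.
  - exact: cabs_ge0.
  - rewrite /circle_sz /csz /circle_sz /gap /=.
    by have := vabs_coord (y' - y) l; rewrite !mxE.
move: (C11M csz01 c1 c2) => H; apply: C11_ext H _ => u v _; split=> //.
have vE (t : 'rV[R[i]]_k) : t 0 l = \sum_m (m == l)%:R * t 0 m.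
  by rewrite (bigD1 l)//= eqxx mul1r big1 ?addr0// => m /negbTE->; rewrite mul0r.
rewrite [(v.2 - u.2) 0 l]vE pairing_trunc /pairing mulr_suml !mulr_sumr -big_split /=.
by apply: eq_bigr => m _; rewrite /dphi; ring.
Qed.

Lemma hadamard_quotientP l x : vabs x < rho ->
  x 0 l * hadamard_quotient l x = g (trunc l.+1 x) - g (trunc l x).
Proof.
move=> xr; have r8 : rho < r by have := R00; rewrite /rho /r; lra.
have tR : vabs (trunc l x) <= R0.
  by have := vabs_trunc l x; have := R00; move: xr; rewrite /rho; lra.
have e1 : vabs (delta_mx 0 l : 'rV[R[i]]_k) <= 1 by rewrite -[delta_mx _ _]scale1r vabs_delta cabs1.
have [bd _ cau] := slice_cauchy R00 R01 gd gM tR e1.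
have xl : cabs (x 0 l) < r by apply: le_lt_trans (vabs_coord _ _) _; apply: lt_trans r8.
have bg w : cabs w = r -> cabs (g (trunc l x + w *: delta_mx 0 l)) <= M.
  by move=> wr; apply: bd; rewrite wr /r; have := R00; lra.
have b s : cabs s < r -> circle_bdd r (fun w => g (trunc l x + w *: delta_mx 0 l) * (w / (w - s))).
  move=> sr; exists (M * (r * (r - cabs s)^-1)) => w wr; rewrite cabsM; apply: ler_pM; rewrite ?cabs_ge0 ?bg//.
  by rewrite cabsM wr; apply: ler_wpM2l; [exact: ltW|exact: circle_inv].
have c00 : cabs 0 < r by rewrite cabs0.
have g0 := cau 0 c00; rewrite scale0r addr0 in g0.
rewrite truncS -cau// -g0 -meanB//; [|exact: b..].
rewrite -meanZ//; last first.
  exists (M * (r - cabs (x 0 l))^-1) => w wr; rewrite cabsM; apply: ler_pM; rewrite ?cabs_ge0 ?bg//.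
  exact: circle_inv.
apply: mean_ext => // w wr.
have n1 : w != 0 by rewrite -cabs_gt0 wr.
have n2 : w - x 0 l != 0 by apply: circle_neq wr _.
by rewrite subr0; field; rewrite n1 n2.
Qed.

End Quotients.

(** The coordinates are set to zero one after the other, and the increments are
    divided by means of Cauchy's formula. *)
Lemma hadamard p (g : 'rV[R[i]]_k -> R[i]^o) : holomorphic_near p g ->
  exists2 q : 'I_k -> 'rV[R[i]]_k -> R[i]^o, (forall l, holomorphic_near p (q l)) &
    \forall x \near p, g x = g p + \sum_l (x - p) 0 l * q l x.
Proof.
move=> /near_tame[R0 [M [R00 R01 M0 gd gM]]].
pose G x := g (p + x).
have rho0 : 0 < R0 / 16 by rewrite divr_gt0.
exists (fun l x => hadamard_quotient R0 G l (x - p)) => [l|].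
  apply/near_vabsP; exists (R0 / 16) => // x /(hadamard_gradient R00 R01 M0 gd gM l)[c cP].
  apply: (proj1 (gradient_differentiable (d := c) _)) => e e0.
  by have [s s0 sP] := cP e e0; exists s => // v /sP; rewrite [x - p + v]addrAC.
apply/near_vabsP; exists (R0 / 16) => // x xr.
rewrite (eq_bigr _ (fun l _ => hadamard_quotientP R00 R01 gd gM l xr)).
rewrite -(big_mkord xpredT (fun l => G (trunc l.+1 (x - p)) - G (trunc l (x - p)))).
rewrite telescope_sumr// trunc_id trunc0 /G addr0.
by rewrite [p + _]addrC subrK [g p + _]addrC subrK.
Qed.

End Hadamard.

(** * Critical points of the master function *)

Section Exponential.
Variable R : realType.

Lemma real_first_order (f : R -> R) (x df : R) : is_derive x 1 f df ->
  forall e, 0 < e -> exists2 r : R, 0 < r &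
    forall h, `|h| < r -> `|f (x + h) - f x - df * h| <= e * `|h|.
Proof.
move=> fd e e0; have := @derive_val _ _ _ _ _ _ _ fd.
have /cvg_ex [l cl] := @ex_derive _ _ _ _ _ _ _ fd.
rewrite /derive (cvg_lim _ cl)// => El; rewrite {}El in cl.
have /cvgr_dist_lt/(_ e e0)/nbhs_ballP[r /= r0 rP] := cl; exists r => // h hr.
have [->|h0] := eqVneq h 0; first by rewrite addr0 mulr0 subrr subr0 normr0 mulr0.
have := rP h; rewrite /ball /= sub0r normrN => /(_ hr h0).
rewrite -[h *: 1]/(h * 1) mulr1 [h + x]addrC => /ltW; rewrite -(ler_pM2r (_ : 0 < `|h|)) ?normr_gt0//.
rewrite -normrM distrC mulrBl => /(le_trans _); apply.
by rewrite -[_ *: _]/(h^-1 * _) mulrAC mulVf// mul1r.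
Qed.

Lemma expCD (w u : R[i]) : expC (w + u) = expC w * expC u.
Proof.
rewrite /expC !raddfD expRD realcM -!/(cis _) cisD; ring.
Qed.

Lemma expC0 : expC (0 : R[i]) = 1.
Proof. by rewrite /expC /= expR0 -/(cis _) cis0 mul1r. Qed.

Lemma expC_neq0 (w : R[i]) : expC w != 0.
Proof.
apply: contra_eqN expC0 => /eqP w0.
by rewrite -(subrr w) expCD w0 mul0r eq_sym oner_eq0.
Qed.

Lemma expC_first_order e : 0 < e -> exists2 r : R, 0 < r &
  forall u : R[i], cabs u < r -> cabs (expC u - 1 - u) <= e * cabs u.
Proof.
move=> e0; have e6 : 0 < e / 6 by rewrite divr_gt0.
have [r1 r10 P1] := real_first_order (is_derive_expR 0) e6.
have [r2 r20 P2] := real_first_order (is_derive_cos 0) e6.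
have [r3 r30 P3] := real_first_order (is_derive_sin 0) e6.
exists (Num.min (Num.min r1 r2) (Num.min (Num.min r3 1) (e / 6))) => [|[x y]].
  by rewrite !lt_min r10 r20 r30 e6 ltr01.
set u := x +i* y; rewrite !lt_min => /andP[/andP[u1 u2] /andP[/andP[u3 u4] u5]].
have xu : `|x| <= cabs u := Re_le_cabs u; have yu : `|y| <= cabs u := Im_le_cabs u.
have := P1 x (le_lt_trans xu u1); have := P2 y (le_lt_trans yu u2); have := P3 y (le_lt_trans yu u3).
rewrite !add0r expR0 cos0 sin0 oppr0 mul0r !mul1r !subr0 addr0 => s1 c1 ex1.
pose A := expR x - 1 - x; pose B := cis y - 1 - 'i%C * y%:C.
have uE : u = x%:C + 'i%C * y%:C by apply/eqP; rewrite eq_complex /=; apply/andP; split; apply/eqP; ring.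
have -> : expC u - 1 - u = A%:C * cis y + (1 + x%:C) * B + 'i%C * (x%:C * y%:C).
  have -> : expC u = (expR x)%:C * cis y by [].
  rewrite uE /A /B !rmorphB /= rmorph1; ring.
have bB : cabs B <= e / 6 * `|y| + e / 6 * `|y|.
  apply: le_trans (cabs_le_ReIm _) _; apply: lerD; rewrite /=.
    by rewrite [X in `|X|](_ : _ = cos y - 1)//; ring.
  by rewrite subr0 mul0r add0r mul1r.
apply: le_trans (cabsD _ _) _; apply: le_trans (lerD (cabsD _ _) (lexx _)) _.
rewrite !cabsM cabs_cis mulr1 !cabs_real cabs_i mul1r.
have b1 : cabs (1 + x%:C) <= 2 by apply: le_trans (cabsD _ _) _; rewrite cabs1 cabs_real; lra.
have y0 := normr_ge0 y; have x0 := normr_ge0 x.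
have h1 : e / 6 * `|x| <= e / 6 * cabs u by rewrite ler_wpM2l// ltW.
have h2 : e / 6 * `|y| <= e / 6 * cabs u by rewrite ler_wpM2l// ltW.
have h3 : cabs (1 + x%:C) * cabs B <= 2 * (e / 6 * `|y| + e / 6 * `|y|) by apply: ler_pM; rewrite ?cabs_ge0.
have h4 : `|x| * `|y| <= e / 6 * cabs u by apply: ler_pM => //; lra.
by rewrite /A; lra.
Qed.

End Exponential.

Section Gradients.
Variables (R : realType) (k : nat).
Implicit Types (f g : 'rV[R[i]]_k -> R[i]) (q : 'rV[R[i]]_k) (d : 'I_k -> R[i]).

Lemma has_gradient_lin f g q d d' (c : R[i]) : has_gradient f q d -> has_gradient g q d' ->
  has_gradient (fun t => f t + c * g t) q (fun l => d l + c * d' l).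
Proof.
move=> fd gd e e0; have c1 : 0 < 1 + cabs c by rewrite ltr_pwDl ?cabs_ge0.
have e1 : 0 < e / (1 + cabs c) by rewrite divr_gt0.
have [r r0 rP] := fd _ e1; have [s s0 sP] := gd _ e1.
exists (Num.min r s) => [|v]; first by rewrite lt_min r0.
rewrite lt_min => /andP[/rP h1 /sP h2].
have -> : pairing (fun l => d l + c * d' l) v = pairing d v + c * pairing d' v.
  by rewrite /pairing mulr_sumr -big_split; apply: eq_bigr => l _ /=; ring.
rewrite (_ : _ - _ = (f (q + v) - f q - pairing d v) + c * (g (q + v) - g q - pairing d' v)); last by ring.
apply: le_trans (cabsD _ _) _; rewrite cabsM.
have h3 := ler_wpM2l (cabs_ge0 c) h2.
apply: le_trans (lerD h1 h3) _; rewrite le_eqVlt; apply/orP; left; apply/eqP.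
by field; rewrite gt_eqF.
Qed.

Lemma has_gradient_cst (c : R[i]) q : has_gradient (fun=> c) q (fun=> 0).
Proof.
move=> e e0; exists 1 => // v _; rewrite subrr /pairing big1 => [|l _]; last by rewrite mul0r.
by rewrite subr0 cabs0 mulr_ge0 ?vabs_ge0 ?ltW.
Qed.

Lemma has_gradient_sum n (c : 'I_n -> R[i]) (F : 'I_n -> 'rV[R[i]]_k -> R[i])
    (D : 'I_n -> 'I_k -> R[i]) q : (forall j, has_gradient (F j) q (D j)) ->
  has_gradient (fun t => \sum_j c j * F j t) q (fun l => \sum_j c j * D j l).
Proof.
move=> FD; elim: (index_enum _) => [|j s IHs].
  have := has_gradient_cst 0 q; congr (has_gradient _ _ _); apply/funext => t; by rewrite big_nil.
have := has_gradient_lin (c j) IHs (FD j); congr (has_gradient _ _ _); apply/funext => t;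
 by rewrite big_cons addrC.
Qed.

Lemma has_gradient_near f g q d : (\forall t \near q, f t = g t) -> has_gradient f q d ->
  has_gradient g q d.
Proof.
move=> /near_vabsP[r r0 rP] fd e e0; have [s s0 sP] := fd e e0.
exists (Num.min r s) => [|v]; first by rewrite lt_min r0.
rewrite lt_min => /andP[vr /sP].
by rewrite (rP (q + v)) ?(rP q) ?subrr ?vabs0// [q + v]addrC addrK.
Qed.

(** The derivative of a logarithm, obtained from the first-order expansion of
    the exponential at [0] only. *)
Lemma log_gradient (L : 'rV[R[i]]_k -> R[i]) f q d d' : has_gradient L q d -> has_gradient f q d' ->
  (\forall t \near q, expC (L t) = f t) -> forall l, d l = d' l / f q.
Proof.
move=> Ld fd /near_vabsP[r r0 Lf] l.
have fq : f q = expC (L q) by rewrite Lf// subrr vabs0.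
have fq0 : f q != 0 by rewrite fq expC_neq0.
apply/eqP; rewrite -subr_eq0 -(mulrI_eq0 _ (mulfI fq0)) mulrBr [f q * (_ / _)]mulrC divfK//.
set c := _ - _; rewrite -cabs_eq0 eq_le cabs_ge0 andbT; apply/ler_addgt0Pr => eps eps0; rewrite add0r.
pose K := 1 + cabs (f q) * (cabs (d l) + 2).
have K0 : 0 < K by rewrite ltr_pwDl// mulr_ge0 ?cabs_ge0// addr_ge0 ?cabs_ge0.
pose e := Num.min 1 (eps / K).
have e0 : 0 < e by rewrite lt_min ltr01 divr_gt0.
have e1 : e <= 1 by rewrite ge_min lexx.
have eK : e * K <= eps by rewrite -ler_pdivlMr// ge_min lexx orbT.
have [r1 r10 P1] := Ld e e0; have [r2 r20 P2] := fd e e0; have [r3 r30 P3] := expC_first_order e0.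
have D0 : 0 < cabs (d l) + 1 by rewrite ltr_wpDl ?cabs_ge0.
pose h := Num.min (Num.min r r1) (Num.min r2 (r3 / (cabs (d l) + 1))) / 2.
have h0 : 0 < h by rewrite divr_gt0// !lt_min r0 r10 r20 divr_gt0.
have : h < Num.min (Num.min r r1) (Num.min r2 (r3 / (cabs (d l) + 1))) by move: h0; rewrite /h; lra.
rewrite !lt_min ltr_pdivlMr// => /andP[/andP[hr hr1] /andP[hr2 hr3]].
pose v : 'rV[R[i]]_k := h%:C *: delta_mx 0 l.
have vh : vabs v = h by rewrite vabs_delta cabs_real gtr0_norm.
pose u := L (q + v) - L q.
have ud : cabs (u - d l * h%:C) <= e * h.
  by have := P1 v; rewrite vh pairingZ pairing_delta mulrC; apply.
have dh : cabs (d l * h%:C) = cabs (d l) * h by rewrite cabsM cabs_real gtr0_norm.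
have uh : cabs u <= (cabs (d l) + e) * h.
  rewrite -[u](subrK (d l * h%:C)); apply: le_trans (cabsD _ _) _; rewrite dh mulrDl; lra.
have ur : cabs u < r3 by apply: le_lt_trans uh _; nra.
have Eu := P3 u ur.
have fE : f (q + v) = f q * expC u.
  by rewrite fq -Lf ?[q + v]addrC ?addrK ?vh// -expCD /u [v + q]addrC [L q + _]addrC subrK.
have fd2 : cabs (f (q + v) - f q - d' l * h%:C) <= e * h.
  by have := P2 v; rewrite vh pairingZ pairing_delta mulrC; apply.
have : cabs (c * h%:C) <= e * K * h.
  rewrite (_ : c * h%:C = (f (q + v) - f q - d' l * h%:C) -
    f q * ((expC u - 1 - u) + (u - d l * h%:C))); last by rewrite fE /c; ring.
  apply: le_trans (cabsBD _ _) _; rewrite cabsM.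
  have : cabs (expC u - 1 - u + (u - d l * h%:C)) <= e * ((cabs (d l) + 1) * h) + e * h.
    apply: le_trans (cabsD _ _) _; apply: lerD => //; apply: le_trans Eu _.
    rewrite ler_wpM2l ?(ltW e0)//; apply: le_trans uh _; rewrite ler_wpM2r ?(ltW h0)//; lra.
  move=> /(ler_wpM2l (cabs_ge0 (f q))) h5; rewrite (_ : e * K * h = e * h +
    cabs (f q) * (e * ((cabs (d l) + 1) * h) + e * h)); last by rewrite /K; ring.
  exact: lerD.
rewrite cabsM cabs_real gtr0_norm// ler_pM2r// => /le_trans; exact.
Qed.

End Gradients.

Section Holomorphic.
Variables (R : realType) (k : nat) (p : 'rV[R[i]]_k).
Implicit Types (f g : 'rV[R[i]]_k -> R[i]^o).

Lemma near_near (P : 'rV[R[i]]_k -> Prop) : (\forall q \near p, P q) ->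
  \forall q \near p, \forall t \near q, P t.
Proof.
move=> /near_vabsP[r r0 rP]; apply/near_vabsP; exists r => // q qr.
apply/near_vabsP; exists (r - vabs (q - p)) => [|t tq]; first by rewrite subr_gt0.
apply: rP; rewrite -(subrK q t) -addrA; apply: le_lt_trans (vabsD _ _) _; lra.
Qed.

Lemma near_forall (I : finType) (P : I -> 'rV[R[i]]_k -> Prop) :
  (forall i, \forall q \near p, P i q) -> \forall q \near p, forall i, P i q.
Proof. by move=> PI; exact: (@filter_forall _ I P (nbhs p) (nbhs_filter p) PI). Qed.

Lemma near_at (P : 'rV[R[i]]_k -> Prop) : (\forall q \near p, P q) -> P p.
Proof. by move=> /near_vabsP[r r0]; apply; rewrite subrr vabs0. Qed.

Lemma holomorphic_ext f g : (\forall t \near p, f t = g t) -> holomorphic_near p f ->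
  holomorphic_near p g.
Proof.
move=> fg fp; near=> q; apply: (proj1 (gradient_differentiable _)).
  have fq : differentiable f q by near: q.
  apply: has_gradient_near (differentiable_gradient fq).
  near: q; exact: near_near.
Unshelve. all: by end_near. Qed.

Lemma holomorphic_cst (c : R[i]) : holomorphic_near p (fun=> c).
Proof. by near=> q; apply: differentiable_cst. Unshelve. all: by end_near. Qed.

Lemma holomorphicD f g : holomorphic_near p f -> holomorphic_near p g ->
  holomorphic_near p (fun t => f t + g t).
Proof.
move=> fp gp; near=> q; have := @differentiableD _ _ _ f g q; apply; near: q; [exact: fp|exact: gp].
Unshelve. all: by end_near. Qed.

Lemma holomorphicM f g : holomorphic_near p f -> holomorphic_near p g ->
  holomorphic_near p (fun t => f t * g t).
Proof.
move=> fp gp; near=> q; have := @differentiableM _ _ f g q; apply; near: q; [exact: fp|exact: gp].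
Unshelve. all: by end_near. Qed.

Lemma holomorphicZ (c : R[i]) g : holomorphic_near p g -> holomorphic_near p (fun t => c * g t).
Proof. by move=> gp; apply: holomorphicM => //; apply: holomorphic_cst. Qed.

Lemma holomorphic_sum (I : Type) (s : seq I) (P : pred I) (F : I -> 'rV[R[i]]_k -> R[i]^o) :
  (forall i, holomorphic_near p (F i)) -> holomorphic_near p (fun t => \sum_(i <- s | P i) F i t).
Proof.
move=> FP; elim: s => [|i s IHs].
  by under eq_fun do rewrite big_nil; apply: holomorphic_cst.
under eq_fun do rewrite big_cons; case: (P i) => //.
exact: holomorphicD.
Qed.

Lemma holomorphic_prod (I : Type) (s : seq I) (P : pred I) (F : I -> 'rV[R[i]]_k -> R[i]^o) :
  (forall i, holomorphic_near p (F i)) -> holomorphic_near p (fun t => \prod_(i <- s | P i) F i t).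
Proof.
move=> FP; elim: s => [|i s IHs].
  by under eq_fun do rewrite big_nil; apply: holomorphic_cst.
under eq_fun do rewrite big_cons; case: (P i) => //.
exact: holomorphicM.
Qed.

Lemma holomorphic_neq0 f : holomorphic_near p f -> f p != 0 -> \forall q \near p, f q != 0.
Proof.
move=> fp fp0; have /differentiable_continuous fc : differentiable f p by exact: (near_at fp).
exact: (cvgr_neq0 _ fc fp0).
Qed.

Lemma holomorphicV f : holomorphic_near p f -> f p != 0 -> holomorphic_near p (fun t => (f t)^-1).
Proof.
move=> fp fp0; have fn := holomorphic_neq0 fp fp0; near=> q.
have := @differentiableV _ _ f q; apply; near: q; [exact: fp|exact: fn].
Unshelve. all: by end_near. Qed.

Lemma holomorphic_coord l : holomorphic_near p (fun t => (t - p) 0 l).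
Proof.
near=> q; apply: (proj1 (gradient_differentiable (d := fun m => (m == l)%:R) _)) => e e0.
exists 1 => // v _; rewrite /pairing (bigD1 l)//= eqxx mul1r big1 ?addr0 => [|m /negbTE->]; last by rewrite mul0r.
rewrite !mxE (_ : _ - _ - _ = 0) ?cabs0 ?mulr_ge0 ?vabs_ge0 ?ltW//; ring.
Unshelve. all: by end_near. Qed.

End Holomorphic.

Section CriticalPoints.
Variables (R : realType) (n k : nat) (b : 'M[R[i]]_(n, k)).
Variables (a : 'I_n -> R[i]) (z : 'rV[R[i]]_n).
Implicit Types p q : 'rV[R[i]]_k.

Definition dmaster (i : 'I_k) (t : 'rV[R[i]]_k) : R[i] := \sum_j a j * (b j i / faff b z j t).

Lemma glinE j t : glin b j t = pairing (b j) t.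
Proof. by []. Qed.

Lemma faff_gradient j q : has_gradient (faff b z j) q (b j).
Proof.
move=> e e0; exists 1 => // v _; rewrite /faff !glinE pairingD.
rewrite (_ : _ - _ - _ = 0) ?cabs0 ?mulr_ge0 ?vabs_ge0 ?ltW//; ring.
Qed.

Lemma holomorphic_faff j p : holomorphic_near p (faff b z j).
Proof. by near=> q; have [] := gradient_differentiable (@faff_gradient j q). Unshelve. all: by end_near. Qed.

Lemma arr_compl_open p : arr_compl b z p -> \forall q \near p, arr_compl b z q.
Proof.
move=> pU; have : \forall q \near p, forall j, faff b z j q != 0 by
  apply: near_forall => j; exact: (holomorphic_neq0 (@holomorphic_faff j p) (pU j)).
exact.
Qed.

Lemma branch_gradient p phi : master_branch b a z p phi ->
  \forall q \near p, has_gradient phi q (dmaster ^~ q).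
Proof.
move=> [L [Lp /near_forall Lf phiE]].
have {}Lp : \forall q \near p, forall j, differentiable (L j) q by apply: near_forall.
have {}Lf := near_near Lf; have {}phiE := near_near phiE.
near=> q; have Eq : \forall t \near q, \sum_j a j * L j t = phi t.
  by have : \forall t \near q, phi t = \sum_j a j * L j t; [near: q|apply: filterS => t ->].
apply: has_gradient_near Eq _; apply: has_gradient_sum => j.
have Lj : differentiable (L j) q by move: j; near: q.
have Lq : \forall t \near q, expC (L j t) = faff b z j t.
  by have : \forall t \near q, forall j, expC (L j t) = faff b z j t; [near: q|apply: filterS => t].
have Lg := differentiable_gradient Lj; have E := log_gradient Lg (@faff_gradient j q) Lq.
by move: Lg; congr (has_gradient _ _ _); apply/funext => l; rewrite E.
Unshelve. all: by end_near. Qed.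

Lemma branch_partial p phi : master_branch b a z p phi ->
  \forall q \near p, forall i, partial i phi q = dmaster i q.
Proof.
move=> /branch_gradient; apply: filterS => q /gradient_differentiable[_ D] i.
by rewrite /partial D pairing_delta.
Qed.

Lemma branch_near p phi : master_branch b a z p phi -> \forall q \near p, master_branch b a z q phi.
Proof.
move=> [L [Lp /near_forall Lf /near_near phiE]].
have {}Lp : \forall q \near p, forall j, holomorphic_near q (L j).
  by apply: near_forall => j; exact: near_near (Lp j).
have {}Lf := near_near Lf.
near=> q; exists L; split; first by near: q.
- have Lq : \forall t \near q, forall j, expC (L j t) = faff b z j t by near: q.
  by move=> j; move: Lq; apply: filterS => t.
- by near: q.
Unshelve. all: by end_near. Qed.

(** A branch of the master function near [p] is also a branch near each
    neighbouring point, so that a zero of the partial derivatives close to [p] is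
    a critical point. *)
Lemma isolated_critical_zero p : isolated_critical b a z p ->
  [/\ arr_compl b z p, exists phi, master_branch b a z p phi, forall i, dmaster i p = 0 &
      \forall q \near p, (forall i, dmaster i q = 0) -> q = p].
Proof.
move=> [[pU [phi phiP crit]] iso]; have pE := branch_partial phiP.
split=> //; [by exists phi| by move=> i; rewrite -(near_at pE)|].
have pE' := near_near pE; have pU' := arr_compl_open pU; have pB := branch_near phiP.
have {}iso : \forall q \near p, q != p -> ~ critical b a z q by [].
near=> q => hq; apply/eqP; apply: contraPT isT => qp _.
have : q != p -> ~ critical b a z q by near: q.
apply=> //; split; first by near: q.
exists phi; first by near: q.
by move=> i; have -> : forall i, partial i phi q = dmaster i q by near: q.
Unshelve. all: by end_near. Qed.

End CriticalPoints.

(** * The Cauchy-Binet formula and the Bezoutian *)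

Section CauchyBinet.
Variables (K : comNzRingType) (n k : nat).
Implicit Types (s t : k.-tuple 'I_n) (Y : 'M[K]_(n, k)).

Definition minor Y s : K := \det (\matrix_(i, l) Y (tnth s i) l).

Definition increasing s := sorted ltn [seq val j | j <- s].

Let ordle (i j : 'I_n) := (i <= j)%N.

Lemma minor_perm Y s (sg : {perm 'I_k}) :
  minor Y [tuple tnth s (sg i) | i < k] = (-1) ^+ sg * minor Y s.
Proof.
rewrite /minor -det_perm -det_mulmx -row_permE; congr (\det _).
by apply/matrixP => i l; rewrite !mxE tnth_mktuple.
Qed.

Lemma minor_dup Y s : ~~ uniq s -> minor Y s = 0.
Proof.
move=> /tuple_uniqP; rewrite /injective => ninj.
have [i1 [i2 [i12 E]]] : exists i1 i2, i1 != i2 /\ tnth s i1 = tnth s i2.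
  apply: contrapT => H; apply: ninj => i1 i2 E; apply/eqP; apply: contraPT isT => i12 _; apply: H.
  by exists i1, i2.
by apply: (determinant_alternate i12) => l; rewrite !mxE E.
Qed.

Let sort_tup s : k.-tuple 'I_n := [tuple of sort ordle s].

Let ordle_total : total ordle. Proof. by move=> i j; apply: leq_total. Qed.
Let ordle_trans : transitive ordle. Proof. by move=> i j l; apply: leq_trans. Qed.
Let ordle_anti : antisymmetric ordle. Proof. by move=> i j /anti_leq /val_inj. Qed.

Let increasingE s : increasing s = uniq s && sorted ordle s.
Proof. by rewrite /increasing ltn_sorted_uniq_leq (map_inj_uniq val_inj) sorted_map. Qed.

(** Each duplicate-free tuple is a unique permutation of an increasing one. *)
Lemma uniq_sum_increasing (F : k.-tuple 'I_n -> K) :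
  \sum_(s : k.-tuple 'I_n | uniq s) F s =
  \sum_(t : k.-tuple 'I_n | increasing t) \sum_(sg : {perm 'I_k}) F [tuple tnth t (sg i) | i < k].
Proof.
rewrite (partition_big sort_tup increasing) => [|s us]; last first.
  by rewrite increasingE sort_uniq us sort_sorted.
apply: eq_bigr => t; rewrite increasingE => /andP[ut st].
pose h (sg : {perm 'I_k}) := [tuple tnth t (sg i) | i < k].
have hinj : injective h.
  move=> s1 s2 E; apply/permP => i; have /tuple_uniqP tinj := ut; apply: tinj.
  by have := congr1 (fun u => tnth u i) E; rewrite !tnth_mktuple.
rewrite -[RHS](big_imset F (h := h) (A := predT)) /=; last by move=> ? ? _ _ /hinj.
apply: eq_bigl => s; apply/idP/imsetP => [/andP[us /eqP st']|[sg _ ->]].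
  have : perm_eq s t by rewrite -st' perm_sym /= perm_sort.
  by move=> /tuple_permP[sg sE]; exists sg => //; apply: val_inj.
have p : perm_eq (h sg) t by apply/tuple_permP; exists sg.
rewrite (perm_uniq p) ut /=; apply/eqP/val_inj => /=.
rewrite -[RHS](sorted_sort ordle_trans st).
by apply/perm_sortP.
Qed.

(** Expand the determinant by multilinearity and group the index functions
    according to their image. *)
Lemma cauchy_binet (X Y : 'M[K]_(n, k)) :
  \det (X^T *m Y) = \sum_(s : k.-tuple 'I_n | increasing s) minor X s * minor Y s.
Proof.
transitivity (\sum_(s : k.-tuple 'I_n) (\prod_i X (tnth s i) i) * minor Y s).
  rewrite /determinant.
  under eq_bigr => sg _.
    rewrite (eq_bigr (fun i => \sum_j X j i * Y j (sg i))); last first.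
      by move=> i _; rewrite mxE; apply: eq_bigr => j _; rewrite mxE.
    rewrite bigA_distr_bigA mulr_sumr /=.
    over.
  rewrite exchange_big /= (reindex (fun s : k.-tuple 'I_n => [ffun i => tnth s i])) /=; last first.
    exists (fun f : {ffun 'I_k -> 'I_n} => [tuple f i | i < k]) => f _.
      by apply: eq_from_tnth => i; rewrite tnth_mktuple ffunE.
    by apply/ffunP => i; rewrite ffunE tnth_mktuple.
  apply: eq_bigr => s _; rewrite /minor /determinant mulr_sumr; apply: eq_bigr => sg _.
  rewrite mulrCA -big_split /=; congr (_ * _); apply: eq_bigr => i _.
  by rewrite ffunE mxE.
rewrite (bigID (fun s : k.-tuple 'I_n => uniq s)) /= addrC big1 ?add0r => [|s /minor_dup->]; last first.
  by rewrite mulr0.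
rewrite uniq_sum_increasing; apply: eq_bigr => t _.
under eq_bigr => sg _ do rewrite minor_perm mulrA [_ * (-1) ^+ sg]mulrC.
rewrite -mulr_suml; congr (_ * _); rewrite /minor -det_tr /determinant; apply: eq_bigr => sg _.
by congr (_ * _); apply: eq_bigr => i _; rewrite tnth_mktuple !mxE.
Qed.

End CauchyBinet.

Section Bezoutian.
Variables (R : realType) (n k : nat) (b : 'M[R[i]]_(n, k)).
Variables (a : 'I_n -> R[i]) (z : 'rV[R[i]]_n).
Local Notation f := (faff b z).
Local Notation U := (arr_compl b z).
Local Notation h := (dmaster b a z).
Implicit Types (p x y : 'rV[R[i]]_k) (s : k.-tuple 'I_n).

Definition omega_coef s y : R[i] := minor b s / \prod_i f (tnth s i) y.

Definition bezout x y : 'M[R[i]]_k :=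
  \matrix_(i, l) \sum_j - (a j / (f j x * f j y)) * b j i * b j l.

Lemma bezoutC x y : bezout x y = bezout y x.
Proof. by apply/matrixP => i l; rewrite !mxE; apply: eq_bigr => j _; rewrite [f j x * _]mulrC. Qed.

(** The difference of two inverses of [f_j] is linear in [y - x], divided by the
    product of two values of [f_j]. *)
Lemma bezoutP i x y : U x -> U y ->
  h i y - h i x = \sum_l bezout x y i l * (y - x) 0 l.
Proof.
move=> xU yU; rewrite /dmaster -sumrB.
under [RHS]eq_bigr => l _ do rewrite mxE mulr_suml.
rewrite exchange_big /=; apply: eq_bigr => j _.
have E : f j y - f j x = \sum_l b j l * (y - x) 0 l.
  rewrite /faff /glin opprD addrACA subrr add0r -sumrB; apply: eq_bigr => l _.
  by rewrite !mxE; ring.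
transitivity (- (a j / (f j x * f j y)) * b j i * (f j y - f j x)).
  by have := xU j; have := yU j; move: (f j x) (f j y) => u v v0 u0; field; rewrite u0 v0.
by rewrite E mulr_sumr; apply: eq_bigr => l _; rewrite mulrA.
Qed.

(** The Bezoutian is [b^T D b] with a diagonal matrix [D], to which the
    Cauchy-Binet formula applies: its determinant is the contravariant form as a
    function of two points. *)
Lemma det_bezout x y : \det (bezout x y) =
  (-1) ^+ k * \sum_(s : k.-tuple 'I_n | increasing s)
    (\prod_(j <- s) a j) * omega_coef s x * omega_coef s y.
Proof.
pose X : 'M[R[i]]_(n, k) := \matrix_(j, i) (- (a j / (f j x * f j y)) * b j i).
have -> : bezout x y = X^T *m b.
  by apply/matrixP => i l; rewrite !mxE; apply: eq_bigr => j _; rewrite !mxE.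
rewrite cauchy_binet mulr_sumr; apply: eq_bigr => s _.
have -> : minor X s = \prod_i (- (a (tnth s i) / (f (tnth s i) x * f (tnth s i) y))) * minor b s.
  rewrite /minor (_ : \matrix_(i, l) _ = diag_mx (\row_i - (a (tnth s i) / (f (tnth s i) x * f (tnth s i) y)))
    *m \matrix_(i, l) b (tnth s i) l); last first.
    by rewrite mul_diag_mx; apply/matrixP => i l; rewrite !mxE.
  by rewrite det_mulmx det_diag; congr (_ * _); apply: eq_bigr => i _; rewrite mxE.
rewrite prodrN card_ord !big_split /= prodfV big_split /= big_tuple /omega_coef.
by rewrite invfM; ring.
Qed.

Definition regular (g : 'rV[R[i]]_k -> R[i]) := forall p, U p -> holomorphic_near p g.

Lemma regular_omega_coef s : regular (omega_coef s).
Proof.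
move=> p pU; apply: holomorphicZ; apply: holomorphicV.
  by apply: holomorphic_prod => i; apply: holomorphic_faff.
by apply/prodf_neq0 => i _; apply: pU.
Qed.

(** A functional applied in the variable [x] to such a function gives a regular
    function of [y]. *)
Definition separated (F : 'rV[R[i]]_k -> 'rV[R[i]]_k -> R[i]) :=
  exists m (A B : 'I_m -> 'rV[R[i]]_k -> R[i]),
    [/\ forall j, regular (A j), forall j, regular (B j) &
        forall x y, F x y = \sum_j A j x * B j y].

Lemma separated_term A B : regular A -> regular B -> separated (fun x y => A x * B y).
Proof. by move=> rA rB; exists 1%N, (fun=> A), (fun=> B); split=> // x y; rewrite big_ord1. Qed.

Lemma regular_cst c : regular (fun=> c).
Proof. by move=> p _; apply: holomorphic_cst. Qed.

Lemma separatedD F G : separated F -> separated G -> separated (fun x y => F x y + G x y).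
Proof.
move=> [m [A [B [rA rB FE]]]] [m' [A' [B' [rA' rB' GE]]]].
pose cat (X : 'I_m -> 'rV[R[i]]_k -> R[i]) (X' : 'I_m' -> 'rV[R[i]]_k -> R[i]) (j : 'I_(m + m')) :=
  match fintype.split j with inl i => X i | inr i => X' i end.
exists (m + m')%N, (cat A A'), (cat B B'); split=> [j|j|x y]; rewrite ?/cat; [by case: fintype.split|by case: fintype.split|].
rewrite FE GE big_split_ord; congr (_ + _); apply: eq_bigr => j _ /=; rewrite /cat.
  by rewrite -/(unsplit (inl j)) unsplitK.
by rewrite -/(unsplit (inr j)) unsplitK.
Qed.

Lemma separated_ext F G : (forall x y, F x y = G x y) -> separated F -> separated G.
Proof. by move=> E [m [A [B [rA rB FE]]]]; exists m, A, B; split=> // x y; rewrite -E. Qed.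

Lemma separated_cst c : separated (fun _ _ => c).
Proof.
by apply: separated_ext (separated_term (regular_cst c) (regular_cst 1)) => x y; rewrite mulr1.
Qed.

Lemma separated_sum (I : Type) (r : seq I) (F : I -> 'rV[R[i]]_k -> 'rV[R[i]]_k -> R[i]) :
  (forall j, separated (F j)) -> separated (fun x y => \sum_(j <- r) F j x y).
Proof.
move=> sF; elim: r => [|j r IHr].
  by apply: separated_ext (separated_cst 0) => x y; rewrite big_nil.
by apply: separated_ext (separatedD (sF j) IHr) => x y; rewrite big_cons.
Qed.

Lemma separatedM F G : separated F -> separated G -> separated (fun x y => F x y * G x y).
Proof.
move=> [m [A [B [rA rB FE]]]] [m' [A' [B' [rA' rB' GE]]]].
apply: (@separated_ext (fun x y => \sum_i \sum_j (A i x * A' j x) * (B i y * B' j y))) => [x y|].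
  by rewrite FE GE big_distrlr /=; apply: eq_bigr => i _; apply: eq_bigr => j _; ring.
apply: separated_sum => i; apply: separated_sum => j; apply: separated_term => p pU; apply: holomorphicM;
 by [exact: rA|exact: rA'|exact: rB|exact: rB'].
Qed.

Lemma separated_prod (I : Type) (r : seq I) (F : I -> 'rV[R[i]]_k -> 'rV[R[i]]_k -> R[i]) :
  (forall j, separated (F j)) -> separated (fun x y => \prod_(j <- r) F j x y).
Proof.
move=> sF; elim: r => [|j r IHr].
  by apply: separated_ext (separated_cst 1) => x y; rewrite big_nil.
by apply: separated_ext (separatedM (sF j) IHr) => x y; rewrite big_cons.
Qed.

Lemma separated_adj i l : separated (fun x y => (\adj (bezout x y)) i l).
Proof.
have sb i' l' : separated (fun x y => bezout x y i' l').
  apply: (@separated_ext (fun x y => \sum_j - (a j) * b j i' * b j l' / f j x * (f j y)^-1)) => [x y|].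
    by rewrite mxE; apply: eq_bigr => j _; rewrite invfM; ring.
  apply: separated_sum => j; apply: separated_term => p pU; do ?apply: holomorphicZ;
    by apply: holomorphicV (pU j); apply: holomorphic_faff.
apply: (@separated_ext (fun x y => (-1) ^+ (l + i) *
   \sum_(sg : {perm 'I_k.-1}) (-1) ^+ sg * \prod_m (row' l (col' i (bezout x y))) m (sg m))) => [x y|].
  by rewrite mxE.
apply: separatedM; first exact: separated_cst.
apply: separated_sum => sg; apply: separatedM; first exact: separated_cst.
apply: separated_prod => m; apply: separated_ext (sb (lift l m) (lift i (sg m))) => x y.
by rewrite !mxE; apply: eq_bigr => j _.
Qed.

(** Cramer's rule for the matrix which sends [y - x] to the differences of the
    partial derivatives. *)
Lemma coord_det_bezout l x y : U x -> U y ->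
  (y - x) 0 l * \det (bezout x y) = \sum_i (\adj (bezout x y)) l i * (h i y - h i x).
Proof.
move=> xU yU; have E : bezout x y *m (y - x)^T = \col_i (h i y - h i x).
  by apply/colP => i; rewrite !mxE (bezoutP i xU yU); apply: eq_bigr => m _; rewrite [_^T _ _]mxE.
have := congr1 (mulmx (\adj (bezout x y))) E; rewrite mulmxA mul_adj_mx mul_scalar_mx.
move=> /colP/(_ l); rewrite !mxE mulrC => ->; apply: eq_bigr => i _; by rewrite [X in _ * X = _]mxE.
Qed.

End Bezoutian.

(** * Functionals, bases of quotients and Gram matrices *)

Section Subspaces.
Variables (K : fieldType) (V : lmodType K).
Implicit Types (A B I : set V) (u v w : V).

Definition subspace A := A 0 /\ forall (c : K) u v, A u -> A v -> A (c *: u + v).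

Definition functional (l : V -> K) := forall (c : K) u v, l (c *: u + v) = c * l u + l v.

Lemma subspaceD A u v : subspace A -> A u -> A v -> A (u + v).
Proof. by move=> [_ As] Au Av; rewrite -[u]scale1r; apply: As. Qed.

Lemma subspaceZ A (c : K) u : subspace A -> A u -> A (c *: u).
Proof. by move=> [A0 As] Au; rewrite -[_ *: _]addr0; apply: As. Qed.

Lemma subspaceB A u v : subspace A -> A u -> A v -> A (u - v).
Proof. by move=> As Au Av; rewrite -scaleN1r; apply: subspaceD => //; apply: subspaceZ. Qed.

Lemma subspace_sum A (J : Type) (r : seq J) (F : J -> V) : subspace A -> (forall j, A (F j)) ->
  A (\sum_(j <- r) F j).
Proof.
move=> As AF; elim: r => [|j r IHr]; first by rewrite big_nil; case: As.
by rewrite big_cons; apply: subspaceD.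
Qed.

Lemma functional0 l : functional l -> l 0 = 0.
Proof. by move=> lf; have := lf (-1) 0 0; rewrite scaler0 addr0 mulN1r addNr. Qed.

Lemma functionalD l u v : functional l -> l (u + v) = l u + l v.
Proof. by move=> lf; rewrite -[u in LHS]scale1r lf mul1r. Qed.

Lemma functionalZ l (c : K) u : functional l -> l (c *: u) = c * l u.
Proof. by move=> lf; rewrite -[_ *: _]addr0 lf functional0// addr0. Qed.

Lemma functionalB l u v : functional l -> l (u - v) = l u - l v.
Proof. by move=> lf; rewrite -scaleN1r addrC lf mulN1r addrC. Qed.

Lemma functional_sum l (J : Type) (r : seq J) (F : J -> V) : functional l ->
  l (\sum_(j <- r) F j) = \sum_(j <- r) l (F j).
Proof.
move=> lf; elim: r => [|j r IHr]; first by rewrite !big_nil functional0.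
by rewrite !big_cons functionalD// IHr.
Qed.

Let extension A v B := [/\ subspace B, A `<=` B & ~ B v].

Let maximal_extension A v : subspace A -> ~ A v ->
  exists B, extension A v B /\ forall C, extension A v C -> B `<=` C -> C `<=` B.
Proof.
move=> As Av; pose P B := B = set0 \/ extension A v B.
have [F FP Ftot|B [PB Bmax]] := @Zorn_bigcup _ P.
  have [[B0 [FB0 B0n]]|none] := pselect (exists B, F B /\ B <> set0); last first.
    left; rewrite -subset0 => x [B FB Bx].
    by apply: none; exists B; split=> // B0; rewrite B0 in Bx.
  have ext B x : F B -> B x -> extension A v B by move=> FB Bx; case: (FP _ FB) => // E; rewrite E in Bx.
  have [[B00 _] AB0 _] : extension A v B0 by case: (FP _ FB0).
  right; split.
  - split=> [|c u w [B1 F1 u1] [B2 F2 w2]]; first by exists B0.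
    have [[_ s1] _ _] := ext _ _ F1 u1; have [[_ s2] _ _] := ext _ _ F2 w2.
    have [B12|B21] := Ftot _ _ F1 F2.
      by exists B2 => //; apply: s2 => //; apply: B12.
    by exists B1 => //; apply: s1 => //; apply: B21.
  - by move=> x Ax; exists B0 => //; apply: AB0.
  - by move=> [B FB Bv]; have [_ _] := ext _ _ FB Bv; apply.
have EA : extension A v A by split.
case: PB => [B0|EB].
  suff BA : B `<` A by case: (Bmax A BA); right.
  split; first by rewrite B0.
  by move=> /(_ _ (proj1 As)); rewrite B0.
exists B; split=> // C EC BC; apply: contrapT => nCB.
by have BltC : B `<` C by []; case: (Bmax C BltC); right.
Qed.

(** By Zorn's lemma there is a maximal subspace containing [A] but not [v]; it has
    codimension one. *)
Lemma separating_functional A v : subspace A -> ~ A v ->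
  exists l : V -> K, [/\ functional l, forall u, A u -> l u = 0 & l v = 1].
Proof.
move=> As Av; have [B [[Bs AB Bv] Bmax]] := maximal_extension As Av.
have span u : exists c, B (u - c *: v).
  apply: contrapT => nc; pose C w := exists c, B (w - c *: u).
  have CB : B `<=` C by move=> w Bw; exists 0; rewrite scale0r subr0.
  have Cs : subspace C.
    split; first by apply: CB; case: Bs.
    move=> c w w' [d Bd] [d' Bd']; exists (c * d + d').
    rewrite (_ : _ - _ = c *: (w - d *: u) + (w' - d' *: u)); first by case: Bs => _; apply.
    by rewrite scalerBr scalerDl scalerA opprD addrACA.
  have [[c Bc]|nCv] := pselect (C v); last first.
    apply: nc; exists 0; rewrite scale0r subr0; apply: (Bmax C) => //; last first.
      by exists 1; rewrite scale1r subrr; case: Bs.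
    by split=> //; apply: subset_trans AB CB.
  have c0 : c != 0 by apply: contra_notN Bv => /eqP c0; move: Bc; rewrite c0 scale0r subr0.
  apply: nc; exists c^-1; have := subspaceZ (- c^-1) Bs Bc.
  by rewrite scalerBr scalerA mulNr mulVf// !scaleNr scale1r opprK addrC.
pose l u := sval (cid (span u)).
have lP u : B (u - l u *: v) by rewrite /l; case: cid.
have uniq c u : B (u - c *: v) -> l u = c.
  move=> Bc; apply/eqP; rewrite -subr_eq0; apply: contraPT isT => n _; apply: Bv.
  have := subspaceZ (l u - c)^-1 Bs (subspaceB Bs Bc (lP u)).
  have -> : u - c *: v - (u - l u *: v) = (l u - c) *: v.
    by rewrite scalerBl opprB addrC addrA subrK.
  by rewrite scalerA mulVf// scale1r.
exists l; split=> [c u w|u Au|].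
- apply: uniq; rewrite (_ : _ - _ = c *: (u - l u *: v) + (w - l w *: v)); first by case: Bs => _; apply.
  by rewrite scalerBr scalerDl scalerA opprD addrACA.
- by apply: uniq; rewrite scale0r subr0; apply: AB.
- by apply: uniq; rewrite scale1r subrr; case: Bs.
Qed.

(** Separate the [j]-th vector from [I] and the other vectors. *)
Lemma dual_functional A I m (e : 'I_m -> V) (j : 'I_m) : subspace I -> basis_mod A I e ->
  exists l : V -> K, [/\ functional l, forall u, I u -> l u = 0 & forall i, l (e i) = (i == j)%:R].
Proof.
move=> Is [_ _ ind].
pose B v := exists c : 'I_m -> K, c j = 0 /\ I (v - \sum_i c i *: e i).
have sum1 i0 : \sum_i (i == i0)%:R *: e i = e i0.
  rewrite (bigD1 i0)//= eqxx scale1r big1 ?addr0// => i /negbTE->; exact: scale0r.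
have Bs : subspace B.
  split.
    by exists (fun=> 0); split=> //; rewrite big1 ?subr0 => [|i _]; [case: Is|rewrite scale0r].
  move=> c u v [d [dj Id]] [d' [dj' Id']]; exists (fun i => c * d i + d' i); split.
    by rewrite dj dj' mulr0 addr0.
  rewrite (_ : _ - _ = c *: (u - \sum_i d i *: e i) + (v - \sum_i d' i *: e i)); first by case: Is => _; apply.
  rewrite scalerBr addrACA -opprD scaler_sumr -big_split; congr (_ - _).
  by apply: eq_bigr => i _; rewrite scalerDl scalerA.
have Bj : ~ B (e j).
  move=> [c [cj]]; rewrite -[e j]sum1 -sumrB.
  under eq_bigr => i _ do rewrite -scalerBl.
  by move=> /ind/(_ j)/eqP; rewrite eqxx cj subr0 oner_eq0.
have [l [lf lB lj]] := separating_functional Bs Bj; exists l; split=> // [u Iu|i].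
  by apply: lB; exists (fun=> 0); split=> //; rewrite big1 ?subr0 => // i _; rewrite scale0r.
have [->//|ij] := eqVneq i j.
apply: lB; exists (fun i' => (i' == i)%:R); rewrite eq_sym (negbTE ij); split=> //.
by rewrite sum1 subrr; case: Is.
Qed.

(** A spanning subfamily with the least number of elements is independent. *)
Lemma basis_of_spanning A I m (e : 'I_m -> V) : subspace I -> (forall i, A (e i)) ->
  (forall v, A v -> exists c : 'I_m -> K, I (v - \sum_i c i *: e i)) ->
  exists m' (f : 'I_m' -> 'I_m), basis_mod A I (e \o f).
Proof.
move=> Is Ae gen.
pose spans m' (f : 'I_m' -> 'I_m) :=
  forall v, A v -> exists c : 'I_m' -> K, I (v - \sum_i c i *: e (f i)).
have ex : exists m', `[< exists f : 'I_m' -> 'I_m, spans m' f >] by exists m; apply/asboolP; exists id.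
case: (ex_minnP ex) => m' /asboolP[f fspan] mmin; exists m', f; split=> [i|v|c Ic i0]; [exact: Ae|exact: fspan|].
apply/eqP; apply: contraPT isT => ci0 _.
case: m' => [|m'] in f fspan mmin c Ic i0 ci0 *; first by case: i0 ci0.
suff : (m'.+1 <= m')%N by rewrite ltnn.
apply: mmin; apply/asboolP; exists (f \o lift i0) => v /fspan[d Id].
exists (fun i => d (lift i0 i) - d i0 / c i0 * c (lift i0 i)).
have := subspaceD Is Id (subspaceZ (d i0 / c i0) Is Ic).
rewrite (_ : _ + _ = v - \sum_i (d i - d i0 / c i0 * c i) *: e (f i)); last first.
  rewrite scaler_sumr -addrA; congr (_ + _); rewrite -[RHS]opprK opprK -sumrN -[RHS]sumrN -big_split.
  by apply: eq_bigr => i _; rewrite /= scalerBl opprB scalerA addrC.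
by rewrite (bigD1_ord i0)//= divfK// subrr scale0r add0r.
Qed.

(** A largest family whose values under [ev] are independent spans [W]. *)
Lemma finite_basis (W : set V) N (ev : V -> 'rV[K]_N) : subspace W ->
  (forall (c : K) u v, ev (c *: u + v) = c *: ev u + ev v) ->
  (forall u, W u -> ev u = 0 -> u = 0) ->
  exists m (e : 'I_m -> V), basis_mod W [set 0] e.
Proof.
move=> Ws evL evI.
have ev0 : ev 0 = 0.
  have := evL (-1) 0 0; rewrite scaler0 addr0 scaleN1r => E.
  by rewrite E addNr.
have evS m (c : 'I_m -> K) (e : 'I_m -> V) : ev (\sum_i c i *: e i) = (\row_i c i) *m \matrix_i ev (e i).
  rewrite mulmx_sum_row; under [RHS]eq_bigr => i _ do rewrite mxE rowK.
  elim: (index_enum _) => [|i r IHr]; first by rewrite !big_nil.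
  by rewrite !big_cons evL IHr.
pose indep m := `[< exists e : 'I_m -> V, (forall i, W (e i)) /\ row_free (\matrix_i ev (e i)) >].
have ex : exists m, indep m.
  exists 0%N; apply/asboolP; exists (fun=> 0); split=> [[]//|].
  by rewrite /row_free -leqn0 rank_leq_row.
have bound m : indep m -> (m <= N)%N.
  by move=> /asboolP[e [_ /eqP <-]]; apply: rank_leq_col.
case: (ex_maxnP ex bound) => m /asboolP[e [We free]] mmax.
have ind (c : 'I_m -> K) : ev (\sum_i c i *: e i) = 0 -> forall i, c i = 0.
  rewrite evS => /(congr1 (mulmxr (pinvmx (\matrix_i ev (e i))))); rewrite /= mul0mx mulmxKp// => /rowP E i.
  by have := E i; rewrite !mxE.
exists m, e; split=> // [v Wv|c E]; last by apply: ind; rewrite E.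
have [/submxP[c cE]|nin] := boolP (ev v <= \matrix_i ev (e i))%MS.
  exists (c 0); apply: evI.
    by apply: subspaceB => //; apply: subspace_sum => // i; apply: subspaceZ.
  rewrite -scaleN1r addrC evL evS cE scaleN1r (_ : \row_i _ = c) ?addNr//.
  by apply/rowP => i; rewrite mxE.
suff : (m.+1 <= m)%N by rewrite ltnn.
apply: mmax; apply/asboolP.
exists (fun i => match unlift ord0 i with Some j => e j | None => v end); split=> [i|].
  by case: unlift.
rewrite -kermx_eq0; apply/rowV0P => c; rewrite sub_kermx mulmx_sum_row => /eqP.
rewrite big_ord_recl rowK unlift_none.
under eq_bigr => i _ do rewrite rowK liftK.
have -> : \sum_(i < m) c 0 (lift ord0 i) *: ev (e i) = ev (\sum_i c 0 (lift ord0 i) *: e i).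
  by rewrite evS mulmx_sum_row; apply: eq_bigr => i _; rewrite mxE rowK.
have [c0|c0] := eqVneq (c 0 ord0) 0.
  rewrite c0 scale0r add0r => /ind E; apply/rowP => i; rewrite mxE.
  by case: (unliftP ord0 i) => [j ->|->].
rewrite evS => E; case/negP: nin; apply/submxP.
exists (- (c 0 ord0)^-1 *: \row_i c 0 (lift ord0 i)).
move/(congr1 (GRing.scale (c 0 ord0)^-1)): E; rewrite scalerDr scalerA mulVf// scale1r scaler0.
by move=> /eqP; rewrite addr_eq0 => /eqP ->; rewrite scaleNr mulNmx -scalemxAl.
Qed.

(** The coordinates of two dual families factor the identity matrix through the
    Gram matrix. *)
Lemma dual_families_rank (W : set V) m (e : 'I_m -> V) (S : V -> V -> K) (J : finType) (F G : J -> V) :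
  basis_mod W [set 0] e -> (forall v, functional (S v)) -> (forall v, functional (S ^~ v)) ->
  (forall j, W (F j)) -> (forall j, W (G j)) -> (forall i j, S (F i) (G j) = (i == j)%:R) ->
  (#|J| <= \rank (\matrix_(i, j) S (e i) (e j)))%N.
Proof.
move=> [_ gen _] Sl Sr WF WG SFG; set Gr := \matrix_(i, j) _.
have coords (X : J -> V) : (forall j, W (X j)) -> exists c : J -> 'I_m -> K, forall j, X j = \sum_i c j i *: e i.
  move=> WX; have H j : exists c : 'I_m -> K, X j = \sum_i c i *: e i.
    by have [c /= /eqP] := gen _ (WX j); rewrite subr_eq0 => /eqP E; exists c.
  by exists (fun j => sval (cid (H j))) => j; case: cid.
have [c cE] := coords F WF; have [d dE] := coords G WG.
pose C : 'M[K]_(#|J|, m) := \matrix_(x, i) c (enum_val x) i.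
pose D : 'M[K]_(#|J|, m) := \matrix_(x, i) d (enum_val x) i.
have E : C *m Gr *m D^T = 1%:M.
  apply/matrixP => x y; rewrite [RHS]mxE -(inj_eq enum_val_inj) -SFG cE dE.
  rewrite (functional_sum _ _ (Sr _)) mxE.
  under eq_bigr => l _ do rewrite [_^T _ _]mxE mxE mulr_suml.
  rewrite exchange_big /=; apply: eq_bigr => i _.
  rewrite (functionalZ _ _ (Sr _)) (functional_sum _ _ (Sl _)) mulr_sumr; apply: eq_bigr => l _.
  by rewrite (functionalZ _ _ (Sl _)) !mxE; ring.
rewrite -[leqLHS](mxrank1 K) -E; apply: leq_trans (mxrankM_maxl _ _) _; exact: mxrankM_maxr.
Qed.

End Subspaces.

(** * The ideal of the partial derivatives *)

Section GermIdeal.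
Variables (R : realType) (k : nat) (p : 'rV[R[i]]_k) (h : 'I_k -> 'rV[R[i]]_k -> R[i]).
Local Notation I := (germ_ideal p h).
Implicit Types (f g u : 'rV[R[i]]_k -> R[i]^o).

Lemma germ_ideal_ext u v : (\forall q \near p, u q = v q) -> I u -> I v.
Proof.
move=> uv [g [gp ug]]; exists g; split=> //; near=> q.
by have <- : u q = v q; near: q.
Unshelve. all: by end_near. Qed.

Lemma germ_ideal_subspace : subspace (I : set ('rV[R[i]]_k -> R[i]^o)).
Proof.
split=> [|c u v [g [gp ug]] [g' [gp' vg]]].
  exists (fun _ _ => 0); split=> [i|]; first exact: holomorphic_cst.
  by near=> q; rewrite big1// => i _; rewrite mul0r.
Unshelve. 2: by end_near.
exists (fun i t => c * g i t + g' i t); split=> [i|].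
  by apply: holomorphicD => //; apply: holomorphicZ.
near=> q; rewrite -[LHS]/(c * u q + v q).
have -> : u q = \sum_i g i q * h i q by near: q.
have -> : v q = \sum_i g' i q * h i q by near: q.
by rewrite mulr_sumr -big_split; apply: eq_bigr => i _ /=; ring.
Unshelve. all: by end_near. Qed.

Lemma germ_idealM f u : holomorphic_near p f -> I u -> I (fun t => f t * u t).
Proof.
move=> fp [g [gp ug]]; exists (fun i t => f t * g i t); split=> [i|]; first exact: holomorphicM.
near=> q; have -> : u q = \sum_i g i q * h i q by near: q.
by rewrite mulr_sumr; apply: eq_bigr => i _; rewrite mulrA.
Unshelve. all: by end_near. Qed.

Lemma germ_ideal_gen i : I (h i).
Proof.
exists (fun j _ => (j == i)%:R); split=> [j|]; first exact: holomorphic_cst.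
near=> q; rewrite (bigD1 i)//= eqxx mul1r big1 ?addr0// => j /negbTE->; exact: mul0r.
Unshelve. all: by end_near. Qed.

Lemma germ_ideal_div f u : holomorphic_near p f -> f p != 0 -> I (fun t => f t * u t) -> I u.
Proof.
move=> fp fp0 /(germ_idealM (holomorphicV fp fp0)); apply: germ_ideal_ext.
have fn := holomorphic_neq0 fp fp0; near=> q.
have f0 : f q != 0 by near: q.
by rewrite mulrA mulVf// mul1r.
Unshelve. all: by end_near. Qed.

End GermIdeal.

Lemma common_radius (R : realType) (J : finType) (P : J -> R -> Prop) :
  (forall j, exists2 r0 : R, 0 < r0 & forall r, r <= r0 -> P j r) ->
  exists2 r0 : R, 0 < r0 & forall r, r <= r0 -> forall j, P j r.
Proof.
move=> PJ; suff [r0 r00 H] : exists2 r0 : R, 0 < r0 & forall r, r <= r0 -> forall j, j \in enum J -> P j r.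
  by exists r0 => // r /H Pr j; apply: Pr; rewrite mem_enum.
elim: (enum J) => [|j s [r1 r10 IHs]]; first by exists 1.
have [r2 r20 Pj] := PJ j; exists (Num.min r1 r2) => [|r]; first by rewrite lt_min r10.
rewrite le_min => /andP[/IHs Ps /Pj Pr] j'; rewrite in_cons => /orP[/eqP->//|]; exact: Ps.
Qed.

Section PowerSums.
Variables (R : realType) (n k : nat) (b : 'M[R[i]]_(n, k)) (z : 'rV[R[i]]_n).
Local Notation f := (faff b z).
Local Notation U := (arr_compl b z).

(** The partial derivatives of the master function and all their derivatives have
    this form, which makes the symmetry of the second derivatives visible. *)
Definition power_sum (c : 'I_n -> R[i]) (e : nat) (t : 'rV[R[i]]_k) : R[i] :=
  \sum_j c j * (f j t)^-1 ^+ e.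

Lemma has_gradientM (g g' : 'rV[R[i]]_k -> R[i]^o) q d d' :
  has_gradient g q d -> has_gradient g' q d' ->
  has_gradient (fun t => g t * g' t) q (fun l => d l * g' q + g q * d' l).
Proof.
move=> /gradient_differentiable[dg Dg] /gradient_differentiable[dg' Dg'].
have := differentiable_gradient (differentiableM dg dg'); congr (has_gradient _ _ _); apply/funext => l.
rewrite deriveM; [|exact: diff_derivable..].
by rewrite Dg Dg' !pairing_delta addrC; congr (_ + _); exact: mulrC.
Qed.

Lemma inverse_power_gradient j e q : f j q != 0 ->
  has_gradient (fun t => (f j t)^-1 ^+ e) q (fun l => - e%:R * (f j q)^-1 ^+ e.+1 * b j l).
Proof.
move=> fq0; have [df Ef] := gradient_differentiable (f := f j) (@faff_gradient R n k b z j q).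
have V1 : has_gradient (fun t => (f j t)^-1) q (fun l => - (f j q)^-1 ^+ 2 * b j l).
  have := differentiable_gradient (differentiableV df fq0); congr (has_gradient _ _ _); apply/funext => l.
  rewrite deriveV//; last exact: diff_derivable.
  by rewrite Ef pairing_delta exprVn.
elim: e => [|e IHe].
  have := has_gradient_cst 1 q; congr (has_gradient _ _ _).
  by apply/funext => l; rewrite oppr0 !mul0r.
have := has_gradientM V1 IHe; congr (has_gradient _ _ _); apply/funext => t; first by rewrite exprS.
by rewrite -natr1 !exprS expr0; ring.
Qed.

Lemma power_sum_gradient c e q : U q ->
  has_gradient (power_sum c e) q (fun l => power_sum (fun j => - e%:R * c j * b j l) e.+1 q).
Proof.
move=> qU; have := has_gradient_sum c (fun j => inverse_power_gradient e (qU j)).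
congr (has_gradient _ _ _); apply/funext => l; apply: eq_bigr => j _; ring.
Qed.

Lemma regular_power_sum c e : regular b z (power_sum c e).
Proof.
move=> p pU; have nU := arr_compl_open pU; near=> q.
have qU : U q by near: q.
exact: (proj1 (gradient_differentiable (power_sum_gradient c e qU))).
Unshelve. all: by end_near. Qed.

Lemma power_sum_hol11 p c e : U p -> exists2 r0 : R, 0 < r0 & forall r, r <= r0 ->
  hol11 [set x | vabs x <= r] (fun x => power_sum c e (p + x))
    (fun l x => power_sum (fun j => - e%:R * c j * b j l) e.+1 (p + x)).
Proof.
move=> pU; have [r1 r10 H] := near_hol11 (regular_power_sum c e pU).
have /near_vabsP[r2 r20 rU] := arr_compl_open pU.
exists (Num.min r1 (r2 / 2)) => [|r]; first by rewrite lt_min r10 divr_gt0.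
rewrite le_min => /andP[/H Hr rr2]; apply: C11_ext Hr _ => x y [/= xr _ _]; split=> //.
have xU : U (p + x) by apply: rU; rewrite addrC addKr; lra.
apply: eq_bigr => l _; congr (_ * _).
by rewrite /partial (proj2 (gradient_differentiable (power_sum_gradient c e xU))) pairing_delta.
Qed.

Variable a : 'I_n -> R[i].
Local Notation h := (dmaster b a z).

Lemma dmaster_power_sum i t : h i t = power_sum (fun j => a j * b j i) 1 t.
Proof. by apply: eq_bigr => j _; rewrite expr1 mulrA. Qed.

(** As the partial derivatives vanish at [p], the matrix [bezout p _] sends the
    coordinates centred at [p] to them. *)
Lemma det_bezout_notin p : (0 < k)%N -> U p -> (forall i, h i p = 0) ->
  (\forall q \near p, (forall i, h i q = 0) -> q = p) ->
  ~ germ_ideal p h (fun t => \det (bezout b a z p t)).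
Proof.
move=> k0 pU hp iso [g [gp gE]].
have [rg rg0 gH] := common_radius (fun i => near_hol11 (gp i)).
pose cB i l := fun j => - (a j * (f j p)^-1 * b j i * b j l).
have [rB rB0 BH] := common_radius (fun i => common_radius (fun l => power_sum_hol11 (cB i l) 1 pU)).
pose c0 i := fun j => a j * b j i.
pose c1 i l := fun j => - 1%:R * c0 i j * b j l.
pose c2 i l m := fun j => - 2%:R * c1 i l j * b j m.
have [r1 r10 H1] := common_radius (fun i => power_sum_hol11 (c0 i) 1 pU).
have [r2 r20 H2] := common_radius (fun i => common_radius (fun l => power_sum_hol11 (c1 i l) 2 pU)).
have /near_vabsP[r3 r30 rU] := arr_compl_open pU.
have /near_vabsP[r4 r40 riso] := iso.
have /near_vabsP[r5 r50 rgE] := gE.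
pose r := Num.min (Num.min (Num.min rg rB) (Num.min r1 r2)) (Num.min (r3 / 2) (Num.min (r4 / 2) (r5 / 2))).
have r0 : 0 < r by rewrite !lt_min rg0 rB0 r10 r20 !divr_gt0.
have : r <= r by [].
rewrite {2}/r !le_min => /andP[/andP[/andP[rrg rrB] /andP[rr1 rr2]] /andP[rr3 /andP[rr4 rr5]]].
have inball s x : r <= s / 2 -> 0 < s -> vabs x <= r -> vabs (p + x - p) < s.
  by move=> rs s0 xr; rewrite addrC addKr; lra.
have xU x : vabs x <= r -> U (p + x) by move=> xr; apply/rU/inball.
pose B i l x := power_sum (cB i l) 1 (p + x).
have BE i l x : B i l x = bezout b a z p (p + x) i l.
  by rewrite mxE; apply: eq_bigr => j _; rewrite expr1 /cB invfM; ring.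
have hE i x : vabs x <= r -> \sum_l B i l x * x 0 l = h i (p + x).
  move=> xr; rewrite -[RHS]subr0 -[X in _ = _ - X](hp i) (bezoutP a i pU (xU x xr)); apply: eq_bigr => l _.
  by rewrite BE [p + x - p]addrC addKr.
have hH i : hol11 [set x | vabs x <= r] (fun x => \sum_l B i l x * x 0 l)
    (fun l x => power_sum (c1 i l) 2 (p + x)).
  by apply: C11_ext (H1 r rr1 i) _ => x y [/= xr yr _]; rewrite !hE// !dmaster_power_sum.
apply: (det_notin_ideal k0 r0 (BH r rrB) hH (H2 r rr2) _ (gH r rrg)) => [i l m x|x xr hx|x xr].
- by apply: eq_bigr => j _; congr (_ * _); rewrite /c2 /c1; ring.
- have : p + x = p by apply: riso => [|i]; [apply: inball|rewrite -hE// hx].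
  by rewrite -[in RHS](addr0 p) => /addrI.
- have <- : bezout b a z p (p + x) = \matrix_(i, l) B i l x by apply/matrixP => i l; rewrite [RHS]mxE BE.
  rewrite rgE; last by apply: inball.
  by apply: eq_bigr => i _; rewrite hE.
Qed.

End PowerSums.

(** * The local algebra at a critical point *)

Section Words.
Variables (R : realType) (k : nat) (p : 'rV[R[i]]_k).

Definition monomial (w : seq 'I_k) (t : 'rV[R[i]]_k) : R[i] := \prod_(l <- w) (t - p) 0 l.

Fixpoint words j : seq (seq 'I_k) :=
  if j is j'.+1 then [seq l :: w | l <- enum 'I_k, w <- words j'] else [:: [::]].

Fixpoint words_below j : seq (seq 'I_k) :=
  if j is j'.+1 then words_below j' ++ words j' else [::].

Lemma size_words j w : w \in words j -> size w = j.
Proof.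
elim: j w => [|j IHj] w /=; first by rewrite inE => /eqP->.
by move=> /allpairsP[[l w'] [_ /IHj <- ->]].
Qed.

Lemma size_words_below j w : w \in words_below j -> (size w < j)%N.
Proof.
elim: j => //= j IHj; rewrite mem_cat => /orP[/IHj|/size_words->//]; exact: ltnW.
Qed.

Lemma monomial_cons l w t : monomial (l :: w) t = (t - p) 0 l * monomial w t.
Proof. by rewrite /monomial big_cons. Qed.

Lemma monomial_nseq m l t : monomial (nseq m l) t = (t - p) 0 l ^+ m.
Proof. by elim: m => [|m IHm]; rewrite ?monomial_cons ?IHm ?exprS// /monomial big_nil. Qed.

Lemma holomorphic_monomial w q : holomorphic_near q (monomial w).
Proof.
apply: holomorphic_prod => l.
have := holomorphicD (holomorphic_coord q l) (holomorphic_cst q ((q - p) 0 l)).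
by apply: holomorphic_ext; apply/near_vabsP; exists 1 => // t _; rewrite !mxE addrA subrK.
Qed.

Lemma holomorphicX (g : 'rV[R[i]]_k -> R[i]^o) m : holomorphic_near p g ->
  holomorphic_near p (fun t => g t ^+ m).
Proof.
move=> gp; elim: m => [|m IHm]; first exact: holomorphic_cst.
by under eq_fun do rewrite exprS; apply: holomorphicM.
Qed.

(** Hadamard's lemma is applied to the coefficients of the previous remainder. *)
Lemma taylor (g : 'rV[R[i]]_k -> R[i]^o) j : holomorphic_near p g ->
  exists (c : seq 'I_k -> R[i]) (G : seq 'I_k -> 'rV[R[i]]_k -> R[i]^o),
    (forall w, holomorphic_near p (G w)) /\
    \forall t \near p, g t = \sum_(w <- words_below j) c w * monomial w t +
                             \sum_(w <- words j) monomial w t * G w t.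
Proof.
move=> gp; elim: j => [|j [c [G [Gp gE]]]].
  exists (fun=> 0), (fun=> g); split=> //; apply/near_vabsP; exists 1 => // t _.
  by rewrite big_nil big_seq1 /monomial big_nil add0r mul1r.
have /choice[q qP] : forall w, exists q : 'I_k -> 'rV[R[i]]_k -> R[i]^o, (forall l, holomorphic_near p (q l)) /\
    \forall x \near p, G w x = G w p + \sum_l (x - p) 0 l * q l x.
  by move=> w; have [q q1 q2] := hadamard (Gp w); exists q.
exists (fun w => if w \in words j then G w p else c w).
exists (fun w => if w is l :: w' then q w' l else cst 0).
split=> [[|l w]|]; [exact: holomorphic_cst|exact: (proj1 (qP w))|].
have Q : \forall x \near p, forall w : seq_sub (words j),
    G (ssval w) x = G (ssval w) p + \sum_l (x - p) 0 l * q (ssval w) l x.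
  by apply: near_forall => w; exact: (proj2 (qP _)).
near=> t.
have -> : g t = \sum_(w <- words_below j) c w * monomial w t + \sum_(w <- words j) monomial w t * G w t by near: t.
have Qt : forall w : seq_sub (words j),
    G (ssval w) t = G (ssval w) p + \sum_l (t - p) 0 l * q (ssval w) l t by near: t.
rewrite /= big_cat big_allpairs_dep /= -addrA; congr (_ + _).
  rewrite !big_seq; apply: eq_bigr => w /size_words_below wj; case: ifP => // /size_words E.
  by rewrite E ltnn in wj.
rewrite exchange_big -big_split /= !big_seq; apply: eq_bigr => w wj.
rewrite wj (Qt (SeqSub wj)) /= mulrDr [G w p * _]mulrC big_enum /= mulr_sumr; congr (_ + _).
by apply: eq_bigr => l _; rewrite monomial_cons mulrAC mulrA [_ * monomial w t]mulrC mulrA.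
Unshelve. all: by end_near. Qed.

(** A long word repeats some letter at least [N] times. *)
Lemma monomial_ideal (h : 'I_k -> 'rV[R[i]]_k -> R[i]) N w :
  (forall l, germ_ideal p h (fun t => (t - p) 0 l ^+ N)) -> (k * N < size w)%N ->
  germ_ideal p h (monomial w).
Proof.
move=> nil wN.
have [l lN] : exists l, (N <= count_mem l w)%N.
  apply: contrapT => none; move: wN; apply/negP; rewrite -leqNgt.
  have -> : size w = \sum_l count_mem l w.
    elim: (w) => [|l w' /= ->]; first by rewrite big1.
    have S1 : (\sum_(l' < k) (l == l') = 1)%N.
      by rewrite (bigD1 l)//= eqxx big1 // => l' /negbTE; rewrite eq_sym => ->.
    by rewrite big_split /= S1.
  apply: (@leq_trans (\sum_(l < k) N)); last by rewrite sum_nat_const card_ord.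
  apply: leq_sum => l _; rewrite leqNgt; apply/negP => /ltnW lN; by apply: none; exists l.
have E t : monomial [seq l' <- w | l' != l] t * (t - p) 0 l ^+ (count_mem l w - N) *
    (t - p) 0 l ^+ N = monomial w t.
  rewrite -mulrA -exprD subnK// /monomial big_filter.
  rewrite [RHS](bigID (pred1 l)) /= mulrC; congr (_ * _).
  rewrite -big_filter -size_filter; elim: w {lN wN} => [|l' w IHw] /=; first by rewrite big_nil.
  case: eqP => [->|//].
  by rewrite big_cons /= exprS IHw.
rewrite (_ : monomial w = fun t => monomial [seq l' <- w | l' != l] t *
  (t - p) 0 l ^+ (count_mem l w - N) * (t - p) 0 l ^+ N); last by apply/funext => t; rewrite E.
apply: germ_idealM (nil l); apply: holomorphicM; first exact: holomorphic_monomial.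
exact: holomorphicX (holomorphic_coord _ _).
Qed.
End Words.

Section Transform.
Variables (R : realType) (n k : nat) (b : 'M[R[i]]_(n, k)).
Variables (a : 'I_n -> R[i]) (z : 'rV[R[i]]_n) (p : 'rV[R[i]]_k).
Local Notation U := (arr_compl b z).
Local Notation h := (dmaster b a z).
Local Notation I := (germ_ideal p h).
Local Notation coef := (omega_coef b z).
Hypothesis pU : U p.
Implicit Types phi : 'rV[R[i]]_k -> R[i]^o.

(** Up to the sign [(-1) ^+ k], the result of applying [ell] in the first variable
    to [phi] times the determinant of the Bezoutian.  This formula shows that the
    values are combinations of the [omega_coef s]. *)
Definition bezout_transform (ell : ('rV[R[i]]_k -> R[i]^o) -> R[i]) phi : 'rV[R[i]]_k -> R[i]^o :=
  fun y => \sum_(s : k.-tuple 'I_n | increasing s)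
    (\prod_(j <- s) a j) * ell (fun x => phi x * coef s x) * coef s y.

Variable ell : ('rV[R[i]]_k -> R[i]^o) -> R[i].
Hypothesis ell_lin : functional ell.
Hypothesis ell_I : forall u, I u -> ell u = 0.
Local Notation T := (bezout_transform ell).

Let Isub := germ_ideal_subspace p h.

Lemma transform_regular phi : regular b z (T phi).
Proof.
move=> q qU; apply: holomorphic_sum => s; apply: holomorphicZ; exact: regular_omega_coef.
Qed.

Lemma functional_near u v : (\forall t \near p, u t = v t) -> ell u = ell v.
Proof.
move=> uv; apply/eqP; rewrite -subr_eq0 -functionalB//; apply/eqP/ell_I.
apply: germ_ideal_ext (proj1 Isub); near=> t.
by rewrite -[RHS]/(u t - v t) (_ : u t = v t) ?subrr//; near: t.
Unshelve. all: by end_near. Qed.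

Lemma transform_det phi y : T phi y =
  (-1) ^+ k * ell (fun x => phi x * \det (bezout b a z x y)).
Proof.
have -> : (fun x => phi x * \det (bezout b a z x y)) =
  \sum_(s : k.-tuple 'I_n | increasing s)
    ((-1) ^+ k * (\prod_(j <- s) a j) * coef s y) *: (fun x => phi x * coef s x : R[i]^o).
  apply/funext => x; rewrite fct_sumE det_bezout !mulr_sumr; apply: eq_bigr => s _.
  rewrite -[RHS]/(_ * (phi x * coef s x)); ring.
rewrite /T big_mkcond [X in ell X]big_mkcond functional_sum// mulr_sumr; apply: eq_bigr => s _.
case: ifP => _; last by rewrite functional0// mulr0.
rewrite (functionalZ _ _ ell_lin); move: (coef s y) (ell _) (\prod_(j <- s) a j) => c e P.
by rewrite !mulrA -expr2 sqrr_sign mul1r mulrAC.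
Qed.

(** Modulo the ideal at [q] the terms [h i y] disappear, and [ell] kills the terms
    [h i x] because they are in the ideal at [p]. *)
Lemma transform_shift phi l q : holomorphic_near p phi -> U q ->
  germ_ideal q h (fun y => (y - p) 0 l * T phi y - T (fun x => (x - p) 0 l * phi x) y).
Proof.
move=> phip qU.
pose adj x y i := (\adj (bezout b a z x y)) l i.
have /choice[G GP] : forall i, exists G : 'rV[R[i]]_k -> R[i]^o, [/\ regular b z G,
    forall y, ell (fun x => phi x * adj x y i) = G y &
    forall y, ell (fun x => phi x * adj x y i * h i x) = 0].
  move=> i; have [m [A [B [rA rB AB]]]] := separated_adj b a z l i.
  exists (fun y => \sum_j ell (fun x => phi x * A j x) * B j y); split.
  - by move=> q' q'U; apply: holomorphic_sum => j; apply: holomorphicZ; apply: rB.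
  - move=> y; rewrite (_ : (fun x => _) = \sum_j B j y *: (fun x => phi x * A j x : R[i]^o)).
      by rewrite functional_sum//; apply: eq_bigr => j _; rewrite (functionalZ _ _ ell_lin) mulrC.
    apply/funext => x; rewrite fct_sumE /adj AB mulr_sumr; apply: eq_bigr => j _.
    by rewrite -[RHS]/(B j y * (phi x * A j x)) mulrA mulrC.
  - move=> y; apply: ell_I; have [_ I_lin] := Isub.
    rewrite (_ : (fun x => _) = \sum_j B j y *: (fun x => (phi x * A j x) * h i x : R[i]^o)).
      apply: subspace_sum => // j; apply: subspaceZ => //; apply: germ_idealM; last exact: germ_ideal_gen.
      by apply: holomorphicM => //; apply: rA.
    apply/funext => x; rewrite fct_sumE /adj AB mulrAC mulr_sumr; apply: eq_bigr => j _.
    by rewrite -[RHS]/(B j y * (phi x * A j x * h i x)); ring.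
exists (fun i y => (-1) ^+ k * G i y); split=> [i|].
  by apply: holomorphicZ; have [rG _ _] := GP i; apply: rG.
have nU := arr_compl_open qU; near=> y; have yU : U y by near: y.
rewrite !transform_det mulrCA -mulrBr -(functionalZ _ _ ell_lin) -(functionalB _ _ ell_lin).
under eq_bigr => i _ do rewrite -mulrA.
rewrite -mulr_sumr; congr (_ * _).
transitivity (ell (\sum_i (h i y *: (fun x => phi x * adj x y i : R[i]^o) -
    (fun x => phi x * adj x y i * h i x)))).
  apply: functional_near; have nUp := arr_compl_open pU; near=> x.
  rewrite fct_sumE -[LHS]/((y - p) 0 l * (phi x * \det (bezout b a z x y)) -
    (x - p) 0 l * phi x * \det (bezout b a z x y)).
  have xU : U x by near: x.
  transitivity (phi x * ((y - x) 0 l * \det (bezout b a z x y))); first by rewrite !mxE; ring.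
  rewrite coord_det_bezout// mulr_sumr; apply: eq_bigr => i _.
  rewrite -[RHS]/(h i y * (phi x * adj x y i) - phi x * adj x y i * h i x) /adj; ring.
rewrite functional_sum//; apply: eq_bigr => i _.
have [_ G1 G2] := GP i.
by rewrite (functionalB _ _ ell_lin) (functionalZ _ _ ell_lin) G1 G2 subr0 mulrC.
Unshelve. all: by end_near. Qed.

Lemma transform_ideal phi y : I phi -> T phi y = 0.
Proof.
move=> Iphi; rewrite /T big1// => s _; rewrite ell_I ?mulr0 ?mul0r//.
under eq_fun do rewrite mulrC; apply: germ_idealM Iphi; exact: regular_omega_coef.
Qed.

Lemma transform_monomial w phi q : holomorphic_near p phi -> U q ->
  germ_ideal q h (fun y => monomial p w y * T phi y - T (fun x => monomial p w x * phi x) y).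
Proof.
move=> phip qU; have Js := germ_ideal_subspace q h; elim: w => [|l w IHw].
  apply: germ_ideal_ext (proj1 Js); apply/near_vabsP; exists 1 => // y _.
  rewrite /monomial big_nil mul1r (_ : (fun x => _) = phi) ?subrr//.
  by apply/funext => x; rewrite big_nil mul1r.
have wphi : holomorphic_near p (fun x => monomial p w x * phi x).
  by apply: holomorphicM => //; apply: holomorphic_monomial.
have := subspaceD Js (germ_idealM (holomorphic_monomial p [:: l] q) IHw) (transform_shift l wphi qU).
congr (germ_ideal _ _ _); apply/funext => y.
rewrite -[LHS]/(monomial p [:: l] y * (monomial p w y * T phi y - T (fun x => monomial p w x * phi x) y) +
  ((y - p) 0 l * T (fun x => monomial p w x * phi x) y -
   T (fun x => (x - p) 0 l * (monomial p w x * phi x)) y)).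
rewrite (_ : (fun x => (x - p) 0 l * _) = fun x => monomial p (l :: w) x * phi x); last first.
  by apply/funext => x; rewrite monomial_cons mulrA.
have -> : monomial p [:: l] y = (y - p) 0 l by rewrite /monomial big_seq1.
rewrite monomial_cons; ring.
Qed.

Hypothesis ell_det : ell (fun x => \det (bezout b a z p x)) = 1.

(* The function [u] is a unit at [p]: up to sign its value is that of [ell] on the
   determinant of the Bezoutian. *)
Let u := T (fun=> 1).

Let u_neq0 : u p != 0.
Proof.
rewrite /u transform_det; under eq_fun do rewrite mul1r bezoutC.
by rewrite ell_det mulr1 signr_eq0.
Qed.

Let up : holomorphic_near p u. Proof. exact: transform_regular. Qed.

(** The transforms of the powers of a coordinate lie in a space of finite
    dimension, so that the transform of some nonzero polynomial [P] of the
    coordinate is zero.  Then [P] times the unit [u] is in the ideal, and the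
    factor of [P] which does not vanish at [p] is a unit as well. *)
Lemma coord_nilpotent l : exists m, I (monomial p (nseq m l)).
Proof.
pose N := #|{: k.-tuple 'I_n}|.
pose M : 'M[R[i]]_(N.+1, N) :=
  \matrix_(m, s) ell (fun x => monomial p (nseq m l) x * 1 * coef (enum_val s) x).
have [c cM c0] : exists2 c : 'rV_N.+1, c *m M = 0 & c != 0.
  have : kermx M != 0 by rewrite kermx_eq0 /row_free; apply: contraTneq (rank_leq_col M) => ->; rewrite ltnn.
  by case/rowV0Pn => c; rewrite sub_kermx => /eqP cM c0; exists c.
pose P := \poly_(m < N.+1) c 0 (inord m).
have P0 : P != 0.
  apply: contraNneq c0 => P0; apply/eqP/rowP => m; have := coef_poly N.+1 (fun m => c 0 (inord m)) m.
  by rewrite ltn_ord inord_val -/P P0 coef0 mxE.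
have IP : I (fun t => P.[(t - p) 0 l]).
  apply: (germ_ideal_div up u_neq0).
  have := subspace_sum (index_enum 'I_N.+1) (F := fun m t => c 0 m * (monomial p (nseq m l) t * u t -
    T (fun x => monomial p (nseq m l) x * 1) t)) Isub.
  move=> H; have {H} := H (fun m => subspaceZ (c 0 m) Isub (transform_monomial (nseq m l) (holomorphic_cst _ _) pU)).
  congr (germ_ideal _ _ _); apply/funext => t; rewrite fct_sumE.
  under eq_bigr => m _ do rewrite mulrBr.
  rewrite sumrB [X in _ - X](_ : _ = 0) ?subr0.
    rewrite horner_poly mulr_sumr; apply: eq_bigr => m _; rewrite inord_val monomial_nseq; ring.
  rewrite /T; under eq_bigr => m _ do rewrite mulr_sumr.
  rewrite exchange_big big1// => s _.
  transitivity ((\prod_(j <- s) a j) * coef s t * (c *m M) 0 (enum_rank s)); last by rewrite cM mxE mulr0.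
  rewrite mxE mulr_sumr; apply: eq_bigr => m _; rewrite mxE enum_rankK; ring.
have [m [Q Q0 PE]] := multiplicity_XsubC P 0.
exists m; apply: (@germ_ideal_div _ _ _ _ (fun t => Q.[(t - p) 0 l])).
- have : holomorphic_near p (fun t => \sum_(j < size Q) Q`_j * monomial p (nseq j l) t).
    by apply: holomorphic_sum => j; apply: holomorphicZ; apply: holomorphic_monomial.
  congr (holomorphic_near _ _); apply/funext => t; rewrite horner_coef.
  by apply: eq_bigr => j _; rewrite monomial_nseq.
- by rewrite subrr mxE; move: Q0; rewrite P0.
- move: IP; congr (germ_ideal _ _ _); apply/funext => t.
  by rewrite PE monomial_nseq !hornerE subr0.
Qed.

(** A power of some coordinate is in the ideal at [p], hence is transformed to
    zero, but is a unit at [q]. *)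
Lemma transform_elsewhere phi q : holomorphic_near p phi -> U q -> q != p ->
  germ_ideal q h (T phi).
Proof.
move=> phip qU qp.
have [l ql] : exists l, (q - p) 0 l != 0.
  apply: contrapT => none; case/negP: qp; rewrite -subr_eq0; apply/eqP/rowP => l; rewrite [RHS]mxE.
  by apply/eqP; apply: contraPT isT => ql _; apply: none; exists l.
have [m Im] := coord_nilpotent l.
apply: (germ_ideal_div (f := monomial p (nseq m l))) (holomorphic_monomial _ _ _) _ _.
  by rewrite monomial_nseq expf_neq0.
have := transform_monomial (nseq m l) phip qU; congr (germ_ideal _ _ _); apply/funext => y.
rewrite [X in _ - X]transform_ideal ?subr0//.
rewrite (_ : (fun x => _) = fun x => phi x * monomial p (nseq m l) x); first exact: germ_idealM.
by apply/funext => x; rewrite mulrC.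
Qed.

(** Modulo the ideal, [g / u] is a polynomial [P] in the coordinates by Hadamard's
    lemma and nilpotency, and then [g] is [P * u], the transform of [P]. *)
Lemma transform_span : exists m (phi : 'I_m -> 'rV[R[i]]_k -> R[i]^o),
  (forall j, holomorphic_near p (phi j)) /\
  forall g, holomorphic_near p g -> exists c : 'I_m -> R[i], I (g - \sum_j c j *: T (phi j)).
Proof.
have [N NP] : exists N, forall l, I (fun t => (t - p) 0 l ^+ N).
  have /choice[m mP] := coord_nilpotent; exists (\max_l m l)%N => l.
  rewrite (_ : (fun t => _) = fun t => monomial p (nseq (\max_l m l - m l) l) t * monomial p (nseq (m l) l) t).
    by apply: germ_idealM; first exact: holomorphic_monomial.
  by apply/funext => t; rewrite !monomial_nseq -exprD subnK// leq_bigmax.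
pose W := words_below k (k * N).+1.
exists (size W), (fun j => monomial p (tnth (in_tuple W) j)); split=> [j|g gp].
  exact: holomorphic_monomial.
have [c [G [Gp gE]]] := taylor (k * N).+1 (holomorphicM gp (holomorphicV up u_neq0)).
exists (fun j => c (tnth (in_tuple W) j)).
have un0 := holomorphic_neq0 up u_neq0.
have I1 : I (\sum_(w <- words k (k * N).+1) (fun t => u t * G w t * monomial p w t)).
  rewrite big_seq; apply: (big_ind I) => [|f f' If If'|w wW]; [exact: (proj1 Isub)|exact: subspaceD|].
  apply: germ_idealM; first exact: holomorphicM.
  by apply: monomial_ideal NP _; rewrite (size_words wW).
have I2 : I (\sum_(w <- W) c w *: (fun t => monomial p w t * u t - T (monomial p w) t)).
  apply: subspace_sum => // w; apply: subspaceZ => //.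
  have := transform_monomial w (holomorphic_cst p 1) pU; congr (germ_ideal _ _ _).
  apply/funext => t; congr (_ - T _ t); by apply/funext => x; rewrite mulr1.
apply: germ_ideal_ext (subspaceD Isub I1 I2); near=> t.
have u0 : u t != 0 by near: t.
have gt : g t * (u t)^-1 = \sum_(w <- W) c w * monomial p w t +
   \sum_(w <- words k (k * N).+1) monomial p w t * G w t by near: t.
rewrite -[RHS]/(g t - (\sum_j c (tnth (in_tuple W) j) *: T (monomial p (tnth (in_tuple W) j))) t).
rewrite -(big_tnth _ _ W xpredT (fun w => c w *: T (monomial p w))).
have -> : g t = u t * (g t * (u t)^-1) by rewrite mulrC divfK.
rewrite gt -[LHS]/(_ t + _ t) !fct_sumE mulrDr !mulr_sumr addrC addrAC; congr (_ + _).
  rewrite -sumrB; apply: eq_bigr => w _.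
  change (c w * (monomial p w t * u t - T (monomial p w) t) =
    u t * (c w * monomial p w t) - c w * T (monomial p w) t); ring.
by apply: eq_bigr => w _; ring.
Unshelve. all: by end_near. Qed.

End Transform.

(** * Singular vectors from functionals *)

Section Forms.
Variables (R : realType) (n k : nat) (b : 'M[R[i]]_(n, k)) (z : 'rV[R[i]]_n).
Local Notation U := (arr_compl b z).
Local Notation coef := (omega_coef b z).

(** The recursion defining [wedges] is the expansion of a determinant along its
    first row. *)
Lemma wedges_omega q (s : 'I_q -> 'I_n) (t : U) (v : 'M[R[i]]_(q, k)) :
  wedges (fun i => omega (s i)) t v =
  \det (\matrix_(i, j) glin b (s i) (row j v)) / \prod_i faff b z (s i) (\val t).
Proof.
elim: q s v => [|q IHq] s v; first by rewrite det_mx00 big_ord0 divr1.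
pose s' i := s (lift ord0 i).
transitivity (\sum_(i < q.+1) (-1) ^+ i * omega (s ord0) t (row i v) *
    (\det (\matrix_(i', j) glin b (s' i') (row j (row' i v))) / \prod_i' faff b z (s' i') (\val t))).
  by apply: eq_bigr => i _; congr (_ * _); exact: IHq.
rewrite (expand_det_row _ ord0) [X in _ = _ / X]big_ord_recl invfM mulr_suml; apply: eq_bigr => i _.
rewrite /omega !mxE /cofactor add0n.
rewrite (_ : row' ord0 (col' i _) = \matrix_(i0, j) glin b (s' i0) (row j (row' i v))); last first.
  apply/matrixP => x y; rewrite !mxE; congr (glin _ _ _); apply/rowP => m; by rewrite !mxE.
set D := \det _; set P := \prod_(_ < _) _; set G := glin _ _ _; set E := faff _ _ _ _; ring.
Qed.

Lemma omegasE q (s : q.-tuple 'I_n) (t : U) (v : 'M[R[i]]_(q, k)) : omegas s t v =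
  \det (\matrix_(i, j) glin b (tnth s i) (row j v)) / \prod_i faff b z (tnth s i) (\val t).
Proof. exact: wedges_omega. Qed.

(** Germs are represented by functions on the whole space, whereas forms are
    defined on the complement only. *)
Definition form_at q (v : 'M[R[i]]_(q, k)) (w : diff_form b z q) : 'rV[R[i]]_k -> R[i]^o :=
  fun t => if pselect (U t) is left tU then w (SigSub (mem_set tU)) v else 0.

Lemma form_at_lin q (v : 'M[R[i]]_(q, k)) (c : R[i]) w1 w2 :
  form_at v (c *: w1 + w2) = c *: form_at v w1 + form_at v w2.
Proof.
apply/funext => t; rewrite -[RHS]/(c * form_at v w1 t + form_at v w2 t) /form_at.
by case: pselect => tU //; rewrite mulr0 addr0.
Qed.

Lemma form_at_sum q (v : 'M[R[i]]_(q, k)) (J : Type) (r : seq J) (c : J -> R[i]) w :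
  form_at v (\sum_(j <- r) c j *: w j) = \sum_(j <- r) c j *: form_at v (w j).
Proof.
elim: r => [|j r IHr].
  by rewrite !big_nil; apply/funext => t; rewrite /form_at; case: pselect.
by rewrite !big_cons form_at_lin IHr.
Qed.

Lemma form_at_omegas q (s : q.-tuple 'I_n) v t : U t -> form_at v (omegas s) t =
  \det (\matrix_(i, j) glin b (tnth s i) (row j v)) / \prod_i faff b z (tnth s i) t.
Proof. by move=> tU; rewrite /form_at; case: pselect => // tU'; rewrite omegasE. Qed.

Lemma form_at_coef (s : k.-tuple 'I_n) t : U t -> form_at 1%:M (omegas s) t = coef s t.
Proof.
move=> tU; rewrite form_at_omegas// /omega_coef /minor; congr (\det _ / _).
apply/matrixP => i j; rewrite !mxE /glin (bigD1 j)//= !mxE eqxx mulr1 big1 ?addr0// => l lj.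
by rewrite !mxE eq_sym (negbTE lj) mulr0.
Qed.

Lemma holomorphic_form_at q (v : 'M[R[i]]_(q, k)) w p : OS w -> U p ->
  holomorphic_near p (form_at v w).
Proof.
move=> [c ->] pU; rewrite form_at_sum.
have : holomorphic_near p (fun t => \sum_s c s * form_at v (omegas s) t).
  apply: holomorphic_sum => s; apply: holomorphicZ.
  have : holomorphic_near p (fun t => \det (\matrix_(i, j) glin b (tnth s i) (row j v)) *
      (\prod_i faff b z (tnth s i) t)^-1).
    apply: holomorphicZ; apply: holomorphicV.
      by apply: holomorphic_prod => i; apply: holomorphic_faff.
    by apply/prodf_neq0 => i _; apply: pU.
  apply: holomorphic_ext; have pU' := arr_compl_open pU; near=> t.
  by rewrite form_at_omegas//; near: t.
by congr (holomorphic_near _ _); apply/funext => t; rewrite fct_sumE.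
Unshelve. all: by end_near. Qed.

Lemma OS_lin q (c : R[i]) (w1 w2 : diff_form b z q) : OS w1 -> OS w2 -> OS (c *: w1 + w2).
Proof.
move=> [c1 ->] [c2 ->]; exists (fun s => c * c1 s + c2 s).
rewrite scaler_sumr -big_split; apply: eq_bigr => s _ /=.
by rewrite scalerA -scalerDl.
Qed.

Lemma OS_omegas q (s : q.-tuple 'I_n) : OS (omegas (b := b) (z := z) s).
Proof.
exists (fun s' => (s' == s)%:R); rewrite (bigD1 s)//= eqxx scale1r big1 ?addr0// => s' /negbTE->.
exact: scale0r.
Qed.

Variable a : 'I_n -> R[i].
Local Notation h := (dmaster b a z).

(** The value of [nu] on the [i]-th unit vector is the [i]-th partial derivative of
    the master function. *)
Lemma form_at_nu_wedge (eta : diff_form b z k.-1) t : U t ->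
  form_at 1%:M (wedge1 (@nu R n k b a z) eta) t =
  \sum_(i < k) (-1) ^+ i * form_at (row' i 1%:M) eta t * h i t.
Proof.
move=> tU; rewrite /form_at; case: pselect => // tU'; apply: eq_bigr => i _.
rewrite mulrAC; congr (_ * _ * _).
have -> : forall v, @nu R n k b a z (SigSub (mem_set tU')) v =
    \sum_j a j * omega j (SigSub (mem_set tU')) v.
  by move=> v; rewrite /nu; elim/big_ind2: _ => // x1 x2 y1 y2 <- <-.
apply: eq_bigr => j _; rewrite /omega /=; congr (_ * (_ / _)).
rewrite /glin (bigD1 i)//= !mxE eqxx mulr1 big1 ?addr0// => l li.
by rewrite !mxE eq_sym (negbTE li) mulr0.
Qed.

Variables (p : 'rV[R[i]]_k) (ell : ('rV[R[i]]_k -> R[i]^o) -> R[i]).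
Hypotheses (pU : U p) (ell_lin : functional ell).
Hypothesis ell_I : forall u, germ_ideal p h u -> ell u = 0.

Definition form_functional (phi : 'rV[R[i]]_k -> R[i]^o) (w : diff_form b z k) : R[i]^o :=
  if pselect (OS w) then ell (fun t => phi t * form_at 1%:M w t) else 0.

Lemma form_functionalE phi w : OS w ->
  form_functional phi w = ell (fun t => phi t * form_at 1%:M w t).
Proof. by rewrite /form_functional; case: (pselect (OS w)). Qed.

(** The coefficient of [nu] wedge any form is a combination of the partial
    derivatives of the master function, hence is in the ideal. *)
Lemma form_functional_sing phi : holomorphic_near p phi ->
  sing_space a (form_functional phi).
Proof.
move=> phip; split; first split.
- move=> c w1 w2 w1O w2O; rewrite !form_functionalE//; last exact: OS_lin.
  rewrite -ell_lin; congr ell; apply/funext => t.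
  rewrite form_at_lin -[RHS]/(c * (phi t * form_at 1%:M w1 t) + phi t * form_at 1%:M w2 t).
  rewrite -[X in phi t * X]/(c * form_at 1%:M w1 t + form_at 1%:M w2 t); ring.
- by move=> w wO; rewrite /form_functional; case: (pselect (OS _)).
- move=> eta etaO; have [wO|nO] := pselect (OS (wedge1 (@nu R n k b a z) eta)); last first.
    by rewrite /form_functional; case: (pselect (OS _)).
  rewrite form_functionalE//.
  apply: ell_I; apply: germ_idealM => //.
  exists (fun (i : 'I_k) t => (-1) ^+ i * form_at (row' i 1%:M) eta t); split=> [i|].
    by apply: holomorphicZ; apply: holomorphic_form_at.
  have pU' := arr_compl_open pU; near=> t.
  by rewrite form_at_nu_wedge//; near: t.
Unshelve. all: by end_near. Qed.

Lemma form_functional_omegas phi s :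
  form_functional phi (omegas s) = ell (fun t => phi t * coef s t).
Proof.
rewrite form_functionalE; last exact: OS_omegas.
apply: (functional_near ell_lin ell_I); have pU' := arr_compl_open pU; near=> t.
by rewrite form_at_coef//; near: t.
Unshelve. all: by end_near. Qed.

End Forms.

(** * Milnor numbers and the rank of the contravariant form *)

Section LocalBasis.
Variables (R : realType) (n k : nat) (b : 'M[R[i]]_(n, k)).
Variables (a : 'I_n -> R[i]) (z : 'rV[R[i]]_n).
Local Notation U := (arr_compl b z).
Local Notation h := (dmaster b a z).
Local Notation form_space := (diff_form b z k -> R[i]^o).
Local Notation form := (contravariant_form (b := b) (z := z) a (p := k)).

(** Lying in the ideals of the other points is what makes the bases at different
    critical points orthogonal in the final duality. *)
Lemma local_basis p : (0 < k)%N -> isolated_critical b a z p ->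
  exists m (phi : 'I_m -> 'rV[R[i]]_k -> R[i]^o) ell,
    [/\ functional ell, forall u, germ_ideal p h u -> ell u = 0,
        forall j, holomorphic_near p (phi j),
        basis_mod (holomorphic_near p) (germ_ideal p h)
          (fun j => bezout_transform b a z ell (phi j)) &
        forall j q, U q -> q != p -> germ_ideal q h (bezout_transform b a z ell (phi j))].
Proof.
move=> k0 /isolated_critical_zero[pU _ hp iso].
have Is := germ_ideal_subspace p h.
have [ell [ell_lin ell_I ell_det]] := separating_functional Is (det_bezout_notin k0 pU hp iso).
have [m [phi [phip span]]] := transform_span pU ell_lin ell_I ell_det.
have Tp j : holomorphic_near p (bezout_transform b a z ell (phi j)) by exact: transform_regular.
have [m' [f basis]] := basis_of_spanning Is Tp span.
exists m', (phi \o f), ell; split=> // [j|j q qU qp]; first exact: phip.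
exact: (transform_elsewhere pU ell_lin ell_I ell_det (phip _) qU qp).
Qed.

Lemma germ_ideal_congr p (d d' : 'I_k -> 'rV[R[i]]_k -> R[i]) :
  (\forall q \near p, forall i, d i q = d' i q) -> germ_ideal p d `<=` germ_ideal p d'.
Proof.
move=> E u [g [gp gE]]; exists g; split=> //; near=> q.
have -> : u q = \sum_i g i q * d i q by near: q.
have Eq : forall i, d i q = d' i q by near: q.
by apply: eq_bigr => i _; rewrite Eq.
Unshelve. all: by end_near. Qed.

Lemma germ_ideal_branch p phi : master_branch b a z p phi ->
  germ_ideal p (fun i => partial i phi) = germ_ideal p h.
Proof.
move=> /branch_partial E; apply/seteqP; split; apply: germ_ideal_congr => //.
by apply: filterS E => q E i; rewrite E.
Qed.

Lemma sing_space_subspace : subspace (sing_space a (p := k) : set form_space).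
Proof.
split=> [|c F G [[FL F0] Fnu] [[GL G0] Gnu]].
  by split=> //; split=> // c w1 w2 _ _; rewrite -[RHS]/(c * 0 + 0) mulr0 addr0.
have E w : (c *: F + G) w = c * F w + G w by [].
split; first split.
- by move=> c' w1 w2 w1O w2O; rewrite !E FL// GL//; ring.
- by move=> w wO; rewrite E F0// G0// mulr0 addr0.
- by move=> eta etaO; rewrite E Fnu// Gnu// mulr0 addr0.
Qed.

(** Elements of the flag space are zero outside of [OS], which the [omegas s]
    span. *)
Lemma flag_space_omegas (F : form_space) : flag_space F ->
  (forall s, F (omegas s) = 0) -> F = 0.
Proof.
move=> [FL F0] Fs; apply/funext => w; have [[c ->]|/F0//] := pselect (OS w).
suff [] : OS (\sum_s c s *: omegas (b := b) (z := z) s) /\ F (\sum_s c s *: omegas s) = 0 by [].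
have O0 : OS (0 : diff_form b z k) by exists (fun=> 0); rewrite big1// => s _; rewrite scale0r.
elim: (index_enum _) => [|s r [rO Fr]].
  rewrite big_nil; split=> //; have := FL (-1) 0 0 O0 O0.
  by rewrite scaler0 addr0 mulN1r addNr.
by rewrite big_cons; split; [apply: OS_lin => //; apply: OS_omegas|rewrite FL ?Fs ?Fr ?mulr0 ?addr0//; exact: OS_omegas].
Qed.

Lemma sing_space_basis : exists m (e : 'I_m -> form_space), basis_mod (sing_space a (p := k)) [set 0] e.
Proof.
pose ev (F : form_space) : 'rV[R[i]]_#|{: k.-tuple 'I_n}| := \row_x F (omegas (enum_val x)).
apply: (finite_basis (ev := ev)) => [|c F G|F [Ff _] /rowP F0].
- exact: sing_space_subspace.
- by apply/rowP => x; rewrite !mxE.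
- by apply: flag_space_omegas => // s; have := F0 (enum_rank s); rewrite !mxE enum_rankK.
Qed.

Lemma contravariant_functional F : functional (form F).
Proof.
move=> c G1 G2; rewrite /contravariant_form mulr_sumr -big_split; apply: eq_bigr => s _ /=.
rewrite -[(c *: G1 + G2) _]/(c * G1 _ + G2 _); ring.
Qed.

Lemma contravariantC F G : form F G = form G F.
Proof. by apply: eq_bigr => s _; rewrite mulrAC. Qed.

(** This is where the contravariant form meets the Bezoutian: its sum over
    increasing tuples is the one in [bezout_transform]. *)
Lemma contravariant_form_functional p ell phi q lam : U p -> functional ell ->
  (forall u, germ_ideal p h u -> ell u = 0) -> holomorphic_near p phi -> U q -> functional lam ->
  (forall u, germ_ideal q h u -> lam u = 0) ->
  form (form_functional ell phi) (form_functional lam (fun=> 1)) =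
  lam (bezout_transform b a z ell phi).
Proof.
move=> pU ell_lin ell_I phip qU lam_lin lam_I.
rewrite (_ : bezout_transform b a z ell phi = \sum_(s : k.-tuple 'I_n | increasing s)
    ((\prod_(j <- s) a j) * ell (fun t => phi t * omega_coef b z s t)) *:
      (omega_coef b z s : 'rV[R[i]]_k -> R[i]^o)); last by apply/funext => t; rewrite fct_sumE.
rewrite /contravariant_form big_mkcond [X in lam X]big_mkcond functional_sum//; apply: eq_bigr => s _.
rewrite -[sorted _ _]/(increasing s); case: ifP => _; last by rewrite functional0.
rewrite (functionalZ _ _ lam_lin) (form_functional_omegas pU ell_lin ell_I).
rewrite (form_functional_omegas qU lam_lin lam_I); congr (_ * lam _).
by apply/funext => t; rewrite mul1r.
Qed.

End LocalBasis.

Theorem corollary9p15 (R : realType) (n k : nat)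
  (k_gt0 : (0 < k)%N) (k_lt_n : (k < n)%N)
  (b : 'M[R[i]]_(n, k)) (b_neq0 : forall j, row j b != 0) (b_span : row_full b)
  (a : 'I_n -> R[i]) (a_neq0 : forall j, a j != 0)
  (lam : {set 'I_n} -> 'I_n -> R[i]) (lamP : circuit_coefs b lam)
  (z0 : 'rV[R[i]]_n) (z0P : discriminant b lam z0)
  (d : nat) (p : 'I_d -> 'rV[R[i]]_k) (p_inj : injective p)
  (pP : forall q, isolated_critical b a z0 q <-> exists i, p i = q) :
  exists (mu : 'I_d -> nat) (r : nat),
    [/\ forall i, has_milnor_number b a z0 (p i) (mu i),
        has_form_rank (sing_space a (p := k))
          (contravariant_form (b := b) (z := z0) a (p := k)) r &
        (\sum_i mu i <= r)%N].
Proof.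
have crit i : isolated_critical b a z0 (p i) by apply/pP; exists i.
have pU i : arr_compl b z0 (p i) by have [] := isolated_critical_zero (crit i).
pose T := bezout_transform b a z0.
pose h := dmaster b a z0.
have /choice[mu muP] := fun i => local_basis k_gt0 (crit i).
pose phi i := sval (cid (muP i)).
have /choice[ell ellP] := fun i => svalP (cid (muP i)).
have basis i : basis_mod (holomorphic_near (p i)) (germ_ideal (p i) h) (fun j => T (ell i) (phi i j)).
  by have [] := ellP i.
have dual i (j : 'I_(mu i)) := dual_functional j (germ_ideal_subspace (p i) h) (basis i).
pose lm i j := sval (cid (dual i j)).
have lmP i j : [/\ functional (lm i j), forall u, germ_ideal (p i) h u -> lm i j u = 0 &
    forall j', lm i j (T (ell i) (phi i j')) = (j' == j)%:R] by exact: svalP (cid (dual i j)).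
have [m [e eP]] := sing_space_basis b a z0.
exists mu, (\rank (\matrix_(i, j) contravariant_form a (e i) (e j))); split.
- move=> i; have [_ [br brP] _ _] := isolated_critical_zero (crit i).
  by exists br => //; rewrite (germ_ideal_branch brP); exists (fun j => T (ell i) (phi i j)).
- by exists m, e.
pose J := {i : 'I_d & 'I_(mu i)}.
pose F (x : J) := form_functional (b := b) (z := z0) (ell (tag x)) (phi _ (tagged x)).
pose G (x : J) := form_functional (b := b) (z := z0) (lm _ (tagged x)) (fun=> 1).
have card : #|{: J}| = (\sum_i mu i)%N.
  by rewrite card_tagged sumnE big_map big_enum; apply: eq_bigr => i _; rewrite card_ord.
rewrite -card; apply: (dual_families_rank (F := F) (G := G) eP).
- by move=> v; apply: contravariant_functional.
- by move=> v c x y; rewrite -!(contravariantC _ v) contravariant_functional.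
- move=> [i j]; have [lin Ii hol _ _] := ellP i.
  exact: (form_functional_sing (pU i) lin Ii (hol j)).
- move=> [i j]; have [lin Ii _] := lmP i j.
  exact: (form_functional_sing (pU i) lin Ii (holomorphic_cst _ 1)).
move=> [i j] [i' j']; have [lin Ii hol _ away] := ellP i; have [lin' Ii' delta] := lmP i' j'.
rewrite /F /G (contravariant_form_functional (pU i) lin Ii (hol j) (pU i') lin' Ii') /=.
have [ii'|ii'] := eqVneq i i'.
  by case: _ / ii' in j' lin' Ii' delta *; rewrite delta eq_Tagged.
rewrite Ii'; last by apply: away => //; rewrite eq_sym (inj_eq p_inj).
by case: eqP => // /(congr1 tag) /eqP; rewrite /= (negbTE ii').
Qed.
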